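(* Let $A:L^2(\mathbb{R}_+)\rightarrow L^2(\mathbb{R}_+)$ be a bounded linear operator with the property that $A(\widetilde{\mathcal{M}})\subset\widetilde{\mathcal{M}}$. Then $A$ can be reconstructed from its values at $\rho_0(t)=\sqrt{2}\,e^{-t}$ and $\rho_1(t)=\sqrt{2}\,e^{-t}(2t-1)$ by means of the formula \[ A=\mathcal{H}^{-1}M_\psi C_\varphi\mathcal{H},\quad\text{where}\quad \psi=\mathcal{H}A\rho_0\quad\text{and}\quad \varphi=(\mathcal{H}A\rho_1)/(\mathcal{H}A\rho_0). \]
   Context: $\mathbb{D}$ is the open unit disk, $\mathbb{R}_+$ the half line $[0,\infty)$; $L^2(\mathbb{R}_+)$ consists of complex-valued functions. $H^2_{\mathbb{D}}$ is the Hardy space of analytic functions on $\mathbb{D}$ with square summable Taylor coefficients. The map $\mathcal{H}:L^2(\mathbb{R}_+)\to H^2_{\mathbb{D}}$, $(\mathcal{H}f)(z)=\frac{\sqrt{2}}{1+z}\int_0^\infty f(t)\exp\!\left(\frac{t(z-1)}{z+1}\right)dt$, is a surjective isometry. A nonzero $G\in H^2_{\mathbb{D}}$ is outer if there is a scalar $\lambda$ with $|\lambda|=1$ such that $G(z)=\lambda\exp\!\left(\frac{1}{2\pi}\int_0^{2\pi}\frac{e^{i\theta}+z}{e^{i\theta}-z}\log|G(e^{i\theta})|\,d\theta\right)$ for all $z\in\mathbb{D}$, where $G(e^{i\theta})$ denotes the boundary function. A function $f\in L^2(\mathbb{R}_+)$ is minimum phase if $\mathcal{H}f$ is outer; $\mathcal{M}$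 is the set of all minimum phase functions. For $\tau\ge 0$, $(T_\tau f)(t)=f(t-\tau)$ if $t\geq\tau$ and $0$ if $t<\tau$. $\widetilde{\mathcal{M}}=\{T_\tau f : f\in\mathcal{M},\ \tau\geq 0\}$. For analytic $\psi$ on $\mathbb{D}$ and analytic $\varphi:\mathbb{D}\to\mathbb{D}$ (possibly constant), $(M_\psi F)(z)=\psi(z)F(z)$ and $(C_\varphi F)(z)=F(\varphi(z))$ for $F$ analytic on $\mathbb{D}$. *)

(* Defs.v *)
From HB Require Import structures.
From mathcomp Require Import all_boot all_order all_algebra.
From mathcomp Require Import complex.
From mathcomp Require Import all_classical all_reals all_analysis.

Set Implicit Arguments.
Unset Strict Implicit.
Unset Printing Implicit Defensive.

Import Order.TTheory GRing.Theory Num.Theory.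
Import numFieldNormedType.Exports.

Local Open Scope classical_set_scope.
Local Open Scope ring_scope.
Local Open Scope complex_scope.

Section Definitions.
Variable R : realType.

(** Functions on the half line are total functions [R -> R[i]] of which only
    the values on [Rplus] matter; functions on the disk are total functions
    [R[i] -> R[i]] of which only the values on [disk] matter. *)

Definition Rplus : set R := `[0, +oo[.

Definition disk : set R[i] := [set z | `|z| < 1].

Definition cexp (z : R[i]) : R[i] :=
  (expR (complex.Re z))%:C * (cos (complex.Im z) +i* sin (complex.Im z)).

Definition cintegral (D : set R) (f : R -> R[i]) : R[i] :=
  (\int[lebesgue_measure]_(t in D) complex.Re (f t))%R +i*
  (\int[lebesgue_measure]_(t in D) complex.Im (f t))%R.

Definition L2norm (f : R -> R[i]) : \bar R :=
  'N[lebesgue_measure]_2%:E[(fun t => (Normc.normc (f t))%:E) \_ Rplus].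

Definition L2 : set (R -> R[i]) :=
  [set f | [/\ measurable_fun Rplus (fun t => complex.Re (f t)),
               measurable_fun Rplus (fun t => complex.Im (f t)) &
               (L2norm f < +oo)%E]].

(** Equality in L^2(R_+); an element of that space is a class of members of
    [L2] modulo [eqL2]. *)
Definition eqL2 (f g : R -> R[i]) : Prop := ae_eq lebesgue_measure Rplus f g.

(** A bounded linear operator on L^2(R_+), given on representatives. *)
Record bounded_linear_L2 (A : (R -> R[i]) -> R -> R[i]) : Prop := {
  blL2_stable : forall f, L2 f -> L2 (A f);
  blL2_compat : forall f g, L2 f -> L2 g -> eqL2 f g -> eqL2 (A f) (A g);
  blL2_linear : forall (a : R[i]) f g, L2 f -> L2 g ->
    eqL2 (A (fun t => a * f t + g t)) (fun t => a * A f t + A g t);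
  blL2_bounded : exists C : R, forall f, L2 f ->
    (L2norm (A f) <= C%:E * L2norm f)%E
}.

(** The regular module [R[i]^o] carries the topology of the complex plane. *)
Definition analytic_disk (F : R[i] -> R[i]) : Prop :=
  forall z, disk z -> derivable (F : R[i]^o -> R[i]^o) z 1.

Definition H2 : set (R[i] -> R[i]) :=
  [set F | exists a : nat -> R[i],
     cvgn (series (fun n => Normc.normc (a n) ^+ 2)) /\
     forall z, disk z ->
       (series (fun n => a n * z ^+ n) : nat -> R[i]^o) @ \oo --> (F z : R[i]^o)].

Definition calH (f : R -> R[i]) (z : R[i]) : R[i] :=
  (Num.sqrt 2)%:C / (1 + z) *
  cintegral Rplus (fun t => f t * cexp (t%:C * (z - 1) / (z + 1))).

(** [calH] is a bijection from [L2] modulo [eqL2] onto [H2], so on [H2] the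
    chosen preimage is unique modulo [eqL2]; outside the range of [calH] the
    value is the zero function. *)
Definition calHinv (F : R[i] -> R[i]) : R -> R[i] :=
  xget (fun=> 0) [set f | L2 f /\ forall z, disk z -> calH f z = F z].

Definition expi (t : R) : R[i] := cos t +i* sin t.

(** The radial limit G(e^{it}), which exists for almost every t when G is in
    [H2]; where it does not exist the value is arbitrary. *)
Definition boundary (G : R[i] -> R[i]) (t : R) : R[i] :=
  lim ((G (r%:C * expi t) : R[i]^o) @[r --> (1 : R)^'-]).

Definition outer (G : R[i] -> R[i]) : Prop :=
  [/\ H2 G, exists2 z, disk z & G z != 0 &
      exists2 lambda : R[i], `|lambda| = 1 &
        forall z, disk z -> G z = lambda * cexp ((2 * pi)^-1%:C *
          cintegral `[0, 2 * pi] (fun t =>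
            (expi t + z) / (expi t - z) * (ln (Normc.normc (boundary G t)))%:C))].

Definition min_phase : set (R -> R[i]) := [set f | L2 f /\ outer (calH f)].

Definition translate (tau : R) (f : R -> R[i]) (t : R) : R[i] :=
  if tau <= t then f (t - tau) else 0.

(** Translates of minimum phase functions, closed under [eqL2]. *)
Definition translated_min_phase : set (R -> R[i]) :=
  [set f | L2 f /\ exists g tau,
     [/\ min_phase g, 0 <= tau & eqL2 f (translate tau g)]].

Definition Mop (psi F : R[i] -> R[i]) (z : R[i]) : R[i] := psi z * F z.

Definition Cop (phi F : R[i] -> R[i]) (z : R[i]) : R[i] := F (phi z).

Definition rho0 (t : R) : R[i] := (Num.sqrt 2 * expR (- t))%:C.

Definition rho1 (t : R) : R[i] := (Num.sqrt 2 * expR (- t) * (2 * t - 1))%:C.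

End Definitions.

Arguments rho0 {R} t.
Arguments rho1 {R} t.

(* Main.v *)
Require Import Defs.
From mathcomp Require Import all_boot all_order all_algebra.
From mathcomp Require Import complex.
From mathcomp Require Import all_classical all_reals all_analysis.
From mathcomp Require Import measurable_realfun.
From mathcomp Require Import ring lra.
Import Order.TTheory GRing.Theory Num.Theory.
Import numFieldNormedType.Exports.
Local Open Scope classical_set_scope.
Local Open Scope ring_scope.
Set Implicit Arguments.
Unset Strict Implicit.
Unset Printing Implicit Defensive.

(** The theorem is an analogue of the Gleason-Kahane-Zelazko theorem: a linear
    functional which does not vanish where evaluations do not vanish is an
    evaluation, up to a factor.

    Fix a point [z] of the disk. Then [L f = calH (A f) z] is a bounded linear
    functional of the square integrable function [f]. An outer function has no zero,
    being the exponential of an integral, and translation by [tau] multiplies the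
    transform by [exp (tau (z - 1) / (z + 1))] ([calH_translate]). Hence [L f] is
    nonzero whenever [f] has minimum phase.

    This is tested on the functions with transform [(1 - a w) ^ n], [|a| < 1]. They
    have minimum phase ([outer_poly]): the Schwarz integral of [log |1 - a w|] is
    computed term by term from the power series of the logarithm ([schwarz_ln]).
    Let [rho k] be the Laguerre function with transform [w ^ k], and let
    [c k = L (rho k) / L (rho 0)]. Expanding [(1 - a w) ^ n], the sums over [k] of
    [binomial(n, k) (- a) ^ k (c k)] are nonzero for all [n] and all [a] in the disk.
    The location of the zeros of these polynomials in [a] forces [c k = (c 1) ^ k]
    ([zero_free_geometric]), by a comparison of elementary symmetric functions with
    powers of a sum as [n] tends to infinity. Boundedness of [L] gives [|c 1| < 1].

    So [L] agrees with [L (rho 0)] times evaluation at [c 1] on every [rho k]. The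
    Laguerre functions are complete ([laguerre_cvg]), so the two functionals are equal
    ([functional_evaluation]), which is the asserted formula with
    [psi z = L (rho 0)] and [phi z = c 1].

    Completeness rests on the density of the span of the decaying exponentials
    ([sqclosure_total]), proved by approximating steps, then Borel sets, then simple
    functions; exponentials lie in the span of the Laguerre functions because their
    Laguerre coefficients are an explicit geometric sequence ([sqclosure_theta_exp]).
    Density also makes the transform injective ([calH_inj]), so that its inverse is
    meaningful, and the Laguerre expansion of [f] is the Taylor expansion of its
    transform ([calH_series]), which yields membership in the Hardy space and
    holomorphy. *)

(** * Square integrable real functions on the half line *)

Section RealL2.
Variable R : realType.
Implicit Types (u v w : R -> R) (a : R).
Notation mu := (@lebesgue_measure R).
Notation HL := (@Rplus R).

Lemma measurable_Rplus : measurable (HL : set (g_sigma_algebraType (R.-ocitv.-measurable))).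
Proof. exact: measurable_itv. Qed.
#[local] Hint Resolve measurable_Rplus : core.

Definition sqint u :=
  measurable_fun HL u /\ mu.-integrable HL (EFin \o (fun t => u t ^+ 2)).

Definition inner u v : R := \int[mu]_(t in HL) (u t * v t).

Lemma measurable_sqint u : sqint u -> measurable_fun HL u.
Proof. by case. Qed.

Lemma sqint_le u v : measurable_fun HL u -> sqint v ->
  (forall t, HL t -> u t ^+ 2 <= v t ^+ 2) -> sqint u.
Proof.
move=> mu_ [mv iv] uv; split=> //; apply: le_integrable iv => //.
  by apply/measurable_EFinP; exact: measurable_funX.
by move=> t Ht /=; rewrite lee_fin !ger0_norm ?sqr_ge0// uv.
Qed.

Lemma integrable_mul_sqint u v : sqint u -> sqint v ->
  mu.-integrable HL (EFin \o (fun t => u t * v t)).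
Proof.
move=> [mu_ iu] [mv iv].
have := integrableD measurable_Rplus iu iv.
apply: le_integrable => //.
  by apply/measurable_EFinP; exact: measurable_funM.
move=> t _ /=; rewrite lee_fin [leRHS]ger0_norm ?addr_ge0 ?sqr_ge0//.
have := sqr_ge0 (u t - v t); have := sqr_ge0 (u t + v t) => ? ?.
rewrite ler_norml; apply/andP; split; nra.
Qed.

Lemma sqintD u v : sqint u -> sqint v -> sqint (fun t => u t + v t).
Proof.
move=> su sv; have [mu_ iu] := su; have [mv iv] := sv.
split; first exact: measurable_funD.
have := integrableD measurable_Rplus
  (integrableZl measurable_Rplus 2 iu) (integrableZl measurable_Rplus 2 iv).
apply: le_integrable => //.
  by apply/measurable_EFinP/measurable_funX; exact: measurable_funD.
move=> t _ /=; have := sqr_ge0 (u t); have := sqr_ge0 (v t) => v2 u2.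
rewrite lee_fin [leLHS]ger0_norm ?sqr_ge0// ger0_norm; last by lra.
by have := sqr_ge0 (u t - v t); nra.
Qed.

Lemma sqintZ a u : sqint u -> sqint (fun t => a * u t).
Proof.
move=> [mu_ iu]; split; first exact: measurable_funM.
have := integrableZl measurable_Rplus (a ^+ 2) iu.
apply: eq_integrable => // t _ /=.
by rewrite exprMn EFinM.
Qed.

Lemma sqintN u : sqint u -> sqint (fun t => - u t).
Proof.
move=> /(sqintZ (- 1)).
by rewrite (_ : (fun t => -1 * u t) = (fun t => - u t))//; apply/funext=> t; rewrite mulN1r.
Qed.

Lemma sqintB u v : sqint u -> sqint v -> sqint (fun t => u t - v t).
Proof. by move=> su sv; apply: sqintD => //; exact: sqintN. Qed.

Lemma sqint0 : sqint (fun=> 0).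
Proof.
split=> //; have := integrable0 mu HL.
by apply: eq_integrable => // t _ /=; rewrite expr0n.
Qed.

Lemma sqint_sum (I : Type) (s : seq I) (P : pred I) (u : I -> R -> R) :
  (forall i, sqint (u i)) -> sqint (fun t => \sum_(i <- s | P i) u i t).
Proof.
move=> su; elim: s => [|i s ih].
  by under eq_fun do rewrite big_nil; exact: sqint0.
under eq_fun do rewrite big_cons.
by case: (P i) => //; exact: sqintD.
Qed.

Lemma innerC u v : inner u v = inner v u.
Proof. by rewrite /inner; under eq_Rintegral do rewrite mulrC. Qed.

Lemma innerDl u v w : sqint u -> sqint v -> sqint w ->
  inner (fun t => u t + v t) w = inner u w + inner v w.
Proof.
move=> su sv sw; rewrite /inner -RintegralD//; [|exact: integrable_mul_sqint..].
by under eq_Rintegral do rewrite mulrDl.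
Qed.

Lemma innerZl a u v : sqint u -> sqint v ->
  inner (fun t => a * u t) v = a * inner u v.
Proof.
move=> su sv; rewrite /inner -RintegralZl//; last exact: integrable_mul_sqint.
by under eq_Rintegral do rewrite -mulrA.
Qed.

Lemma innerNl u v : sqint u -> sqint v -> inner (fun t => - u t) v = - inner u v.
Proof.
move=> su sv; rewrite -mulN1r -innerZl//.
by congr inner; apply/funext=> t; rewrite mulN1r.
Qed.

Lemma innerBl u v w : sqint u -> sqint v -> sqint w ->
  inner (fun t => u t - v t) w = inner u w - inner v w.
Proof. by move=> su sv sw; rewrite innerDl ?innerNl//; exact: sqintN. Qed.

Lemma innerDr u v w : sqint u -> sqint v -> sqint w ->
  inner w (fun t => u t + v t) = inner w u + inner w v.
Proof. by move=> *; rewrite innerC innerDl// ![inner _ w]innerC. Qed.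

Lemma innerZr a u v : sqint u -> sqint v ->
  inner v (fun t => a * u t) = a * inner v u.
Proof. by move=> *; rewrite innerC innerZl// innerC. Qed.

Lemma innerBr u v w : sqint u -> sqint v -> sqint w ->
  inner w (fun t => u t - v t) = inner w u - inner w v.
Proof. by move=> *; rewrite innerC innerBl// ![inner _ w]innerC. Qed.

Lemma inner0l u : inner (fun=> 0) u = 0.
Proof.
rewrite /inner; under eq_Rintegral do rewrite mul0r.
by rewrite Rintegral_cst// mul0r.
Qed.

Lemma inner_suml (I : Type) (s : seq I) (P : pred I) (u : I -> R -> R) v :
  (forall i, sqint (u i)) -> sqint v ->
  inner (fun t => \sum_(i <- s | P i) u i t) v = \sum_(i <- s | P i) inner (u i) v.
Proof.
move=> su sv; elim: s => [|i s ih].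
  by rewrite big_nil -[RHS](inner0l v); congr inner; apply/funext=> t; rewrite big_nil.
under [in LHS]eq_fun do rewrite big_cons.
by rewrite big_cons; case: (P i) => //; rewrite innerDl// ?ih//; exact: sqint_sum.
Qed.

Lemma inner_sumr (I : Type) (s : seq I) (P : pred I) (u : I -> R -> R) v :
  (forall i, sqint (u i)) -> sqint v ->
  inner v (fun t => \sum_(i <- s | P i) u i t) = \sum_(i <- s | P i) inner v (u i).
Proof.
by move=> su sv; rewrite innerC inner_suml//; apply: eq_bigr => i _; rewrite innerC.
Qed.

Lemma inner_ge0 u : 0 <= inner u u.
Proof. by apply: Rintegral_ge0 => t _; rewrite -expr2 sqr_ge0. Qed.

Lemma eq_inner u u' v v' : {in HL, u =1 u'} -> {in HL, v =1 v'} ->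
  inner u v = inner u' v'.
Proof. by move=> uu' vv'; apply: eq_Rintegral => t Ht; rewrite uu'// vv'. Qed.

Lemma innerDD u v : sqint u -> sqint v ->
  inner (fun t => u t + v t) (fun t => u t + v t) <= 2 * (inner u u + inner v v).
Proof.
move=> su sv; have sp := sqintD su sv.
have := inner_ge0 (fun t => u t - v t).
rewrite innerBl ?innerBr ?innerDl ?innerDr//; last exact: sqintB.
by rewrite (innerC v u); lra.
Qed.

Lemma cauchy_schwarz u v : sqint u -> sqint v ->
  inner u v ^+ 2 <= inner u u * inner v v.
Proof.
move=> su sv.
have H a : 0 <= inner u u - 2 * a * inner u v + a ^+ 2 * inner v v.
  have sav := sqintZ a sv.
  have := inner_ge0 (fun t => u t - a * v t).
  rewrite innerBl// ?innerBr//; last exact: sqintB.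
  rewrite !innerZl// !innerZr// (innerC v u).
  by congr (0 <= _); ring.
have := inner_ge0 v; rewrite le_eqVlt => /predU1P[v0|v0]; last first.
  have := H (inner u v / inner v v) => {}H.
  rewrite -subr_ge0.
  have -> : inner u u * inner v v - inner u v ^+ 2 = inner v v *
     (inner u u - 2 * (inner u v / inner v v) * inner u v + (inner u v / inner v v) ^+ 2 * inner v v).
    by field; rewrite gt_eqF.
  by apply: mulr_ge0 => //; exact: ltW.
rewrite -v0 mulr0.
have [->|nz] := eqVneq (inner u v) 0; first by rewrite expr0n.
have := H ((inner u u + 1) / (2 * inner u v)).
rewrite -v0 mulr0 addr0.
rewrite (_ : 2 * ((inner u u + 1) / (2 * inner u v)) * inner u v = inner u u + 1); last by field.
lra.
Qed.

Lemma inner_eq0 u : sqint u -> inner u u = 0 -> ae_eq mu HL u (fun=> 0).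
Proof.
move=> [mu_ iu] u0.
have : (\int[mu]_(t in HL) `|(u t ^+ 2)%:E|)%E = 0%E.
  under eq_integral do rewrite gee0_abs ?lee_fin ?sqr_ge0//.
  rewrite -[LHS]fineK; last exact: integrable_fin_num.
  by congr EFin; rewrite -[RHS]u0; congr fine; apply: eq_integral.
move/(ae_eq_integral_abs mu measurable_Rplus).
have /[swap]/[apply] : measurable_fun HL (EFin \o (fun t => u t ^+ 2)).
  by apply/measurable_EFinP; exact: measurable_funX.
apply: filterS => t /= /[swap] Ht /(_ Ht) [].
by move/eqP; rewrite sqrf_eq0 => /eqP.
Qed.

Lemma eq_inner_ae u u' v : sqint u -> sqint u' -> sqint v -> ae_eq mu HL u u' ->
  inner u v = inner u' v.
Proof.
move=> [mu_ _] [mu'_ _] [mv _] uu'; rewrite /inner /Rintegral; congr fine.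
apply: ae_eq_integral => //.
- by apply/measurable_EFinP; exact: measurable_funM.
- by apply/measurable_EFinP; exact: measurable_funM.
by move: uu'; apply: filterS => t /[swap] Ht /(_ Ht) ->.
Qed.

(** The integrands [(u - h n) ^ 2] are dominated by [2 u ^ 2 + 2 v ^ 2]. *)
Lemma dominated_cvg_inner (h : nat -> R -> R) u v :
  (forall n, sqint (h n)) -> sqint u -> sqint v ->
  {ae mu, forall t, HL t -> h n t @[n --> \oo] --> u t} ->
  (forall n t, HL t -> `|h n t| <= `|v t|) ->
  inner (fun t => u t - h n t) (fun t => u t - h n t) @[n --> \oo] --> (0 : R).
Proof.
move=> sh su sv hu hv.
pose g t := 2 * u t ^+ 2 + 2 * v t ^+ 2.
have ig : mu.-integrable HL (EFin \o g).
  have [_ iu] := su; have [_ iv] := sv.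
  have := integrableD measurable_Rplus
    (integrableZl measurable_Rplus 2 iu) (integrableZl measurable_Rplus 2 iv).
  by apply: eq_integrable.
pose f_ n := EFin \o (fun t => (u t - h n t) * (u t - h n t)).
have i_ n : mu.-integrable HL (f_ n) by apply: integrable_mul_sqint; exact: sqintB.
have [|||||_ _] := @dominated_convergence _ _ _ mu HL measurable_Rplus f_ (cst 0%E) (EFin \o g).
- by move=> n; exact: (measurable_int mu (i_ n)).
- exact: measurable_cst.
- move: hu; apply: filterS; first exact: (ae_filter_ringOfSetsType mu).
  move=> t /[swap] Ht /(_ Ht) ht.
  apply/fine_cvgP; split; first exact: nearW.
  rewrite [X in _ --> X](_ : _ = (u t - u t) * (u t - u t)); last by rewrite subrr mul0r.
  by apply: cvgM; apply: cvgB => //; exact: cvg_cst.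
- exact: ig.
- apply: nearW => t n Ht; rewrite /f_ /g /= lee_fin -expr2 ger0_norm ?sqr_ge0//.
  have : h n t ^+ 2 <= v t ^+ 2.
    by rewrite -(real_normK (num_real (h n t))) -(real_normK (num_real (v t))) lerXn2r ?nnegrE ?hv.
  have := sqr_ge0 (u t + h n t); nra.
rewrite integral0 => /fine_cvgP[_].
by apply: cvg_trans; apply: near_eq_cvg; apply: nearW => n.
Qed.

End RealL2.
#[local] Hint Resolve measurable_Rplus : core.

(** * Laplace integrals of exponential polynomials *)

Section Laplace.
Variable R : realType.
Notation mu := (@lebesgue_measure R).
Notation HL := (@Rplus R).

Lemma RplusE (t : R) : HL t <-> 0 <= t.
Proof. by rewrite /Rplus/= in_itv/= andbT. Qed.

Lemma Rintegral_FTC_y (F f : R -> R) : (forall x : R, is_derive x 1 F (f x)) ->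
  continuous f -> mu.-integrable HL (EFin \o f) ->
  F x @[x --> +oo] --> (0 : R) -> \int[mu]_(t in HL) f t = - F 0.
Proof.
move=> dF cf intf F0.
have dF' (x : R) : derivable F x 1 by have [] := dF x.
have cF : continuous F.
  by move=> x; apply: differentiable_continuous; exact/derivable1_diffP.
have Fn n : \int[mu]_(t in HL) (f \_ `[0, n.+1%:R]) t = F n.+1%:R - F 0.
  rewrite -Rintegral_mkcondr (_ : HL `&` _ = `[0, n.+1%:R]%classic); last first.
    by apply/setIidr => x; rewrite RplusE/= in_itv/= => /andP[].
  rewrite /Rintegral (@continuous_FTC2 _ f F)//.
  - exact: continuous_subspaceT.
  - split=> //.
    + by apply: cvg_at_right_filter; exact: cF.
    + by apply: cvg_at_left_filter; exact: cF.
  - by move=> x _; rewrite derive1E; have [_ ->] := dF x.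
have L1 : \int[mu]_(t in HL) (f \_ `[0, n.+1%:R]) t @[n --> \oo] --> 0 - F 0.
  under eq_fun do rewrite Fn.
  apply: cvgB; last exact: cvg_cst.
  have := cvg_comp _ _ (@cvgr_idn R) F0.
  by rewrite -cvg_shiftS.
suff L2 : \int[mu]_(t in HL) (f \_ `[0, n.+1%:R]) t @[n --> \oo] --> \int[mu]_(t in HL) f t.
  by rewrite (cvg_unique _ L2 L1) ?sub0r.
have mf : measurable_fun HL f by apply/measurable_EFinP; exact: measurable_int intf.
have [|||||_ _] := @dominated_convergence _ _ _ mu HL (@measurable_Rplus R)
  (fun n => EFin \o (f \_ `[0, n.+1%:R])) (EFin \o f) (fun t => `|(EFin \o f) t|%E).
- move=> n; apply/measurable_EFinP.
  have mI : measurable (`[0, n.+1%:R]%classic : set (g_sigma_algebraType (R.-ocitv.-measurable))) by exact: measurable_itv.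
  apply/(measurable_restrict f mI (@measurable_Rplus R)).
  by apply: (measurable_funS (@measurable_Rplus R)) mf; exact: subIsetl.
- exact/measurable_EFinP.
- apply: nearW => t /RplusE t0; apply/fine_cvgP; split; first exact: nearW.
  apply: cvg_near_cst; near=> n; rewrite /= patchE ifT// inE/= in_itv/= t0/=.
  apply: (@le_trans _ _ n%:R); last by rewrite ler_nat.
  by near: n; exact: nbhs_infty_ger.
- exact: (integrable_abse intf).
- apply: nearW => t n _ /=; rewrite patchE; case: ifP => // _.
  by rewrite normr0 lee_fin.
rewrite -[X in _ --> X -> _]fineK ?integrable_fin_num// => /fine_cvgP[_].
exact.
Unshelve. all: by end_near. Qed.

Lemma continuous_measurable_Rplus (f : R -> R) : continuous f -> measurable_fun HL f.
Proof.
move=> cf; apply: (@measurable_funS _ _ _ _ setT) => //.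
exact: continuous_measurable_fun.
Qed.

Lemma is_derive_expRN (a x : R) :
  is_derive x 1 (fun t => expR (- (a * t))) (- a * expR (- (a * x))).
Proof.
have -> : (fun t => expR (- (a * t))) = expR \o (fun t => - a * t).
  by apply/funext => t /=; rewrite mulNr.
have H : is_derive x 1 (fun t => - a * t) (- a).
  by apply: is_derive_eq; rewrite /GRing.scale/= mulr1.
apply: is_derive_eq; rewrite /GRing.scale/= mulNr; ring.
Qed.

Lemma cvgy_expRN (a : R) : 0 < a -> expR (- (a * t)) @[t --> +oo] --> (0 : R).
Proof.
move=> a0; apply: (cvg_comp (fun t => a * t) (fun t => expR (- t)) _ (@cvgr_expR R)).
by apply: gt0_cvgMry => //; exact: cvg_id.
Qed.

Lemma continuous_expRN (a : R) : continuous (fun t : R => expR (- (a * t))).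
Proof.
move=> x; apply: differentiable_continuous; apply/derivable1_diffP.
by have [] := is_derive_expRN a x.
Qed.

Lemma integrable_expRN (a : R) : 0 < a ->
  mu.-integrable HL (EFin \o (fun t => expR (- (a * t)))).
Proof.
move=> a0; apply/integrableP; split.
  by apply/measurable_EFinP; apply: continuous_measurable_Rplus; exact: continuous_expRN.
under eq_integral do rewrite /= ger0_norm ?expR_ge0//.
rewrite (@ge0_continuous_FTC2y _ _ (fun t => - a^-1 * expR (- (a * t))) 0 0)//.
- by rewrite -EFinB ltry.
- by apply: continuous_subspaceT; exact: continuous_expRN.
- by rewrite -[X in _ --> X](mulr0 (- a^-1)); apply: cvgM; [exact: cvg_cst|exact: cvgy_expRN].
- by apply: cvg_at_right_filter; apply: cvgM; [exact: cvg_cst|exact: continuous_expRN].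
- move=> x _; rewrite derive1E.
  have [dE vE] := is_derive_expRN a x.
  by rewrite deriveM// vE derive_cst scaler0 addr0 /GRing.scale/= mulrA mulrNN mulVf ?gt_eqF// mul1r.
Qed.

Lemma sqint_expRN (a : R) : 0 < a -> sqint (fun t => expR (- (a * t))).
Proof.
move=> a0; split.
  by apply: continuous_measurable_Rplus; exact: continuous_expRN.
have : 0 < 2 * a by lra.
move/integrable_expRN; apply: eq_integrable => // t _ /=.
by rewrite -expRM_natl; congr (expR _)%:E; ring.
Qed.

(** Powers are divided by factorials so that the Laplace transform of [dpow k]
    is [s ^- k.+1], without a coefficient. *)
Definition dpow (k : nat) (t : R) : R := t ^+ k / k`!%:R.

Lemma is_derive_dpow k (x : R) : is_derive x 1 (dpow k.+1) (dpow k x).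
Proof.
have -> : dpow k.+1 = (k.+1)`!%:R^-1 \*: ((id : R -> R) ^+ k.+1).
  by apply/funext => t; rewrite /dpow mulrC /= exprfctE.
apply: is_derive_eq.
rewrite /GRing.scale/= mulr1 /dpow factS natrM invfM.
by rewrite mulrACA mulVf ?pnatr_eq0// mul1r mulrC.
Qed.

Lemma dpow0E (t : R) : dpow 0 t = 1.
Proof. by rewrite /dpow expr0 fact0 divr1. Qed.

Lemma dpow_ge0 k (t : R) : 0 <= t -> 0 <= dpow k t.
Proof. by move=> t0; rewrite /dpow divr_ge0// exprn_ge0. Qed.

Lemma dpow_le_exp k (a t : R) : 0 < a -> 0 <= t ->
  dpow k t * expR (- (a * t)) <= (2 / a) ^+ k * expR (- (a / 2 * t)).
Proof.
move=> a0 t0.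
have e0 : dpow k (a / 2 * t) <= expR (a / 2 * t).
  have at0 : 0 <= a / 2 * t by rewrite mulr_ge0// divr_ge0// ltW.
  case: k => [|k]; first by rewrite dpow0E; apply: le_trans (expR_ge1Dx _); rewrite lerDl.
  apply: le_trans (expR_ge1Dxn k at0); rewrite /dpow lerDr//.
have -> : dpow k t = (2 / a) ^+ k * dpow k (a / 2 * t).
  rewrite /dpow mulrA -exprMn; congr (_ ^+ _ / _).
  by field; rewrite gt_eqF.
have -> : - (a / 2 * t) = a / 2 * t - (a * t) by field.
rewrite expRD -[leLHS]mulrA; apply: ler_wpM2l.
  by rewrite exprn_ge0// divr_ge0// ltW.
by apply: ler_wpM2r => //; exact: expR_ge0.
Qed.

(** Real and imaginary parts, up to sign, of [dpow k t * exp (- (a + i b) t)]. *)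
Definition ecos k (a b t : R) := dpow k t * expR (- (a * t)) * cos (b * t).
Definition esin k (a b t : R) := dpow k t * expR (- (a * t)) * sin (b * t).

Lemma is_derive_cosl (b x : R) : is_derive x 1 (fun t => cos (b * t)) (- (b * sin (b * x))).
Proof.
have H : is_derive x 1 (fun t => b * t) b.
  by apply: is_derive_eq; rewrite /GRing.scale/= mulr1.
have -> : (fun t => cos (b * t)) = cos \o (fun t => b * t) by [].
by apply: is_derive_eq; rewrite /GRing.scale/=; ring.
Qed.

Lemma is_derive_sinl (b x : R) : is_derive x 1 (fun t => sin (b * t)) (b * cos (b * x)).
Proof.
have H : is_derive x 1 (fun t => b * t) b.
  by apply: is_derive_eq; rewrite /GRing.scale/= mulr1.
have -> : (fun t => sin (b * t)) = sin \o (fun t => b * t) by [].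
by apply: is_derive_eq; rewrite /GRing.scale/=; ring.
Qed.

Lemma is_derive_ecosS k (a b x : R) : is_derive x 1 (ecos k.+1 a b)
  (ecos k a b x - a * ecos k.+1 a b x - b * esin k.+1 a b x).
Proof.
have d1 := is_derive_dpow k x; have d2 := is_derive_expRN a x; have d3 := is_derive_cosl b x.
have -> : ecos k.+1 a b = (dpow k.+1 * (fun t => expR (- (a * t)))) * (fun t => cos (b * t)) by [].
apply: is_derive_eq; rewrite /GRing.scale/= /ecos /esin.
by rewrite ?mulrfctE/=; ring.
Qed.

Lemma is_derive_esinS k (a b x : R) : is_derive x 1 (esin k.+1 a b)
  (esin k a b x - a * esin k.+1 a b x + b * ecos k.+1 a b x).
Proof.
have d1 := is_derive_dpow k x; have d2 := is_derive_expRN a x; have d3 := is_derive_sinl b x.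
have -> : esin k.+1 a b = (dpow k.+1 * (fun t => expR (- (a * t)))) * (fun t => sin (b * t)) by [].
apply: is_derive_eq; rewrite /GRing.scale/= /ecos /esin.
by rewrite ?mulrfctE/=; ring.
Qed.

Lemma is_derive_ecos0 (a b x : R) : is_derive x 1 (ecos 0 a b)
  (- a * ecos 0 a b x - b * esin 0 a b x).
Proof.
have d2 := is_derive_expRN a x; have d3 := is_derive_cosl b x.
have -> : ecos 0 a b = (fun t => expR (- (a * t))) * (fun t => cos (b * t)).
  by apply/funext=> t; rewrite /ecos dpow0E mul1r.
apply: is_derive_eq; rewrite /GRing.scale/= /esin dpow0E.
by rewrite ?mulrfctE/=; ring.
Qed.

Lemma is_derive_esin0 (a b x : R) : is_derive x 1 (esin 0 a b)
  (- a * esin 0 a b x + b * ecos 0 a b x).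
Proof.
have d2 := is_derive_expRN a x; have d3 := is_derive_sinl b x.
have -> : esin 0 a b = (fun t => expR (- (a * t))) * (fun t => sin (b * t)).
  by apply/funext=> t; rewrite /esin dpow0E mul1r.
apply: is_derive_eq; rewrite /GRing.scale/= /ecos dpow0E.
by rewrite ?mulrfctE/=; ring.
Qed.

Lemma exp_dominated (f : R -> R) (a C : R) : continuous f -> 0 < a ->
  (forall t, 0 <= t -> `|f t| <= C * expR (- (a * t))) ->
  [/\ sqint f, mu.-integrable HL (EFin \o f) & f t @[t --> +oo] --> (0 : R)].
Proof.
move=> cf a0 fC; have mf := continuous_measurable_Rplus cf; split.
- apply: (sqint_le mf (sqintZ C (sqint_expRN a0))) => t /RplusE t0.
  rewrite -(real_normK (num_real (f t))) lerXn2r ?nnegrE ?fC//.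
  exact: le_trans (fC _ t0).
- have := integrableZl (@measurable_Rplus R) C (integrable_expRN a0).
  apply: le_integrable => //; first exact/measurable_EFinP.
  move=> t /RplusE t0 /=; rewrite lee_fin; apply: le_trans (fC t t0) _.
  exact: ler_norm.
- apply/norm_cvg0P.
  apply: (@squeeze_cvgr _ _ _ _ (fun=> 0) (fun t => C * expR (- (a * t)))).
  + by exists 0; split=> // t /ltW t0; rewrite normr_ge0/= fC.
  + exact: cvg_cst.
  + by rewrite -[X in _ --> X](mulr0 C); apply: cvgM; [exact: cvg_cst|exact: cvgy_expRN].
Qed.

Lemma continuous_ecos k (a b : R) : continuous (ecos k a b).
Proof.
move=> x; apply: differentiable_continuous; apply/derivable1_diffP.
by case: k => [|k]; [have [] := is_derive_ecos0 a b x|have [] := is_derive_ecosS k a b x].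
Qed.

Lemma continuous_esin k (a b : R) : continuous (esin k a b).
Proof.
move=> x; apply: differentiable_continuous; apply/derivable1_diffP.
by case: k => [|k]; [have [] := is_derive_esin0 a b x|have [] := is_derive_esinS k a b x].
Qed.

Lemma norm_dpow_exp_le k (a t x : R) : 0 < a -> 0 <= t -> `|x| <= 1 ->
  `|dpow k t * expR (- (a * t)) * x| <= (2 / a) ^+ k * expR (- (a / 2 * t)).
Proof.
move=> a0 t0 x1; rewrite normrM ger0_norm; last by rewrite mulr_ge0 ?dpow_ge0 ?expR_ge0.
apply: le_trans (dpow_le_exp k a0 t0).
by apply: ler_piMr => //; rewrite mulr_ge0 ?dpow_ge0 ?expR_ge0.
Qed.

Lemma ecos_dominated k (a b : R) : 0 < a ->
  [/\ sqint (ecos k a b), mu.-integrable HL (EFin \o ecos k a b)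
    & ecos k a b t @[t --> +oo] --> (0 : R)].
Proof.
move=> a0; apply: (@exp_dominated _ (a / 2) ((2 / a) ^+ k)) => [||t t0].
- exact: continuous_ecos.
- by rewrite divr_gt0.
- by apply: norm_dpow_exp_le => //; rewrite ler_norml cos_geN1 cos_le1.
Qed.

Lemma esin_dominated k (a b : R) : 0 < a ->
  [/\ sqint (esin k a b), mu.-integrable HL (EFin \o esin k a b)
    & esin k a b t @[t --> +oo] --> (0 : R)].
Proof.
move=> a0; apply: (@exp_dominated _ (a / 2) ((2 / a) ^+ k)) => [||t t0].
- exact: continuous_esin.
- by rewrite divr_gt0.
- by apply: norm_dpow_exp_le => //; rewrite ler_norml sin_geN1 sin_le1.
Qed.

Lemma dpowS0 k : dpow k.+1 0 = 0.
Proof. by rewrite /dpow expr0n mul0r. Qed.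

Lemma Rintegral_lin3 (f g h : R -> R) (a b : R) :
  mu.-integrable HL (EFin \o f) -> mu.-integrable HL (EFin \o g) ->
  mu.-integrable HL (EFin \o h) ->
  mu.-integrable HL (EFin \o (fun t => f t + a * g t + b * h t)) /\
  \int[mu]_(t in HL) (f t + a * g t + b * h t) =
  \int[mu]_(t in HL) f t + a * \int[mu]_(t in HL) g t + b * \int[mu]_(t in HL) h t.
Proof.
move=> intf intg inth.
have mH := @measurable_Rplus R.
have iag : mu.-integrable HL (EFin \o (fun t => a * g t)) := integrableZl mH a intg.
have ibh : mu.-integrable HL (EFin \o (fun t => b * h t)) := integrableZl mH b inth.
have ifg : mu.-integrable HL (EFin \o (fun t => f t + a * g t)) := integrableD mH intf iag.
split; first exact: (integrableD mH ifg ibh).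
by rewrite RintegralD// RintegralD// !RintegralZl.
Qed.

Lemma continuous_lin3 (f g h : R -> R) (a b : R) : continuous f -> continuous g ->
  continuous h -> continuous (fun t => f t + a * g t + b * h t).
Proof.
move=> cf cg ch x; apply: cvgD; first apply: cvgD; first exact: cf.
- by apply: cvgM; [exact: cvg_cst|exact: cg].
- by apply: cvgM; [exact: cvg_cst|exact: ch].
Qed.

Let Ic k a b := \int[mu]_(t in HL) ecos k a b t.
Let Is k a b := \int[mu]_(t in HL) esin k a b t.

(** Integration by parts: the derivative of [ecos k.+1 a b] integrates to zero
    because that function vanishes at both ends. *)
Lemma Ic_recS k (a b : R) : 0 < a -> Ic k a b = a * Ic k.+1 a b + b * Is k.+1 a b.
Proof.
move=> a0.
have [_ i1 _] := ecos_dominated k b a0; have [_ i2 l2] := ecos_dominated k.+1 b a0.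
have [_ i3 _] := esin_dominated k.+1 b a0.
have [i4 e4] := Rintegral_lin3 (- a) (- b) i1 i2 i3.
have := Rintegral_FTC_y (F := ecos k.+1 a b) _ _ i4 l2.
have -> : ecos k.+1 a b 0 = 0 by rewrite /ecos dpowS0 !mul0r.
rewrite e4 oppr0 => H.
suff : Ic k a b + - a * Ic k.+1 a b + - b * Is k.+1 a b = 0 by lra.
apply: H.
- by move=> x; have := is_derive_ecosS k a b x; congr is_derive; rewrite !mulNr.
- by apply: continuous_lin3; [exact: continuous_ecos..|exact: continuous_esin].
Qed.

Lemma Is_recS k (a b : R) : 0 < a -> Is k a b = a * Is k.+1 a b - b * Ic k.+1 a b.
Proof.
move=> a0.
have [_ i1 _] := esin_dominated k b a0; have [_ i2 l2] := esin_dominated k.+1 b a0.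
have [_ i3 _] := ecos_dominated k.+1 b a0.
have [i4 e4] := Rintegral_lin3 (- a) b i1 i2 i3.
have := Rintegral_FTC_y (F := esin k.+1 a b) _ _ i4 l2.
have -> : esin k.+1 a b 0 = 0 by rewrite /esin dpowS0 !mul0r.
rewrite e4 oppr0 => H.
suff : Is k a b + - a * Is k.+1 a b + b * Ic k.+1 a b = 0 by lra.
apply: H.
- by move=> x; have := is_derive_esinS k a b x; congr is_derive; rewrite !mulNr.
- by apply: continuous_lin3; [exact: continuous_esin..|exact: continuous_ecos].
Qed.

Lemma Ic_rec0 (a b : R) : 0 < a -> a * Ic 0 a b + b * Is 0 a b = 1.
Proof.
move=> a0.
have [_ i2 l2] := ecos_dominated 0 b a0; have [_ i3 _] := esin_dominated 0 b a0.
have i1 := integrable0 mu HL.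
have [i4 e4] := Rintegral_lin3 (f := fun=> 0) (- a) (- b) i1 i2 i3.
have := Rintegral_FTC_y (F := ecos 0 a b) _ _ i4 l2.
rewrite e4 Rintegral_cst ?mul0r; last exact: measurable_Rplus.
have -> : ecos 0 a b 0 = 1 by rewrite /ecos dpow0E !mulr0 oppr0 expR0 cos0 !mul1r.
move=> H.
suff : 0 + - a * Ic 0 a b + - b * Is 0 a b = - 1 by lra.
apply: H.
- by move=> x; have := is_derive_ecos0 a b x; congr is_derive; rewrite !mulNr add0r.
- by apply: continuous_lin3; [move=> x; exact: cvg_cst|exact: continuous_ecos|exact: continuous_esin].
Qed.

Lemma Is_rec0 (a b : R) : 0 < a -> a * Is 0 a b - b * Ic 0 a b = 0.
Proof.
move=> a0.
have [_ i2 l2] := esin_dominated 0 b a0; have [_ i3 _] := ecos_dominated 0 b a0.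
have i1 := integrable0 mu HL.
have [i4 e4] := Rintegral_lin3 (f := fun=> 0) (- a) b i1 i2 i3.
have := Rintegral_FTC_y (F := esin 0 a b) _ _ i4 l2.
rewrite e4 Rintegral_cst ?mul0r; last exact: measurable_Rplus.
have -> : esin 0 a b 0 = 0 by rewrite /esin !mulr0 sin0 mulr0.
rewrite oppr0 => H.
suff : 0 + - a * Is 0 a b + b * Ic 0 a b = 0 by lra.
apply: H.
- by move=> x; have := is_derive_esin0 a b x; congr is_derive; rewrite !mulNr add0r.
- by apply: continuous_lin3; [move=> x; exact: cvg_cst|exact: continuous_esin|exact: continuous_ecos].
Qed.

Local Open Scope complex_scope.

(** The recursions [Ic_recS] and [Is_recS] are the real and imaginary parts of
    [c * I_(k + 1) = I_k], and the initial ones say that [c * I_0 = 1]. *)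
Lemma complex_Laplace_dpow k (c : R[i]) : 0 < complex.Re c ->
  Ic k (complex.Re c) (complex.Im c) +i* (- Is k (complex.Re c) (complex.Im c)) =
  c ^- k.+1.
Proof.
case: c => a b /= a0.
have c0 : a +i* b != 0 by rewrite eq_complex/= negb_and gt_eqF.
have H0 : (a +i* b) * (Ic 0 a b +i* (- Is 0 a b)) = 1.
  apply/eqP; rewrite eq_complex/=; apply/andP; split; apply/eqP.
    by have := Ic_rec0 b a0; lra.
  by have := Is_rec0 b a0; lra.
have HS j : (a +i* b) * (Ic j.+1 a b +i* (- Is j.+1 a b)) = Ic j a b +i* (- Is j a b).
  apply/eqP; rewrite eq_complex/=; apply/andP; split; apply/eqP.
    by rewrite (Ic_recS j b a0); ring.
  by rewrite (Is_recS j b a0); ring.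
elim: k => [|k ih]; apply: (mulfI c0).
  by rewrite H0 expr1 mulfV.
by rewrite HS ih [in RHS]exprS invfM mulVKf.
Qed.

Lemma sqint_dpow_expRN k (a : R) : 0 < a -> sqint (fun t => dpow k t * expR (- (a * t))).
Proof.
move=> a0; have [+ _ _] := ecos_dominated k 0 a0.
by rewrite /ecos; under eq_fun do rewrite mul0r cos0 mulr1.
Qed.

Lemma Rintegral_dpow_expRN k (a : R) : 0 < a ->
  \int[mu]_(t in HL) (dpow k t * expR (- (a * t))) = a ^- k.+1.
Proof.
move=> a0; have /= := @complex_Laplace_dpow k a%:C a0.
rewrite -rmorphXn -fmorphV => /(congr1 (@complex.Re R)) /= <-.
by rewrite /Ic /ecos; under [RHS]eq_Rintegral do rewrite mul0r cos0 mulr1.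
Qed.

End Laplace.

(** * Laguerre functions *)

Section Laguerre.
Variable R : realType.
Notation mu := (@lebesgue_measure R).
Notation HL := (@Rplus R).
Implicit Types (u v : R -> R) (p q : {poly R}).

(** The factor [sqrt 2] makes the transform of [ebasis k] exactly the [k]-th
    power of [(1 + z) / 2]. *)
Definition ebasis (k : nat) (t : R) : R := Num.sqrt 2 * (dpow k t * expR (- (1 * t))).

Lemma sqint_ebasis k : sqint (ebasis k).
Proof. by apply: sqintZ; exact: sqint_dpow_expRN. Qed.

Lemma dpowM i j (t : R) : dpow i t * dpow j t = 'C(i + j, i)%:R * dpow (i + j) t.
Proof.
rewrite /dpow exprD.
have := @bin_fact (i + j) i (leq_addr _ _); rewrite addKn => <-.
rewrite !natrM; field.
by rewrite !pnatr_eq0 -!lt0n bin_gt0 leq_addr !fact_gt0.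
Qed.

Lemma inner_ebasis i j : inner (ebasis i) (ebasis j) = 'C(i + j, i)%:R / 2 ^+ (i + j).
Proof.
have s0 : 0 < (2 : R) by [].
transitivity (inner (fun t : R => (2 * 'C(i + j, i)%:R) * (dpow (i + j) t * expR (- (1 * t))))
                    (fun t : R => dpow 0 t * expR (- (1 * t)))).
  apply: eq_Rintegral => t _; rewrite /ebasis dpow0E !mul1r.
  transitivity (Num.sqrt 2 ^+ 2 * (dpow i t * dpow j t) * expR (- t) ^+ 2); first by ring.
  by rewrite dpowM sqr_sqrtr//; ring.
rewrite innerZl; try by exact: sqint_dpow_expRN.
rewrite /inner (@eq_Rintegral _ _ _ mu HL (fun t => dpow (i + j) t * expR (- (2 * t)))); last first.
  by move=> t _; rewrite dpow0E -mulrA [1 * expR _]mul1r -expRD; congr (_ * expR _); ring.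
rewrite Rintegral_dpow_expRN// exprS invfM.
by field; rewrite expf_neq0.
Qed.

Definition theta p (t : R) : R := \sum_(k < size p) p`_k * ebasis k t.

Lemma theta_widen p n (t : R) : (size p <= n)%N ->
  theta p t = \sum_(k < n) p`_k * ebasis k t.
Proof.
move=> pn; rewrite /theta (big_ord_widen n (fun k => p`_k * ebasis k t) pn).
rewrite big_mkcond; apply: eq_bigr => k _; case: ltnP => // pk.
by rewrite nth_default// mul0r.
Qed.

Lemma sqint_theta p : sqint (theta p).
Proof. by apply: sqint_sum => k; apply: sqintZ; exact: sqint_ebasis. Qed.

Lemma thetaD p q t : theta (p + q) t = theta p t + theta q t.
Proof.
pose n := maxn (size p) (size q).
rewrite !(@theta_widen _ n) ?leq_maxl ?leq_maxr//; last exact: size_polyD.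
by rewrite -big_split; apply: eq_bigr => k _; rewrite coefD mulrDl.
Qed.

Lemma thetaZ a p t : theta (a *: p) t = a * theta p t.
Proof.
rewrite (@theta_widen _ (size p)); last exact: size_scale_leq.
by rewrite mulr_sumr; apply: eq_bigr => k _; rewrite coefZ mulrA.
Qed.

Lemma thetaXn k t : theta 'X^k t = ebasis k t.
Proof.
rewrite /theta size_polyXn big_ord_recr/= coefXn eqxx mul1r big1 ?add0r// => i _.
by rewrite coefXn ltn_eqF ?mul0r.
Qed.

Lemma theta0 t : theta 0 t = 0.
Proof. by rewrite /theta size_poly0 big_ord0. Qed.

Lemma theta_sum (I : Type) (s : seq I) (P : pred I) (F : I -> {poly R}) t :
  theta (\sum_(i <- s | P i) F i) t = \sum_(i <- s | P i) theta (F i) t.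
Proof.
by apply: (big_morph (theta ^~ t)) => [p q|]; [exact: thetaD|exact: theta0].
Qed.

Definition gram p q : R := inner (theta p) (theta q).

Lemma gramC p q : gram p q = gram q p. Proof. exact: innerC. Qed.

Lemma gramDl p p' q : gram (p + p') q = gram p q + gram p' q.
Proof.
rewrite /gram -innerDl; try by exact: sqint_theta.
by congr inner; apply/funext=> t; rewrite thetaD.
Qed.

Lemma gramZl a p q : gram (a *: p) q = a * gram p q.
Proof.
rewrite /gram -innerZl; try by exact: sqint_theta.
by congr inner; apply/funext=> t; rewrite thetaZ.
Qed.

Lemma gramXn i j : gram 'X^i 'X^j = 'C(i + j, i)%:R / 2 ^+ (i + j).
Proof. by rewrite -inner_ebasis; apply: eq_inner => t _; rewrite thetaXn. Qed.

Lemma poly_lin_ind (K : {poly R} -> Prop) : K 0 -> (forall p q, K p -> K q -> K (p + q)) ->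
  (forall a k, K (a *: 'X^k)) -> forall p, K p.
Proof.
move=> K0 KD KX p; rewrite -[p]coefK poly_def.
by apply: big_ind => // i _; exact: KX.
Qed.

(** The transform of [theta p] at [z] is [p.[(1 + z) / 2]]; this is the polynomial
    whose transform is the coordinate [z] itself. *)
Definition zpoly : {poly R} := 2 *: 'X - 1.

Lemma gram0l q : gram 0 q = 0.
Proof. by rewrite -(scale0r 0) gramZl mul0r. Qed.

Lemma zpolyMXn k : zpoly * 'X^k = 2 *: 'X^(k.+1) + (- 1) *: 'X^k.
Proof. by rewrite /zpoly mulrBl mul1r -scalerAl -exprS scaleN1r. Qed.

(** On the Hardy space side, multiplication by [z] is an isometry; on monomials
    this is Pascal's rule for the Gram matrix [gramXn]. *)
Lemma gram_zpoly p q : gram (zpoly * p) (zpoly * q) = gram p q.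
Proof.
elim/poly_lin_ind: p => [|p p' ih ih'|a i]; first by rewrite mulr0 !gram0l.
  by rewrite mulrDr !gramDl ih ih'.
rewrite -scalerAr !gramZl; congr (_ * _); rewrite gramC [RHS]gramC.
elim/poly_lin_ind: q => [|p p' ih ih'|b j]; first by rewrite mulr0 !gram0l.
  by rewrite mulrDr !gramDl ih ih'.
rewrite -scalerAr !gramZl; congr (_ * _); rewrite !zpolyMXn [RHS]gramC.
rewrite gramDl !gramZl ![gram _ (_ + _)]gramC !gramDl !gramZl !gramXn.
have -> : 'C(i.+1 + j.+1, i.+1) = ('C(i + j.+1, i) + 'C(i.+1 + j, i.+1))%N.
  by rewrite addSn binS addnC addnS addSn.
rewrite natrD !addnS !addSn !exprS.
field.
by rewrite expf_neq0.
Qed.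

(** Together with [gram_zpoly] this makes the powers of [zpoly] orthonormal. *)
Lemma gram1_zpoly q : gram 1 (zpoly * q) = 0.
Proof.
rewrite gramC.
elim/poly_lin_ind: q => [|p p' ih ih'|b j]; first by rewrite mulr0 gram0l.
  by rewrite mulrDr gramDl ih ih' addr0.
rewrite -scalerAr gramZl zpolyMXn gramDl !gramZl.
rewrite -(expr0 ('X : {poly R})) !gramXn !addn0 !binn exprS.
by field; rewrite expf_neq0.
Qed.

Definition rho n := theta (zpoly ^+ n).

Lemma sqint_rho n : sqint (rho n). Proof. exact: sqint_theta. Qed.

Lemma inner_rho n m : inner (rho n) (rho m) = (n == m)%:R.
Proof.
rewrite -/(gram _ _).
elim: n m => [|n ih] [|m].
- by rewrite expr0 -(expr0 ('X : {poly R})) gramXn bin0 divr1.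
- by rewrite expr0 exprS gram1_zpoly.
- by rewrite expr0 exprS gramC gram1_zpoly.
by rewrite !exprS gram_zpoly ih eqSS.
Qed.

Lemma inner_rho_sum N (b : nat -> R) (i : 'I_N) :
  inner (fun t => \sum_(k < N) b k * rho k t) (rho i) = b i.
Proof.
have sb (k : 'I_N) : sqint (fun t => b k * rho k t) by apply: sqintZ; exact: sqint_rho.
rewrite inner_suml//; last exact: sqint_rho.
rewrite (bigD1 i)//= innerZl; try exact: sqint_rho.
rewrite inner_rho eqxx mulr1 big1 ?addr0// => j ji.
rewrite innerZl; try exact: sqint_rho.
by move: ji; rewrite inner_rho -val_eqE /= => /negPf ->; rewrite mulr0.
Qed.

Lemma inner_rho_sum_self N (b : nat -> R) :
  inner (fun t => \sum_(k < N) b k * rho k t) (fun t => \sum_(k < N) b k * rho k t) =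
  \sum_(k < N) b k ^+ 2.
Proof.
have sb (k : 'I_N) : sqint (fun t => b k * rho k t) by apply: sqintZ; exact: sqint_rho.
rewrite inner_sumr//; last exact: sqint_sum.
apply: eq_bigr => k _; rewrite innerZr; [|exact: sqint_rho|exact: sqint_sum].
by rewrite inner_rho_sum expr2.
Qed.

Definition laguerre_coef n u := inner u (rho n).
Definition laguerre_sum N u (t : R) := \sum_(n < N) laguerre_coef n u * rho n t.

Lemma bessel_eq N u : sqint u ->
  inner (fun t => u t - laguerre_sum N u t) (fun t => u t - laguerre_sum N u t) =
  inner u u - \sum_(n < N) laguerre_coef n u ^+ 2.
Proof.
move=> su.
have sr n : sqint (fun t => laguerre_coef n u * rho n t) by apply: sqintZ; exact: sqint_rho.
have ss : sqint (laguerre_sum N u) by exact: sqint_sum.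
have us : inner u (laguerre_sum N u) = \sum_(n < N) laguerre_coef n u ^+ 2.
  rewrite inner_sumr//; apply: eq_bigr => i _.
  by rewrite innerZr//; exact: sqint_rho.
have sus : inner (laguerre_sum N u) (laguerre_sum N u) = \sum_(n < N) laguerre_coef n u ^+ 2.
  exact: (inner_rho_sum_self N (fun n => laguerre_coef n u)).
rewrite innerBl ?innerBr//; last exact: sqintB.
by rewrite (innerC _ u) us sus; ring.
Qed.

Lemma bessel_le N u : sqint u -> \sum_(n < N) laguerre_coef n u ^+ 2 <= inner u u.
Proof. by move=> su; rewrite -subr_ge0 -bessel_eq//; exact: inner_ge0. Qed.

Lemma inner_theta_exp p (s : R) : 0 < s ->
  inner (theta p) (fun t : R => Num.sqrt 2 * expR (- (s * t))) = 2 / (1 + s) * p.[(1 + s)^-1].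
Proof.
move=> s0; have s1 : 0 < 1 + s by lra.
have se : sqint (fun t : R => Num.sqrt 2 * expR (- (s * t))).
  by apply: sqintZ; exact: sqint_expRN.
elim/poly_lin_ind: p => [|p q ihp ihq|a k].
- by rewrite horner0 mulr0 -[RHS](inner0l (fun t : R => Num.sqrt 2 * expR (- (s * t)))); congr inner; apply/funext=> t; rewrite theta0.
- rewrite hornerD mulrDr -ihp -ihq -innerDl; try by [|exact: sqint_theta].
  by congr inner; apply/funext=> t; rewrite thetaD.
rewrite hornerZ hornerXn mulrCA.
transitivity (inner (fun t => a * ebasis k t) (fun t : R => Num.sqrt 2 * expR (- (s * t)))).
  by congr inner; apply/funext=> t; rewrite thetaZ thetaXn.
rewrite innerZl//; last exact: sqint_ebasis.
congr (_ * _).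
transitivity (inner (fun t : R => 2 * (dpow k t * expR (- (1 * t)))) (fun t : R => expR (- (s * t)))).
  apply: eq_Rintegral => t _; rewrite /ebasis.
  by rewrite -[X in X * (_ * _) * _](@sqr_sqrtr _ 2)//; ring.
rewrite innerZl; [|exact: sqint_dpow_expRN|exact: sqint_expRN].
rewrite /inner (@eq_Rintegral _ _ _ mu HL (fun t => dpow k t * expR (- ((1 + s) * t)))); last first.
  by move=> t _; rewrite -mulrA -expRD; congr (_ * expR _); ring.
by rewrite Rintegral_dpow_expRN// exprS exprVn invfM mulrA.
Qed.

End Laguerre.

(** * Density of the exponential polynomials *)

Section Closure.
Variable R : realType.
Notation mu := (@lebesgue_measure R).
Notation HL := (@Rplus R).
Implicit Types (u v : R -> R).

Variable S : (R -> R) -> Prop.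
Hypothesis S_sqint : forall u, S u -> sqint u.
Hypothesis S_0 : S (fun=> 0).
Hypothesis S_D : forall u v, S u -> S v -> S (fun t => u t + v t).
Hypothesis S_Z : forall a u, S u -> S (fun t => a * u t).

Definition sqclosure u :=
  sqint u /\ forall e : R, 0 < e ->
    exists2 v, S v & inner (fun t => u t - v t) (fun t => u t - v t) < e.

Lemma sqclosureD u v : sqclosure u -> sqclosure v ->
  sqclosure (fun t => u t + v t).
Proof.
move=> [su cu] [sv cv]; split=> [|e e0]; first exact: sqintD.
have e4 : 0 < e / 4 by rewrite divr_gt0.
have [p Sp up] := cu _ e4; have [q Sq vq] := cv _ e4.
exists (fun t => p t + q t); first exact: S_D.
rewrite (_ : (fun t => _) = (fun t => (u t - p t) + (v t - q t))); last first.
  by apply/funext=> t; ring.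
apply: le_lt_trans (innerDD _ _) _; try by apply: sqintB => //; exact: S_sqint.
by lra.
Qed.

Lemma sqclosureZ a u : sqclosure u -> sqclosure (fun t => a * u t).
Proof.
move=> [su cu]; split=> [|e e0]; first exact: sqintZ.
have a1 : 0 < a ^+ 2 + 1 by have := sqr_ge0 a; lra.
have [p Sp up] := cu _ (divr_gt0 e0 a1).
have sp : sqint (fun t => u t - p t) by apply: sqintB => //; exact: S_sqint.
exists (fun t => a * p t); first exact: S_Z.
rewrite (_ : (fun t => _) = (fun t => a * (u t - p t))); last first.
  by apply/funext=> t; rewrite mulrBr.
rewrite innerZl ?innerZr//; last exact: sqintZ.
rewrite mulrA -expr2; move: up; rewrite ltr_pdivlMr// => up.
have := inner_ge0 (fun t => u t - p t); nra.
Qed.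

Lemma sqclosure_lim u (h : nat -> R -> R) : sqint u ->
  (forall n, sqclosure (h n)) ->
  inner (fun t => u t - h n t) (fun t => u t - h n t) @[n --> \oo] --> (0 : R) ->
  sqclosure u.
Proof.
move=> su ch hu; split=> // e e0.
have e4 : 0 < e / 4 by rewrite divr_gt0.
have [n _ /(_ n (leqnn _)) /= un] := cvgr_lt _ hu _ e4.
have [sn /(_ _ e4)[p Sp pn]] := ch n; exists p => //.
rewrite (_ : (fun t => _) = (fun t => (u t - h n t) + (h n t - p t))); last first.
  by apply/funext=> t; ring.
apply: le_lt_trans (innerDD _ _) _; try by apply: sqintB => //; exact: S_sqint.
by lra.
Qed.

Lemma sqclosure_ae u (h : nat -> R -> R) v : sqint u -> sqint v ->
  (forall n, sqclosure (h n)) ->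
  {ae mu, forall t, HL t -> h n t @[n --> \oo] --> u t} ->
  (forall n t, HL t -> `|h n t| <= `|v t|) ->
  sqclosure u.
Proof.
move=> su sv ch hu hv; apply: (sqclosure_lim su ch).
by apply: dominated_cvg_inner hu hv => // n; have [] := ch n.
Qed.

Lemma sqclosure_sub u : S u -> sqclosure u.
Proof.
move=> Su; split=> [|e e0]; first exact: S_sqint.
exists u => //; rewrite (_ : (fun t => _) = (fun=> 0)) ?inner0l//.
by apply/funext=> t; rewrite subrr.
Qed.

Lemma sqclosure0 : sqclosure (fun=> 0).
Proof.
exact: sqclosure_sub.
Qed.

Lemma sqclosure_sum (I : Type) (s : seq I) (P : pred I) (u : I -> R -> R) :
  (forall i, sqclosure (u i)) -> sqclosure (fun t => \sum_(i <- s | P i) u i t).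
Proof.
move=> su; elim: s => [|i s ih].
  by under eq_fun do rewrite big_nil; exact: sqclosure0.
under eq_fun do rewrite big_cons.
by case: (P i) => //; exact: sqclosureD.
Qed.

(** The polynomials [(1 - x ^ n) ^ (2 ^ n)] separate the two sides of [1 / 2].
    Below [1 / 2], Bernoulli's inequality bounds them from below by
    [1 - (2 x) ^ n]. *)
Lemma cvg_threshold_lt (x : R) : 0 <= x -> x < 1 / 2 ->
  (1 - x ^+ n) ^+ (2 ^ n) @[n --> \oo] --> (1 : R).
Proof.
move=> x0 x2.
apply: (@squeeze_cvgr _ _ _ _ (fun n => 1 - (2 * x) ^+ n) (fun=> 1)); last exact: cvg_cst.
  apply: nearW => n; have xn0 : 0 <= x ^+ n by rewrite exprn_ge0.
  have xn1 : x ^+ n <= 1 by rewrite exprn_ile1//; lra.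
  apply/andP; split; last by rewrite exprn_ile1//; lra.
  have -> : (2 * x) ^+ n = x ^+ n *+ (2 ^ n) by rewrite exprMn mulrC -natrX mulr_natr.
  elim: (2 ^ n)%N => [|m ih]; first by rewrite expr0 mulr0n subr0.
  rewrite exprS mulrS; set y := x ^+ n in xn0 xn1 ih *.
  have yn : 0 <= y *+ m by rewrite mulrn_wge0.
  apply: le_trans (_ : (1 - y) * (1 - y *+ m) <= _); first by nra.
  by apply: ler_wpM2l => //; lra.
rewrite -[X in _ --> X]subr0; apply: cvgB; first exact: cvg_cst.
apply: cvg_expr; rewrite ger0_norm; lra.
Qed.

(** Above [1 / 2], [(1 - y) ^ m * (1 + m y) <= 1] bounds them by [(2 x) ^ - n]. *)
Lemma cvg_threshold_gt (x : R) : x <= 1 -> 1 / 2 < x ->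
  (1 - x ^+ n) ^+ (2 ^ n) @[n --> \oo] --> (0 : R).
Proof.
move=> x1 x2.
apply: (@squeeze_cvgr _ _ _ _ (fun=> 0) (fun n => (2 * x)^-1 ^+ n)); last 2 first.
- exact: cvg_cst.
- apply: cvg_expr; rewrite ger0_norm ?invr_ge0; last by lra.
  by rewrite invf_lt1; lra.
apply: nearW => n; have xn0 : 0 <= x ^+ n by rewrite exprn_ge0//; lra.
have xn1 : x ^+ n <= 1 by rewrite exprn_ile1//; lra.
rewrite exprn_ge0 ?subr_ge0//=.
rewrite exprVn -[leRHS]mul1r ler_pdivlMr ?exprn_gt0//; last by lra.
have -> : (2 * x) ^+ n = x ^+ n *+ (2 ^ n) by rewrite exprMn mulrC -natrX mulr_natr.
set y := x ^+ n in xn0 xn1 *; set m := (2 ^ n)%N.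
suff : (1 - y) ^+ m * (1 + y *+ m) <= 1.
  have : 0 <= (1 - y) ^+ m by rewrite exprn_ge0// subr_ge0.
  lra.
elim: m => [|m ih]; first by rewrite expr0 mulr0n; lra.
have a0 : 0 <= (1 - y) ^+ m by rewrite exprn_ge0// subr_ge0.
have yn : 0 <= y *+ m by rewrite mulrn_wge0.
apply: le_trans ih; rewrite exprS mulrS -mulrA mulrCA; apply: ler_wpM2l => //.
nra.
Qed.

Hypothesis S_exp : forall s : R, 0 < s -> sqclosure (fun t => expR (- (s * t))).

(** A step at [T] is the limit of the threshold polynomials in [exp (- c t)]; by
    the binomial formula these are combinations of decaying exponentials. *)
Lemma sqclosure_ray (T : R) :
  sqclosure (fun t => expR (- (1 * t)) * (\1_(`[T, +oo[%classic) t)).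
Proof.
have cu : sqclosure (fun t => expR (- (1 * t))) by exact: S_exp.
have [T0|T0] := leP T 0.
  have [su _] := cu.
  apply: (@sqclosure_ae _ (fun _ t => expR (- (1 * t))) (fun t => expR (- (1 * t)))) => //.
    apply: (sqint_le _ su).
      apply: measurable_funM; first exact: (measurable_sqint su).
      exact: measurable_indic.
    move=> t /RplusE t0; rewrite indicE mem_set ?mulr1//=.
    by rewrite in_itv/= andbT; lra.
  apply: nearW => t /RplusE t0; rewrite indicE mem_set ?mulr1/=; first exact: cvg_cst.
  by rewrite in_itv/= andbT; lra.
(* With this rate, [exp (- c t)] crosses [1 / 2] at [t = T]. *)
pose c := ln 2 / T.
have c0 : 0 < c by rewrite divr_gt0// ln_gt0// ltr1n.
have [su _] := cu.
pose h n t := expR (- (1 * t)) * (1 - expR (- (c * t)) ^+ n) ^+ (2 ^ n).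
have half : 1 / 2 = expR (- ln 2) :> R by rewrite expRN lnK ?posrE// div1r.
have Tc t : (expR (- (c * t)) < 1 / 2) = (T < t).
  rewrite half ltr_expR ltrN2.
  by rewrite /c mulrAC ltr_pdivlMr// ltr_pM2l// ln_gt0// ltr1n.
have Tc' t : (1 / 2 < expR (- (c * t))) = (t < T).
  rewrite half ltr_expR ltrN2.
  by rewrite /c mulrAC ltr_pdivrMr// ltr_pM2l// ln_gt0// ltr1n.
have su' : sqint (fun t => expR (- (1 * t)) * (\1_(`[T, +oo[%classic) t)).
  apply: (sqint_le _ su).
    apply: measurable_funM; first exact: (measurable_sqint su).
    exact: measurable_indic.
  move=> t /RplusE t0; rewrite exprMn ler_piMr ?sqr_ge0// indicE.
apply: (@sqclosure_ae _ h (fun t => expR (- (1 * t)))) => //.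
- move=> n.
  have -> : h n = fun t => \sum_(i < (2 ^ n).+1)
      ((-1) ^+ i *+ 'C(2 ^ n, i)) * expR (- ((1 + (c * (n * i)%:R)) * t)).
    apply/funext => t; rewrite /h exprBn mulr_sumr; apply: eq_bigr => i _.
    rewrite expr1n mulr1 -exprM -mulrnAl mulrCA; congr (_ * _).
    by rewrite -expRM_natl -expRD; congr expR; ring.
  apply: sqclosure_sum => i; apply: sqclosureZ; apply: S_exp.
  by rewrite ltr_wpDr// mulr_ge0// ltW.
- exists [set T]; split; [exact: measurable_set1|exact: lebesgue_measure_set1|].
  move=> t /= /not_implyP[/RplusE t0]; apply: contra_notP => /eqP.
  rewrite neq_lt indicE => /orP[tT|Tt].
    rewrite memNset/=; last by rewrite in_itv/= andbT leNgt tT.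
    apply: cvgM; first exact: cvg_cst.
    apply: cvg_threshold_gt; last by rewrite Tc'.
    by rewrite -expR0 ler_expR oppr_le0 mulr_ge0// ltW.
  rewrite mem_set/=; last by rewrite in_itv/= andbT ltW.
  apply: cvgM; first exact: cvg_cst.
  by apply: cvg_threshold_lt; rewrite ?expR_ge0 ?Tc.
- move=> n t /RplusE t0; rewrite /h normrM ler_piMr// normrX exprn_ile1//.
  have e1 : expR (- (c * t)) ^+ n <= 1.
    rewrite exprn_ile1 ?expR_ge0// -expR0 ler_expR oppr_le0 mulr_ge0// ltW//.
  have e0 : 0 <= expR (- (c * t)) ^+ n by rewrite exprn_ge0// expR_ge0.
  by rewrite ger0_norm; lra.
Qed.

Let wexp (t : R) := expR (- (1 * t)).

Lemma sqint_wexp_indic (E : set R) : measurable (E : set (measurableTypeR R)) ->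
  sqint (fun t => wexp t * \1_E t).
Proof.
move=> mE; have se := sqint_expRN (ltr01 : 0 < (1 : R)).
apply: (sqint_le _ se).
  apply: measurable_funM; first exact: (measurable_sqint se).
  exact: measurable_indic.
by move=> t _; rewrite exprMn ler_piMr ?sqr_ge0// indicE; case: (t \in E); rewrite ?expr1n ?expr0n.
Qed.

(** Rays form a pi-system generating the Borel sets, and the sets whose weighted
    indicator lies in the closure form a Dynkin system. *)
Lemma sqclosure_indic (E : set R) : measurable (E : set (measurableTypeR R)) ->
  sqclosure (fun t => wexp t * \1_E t).
Proof.
have cu : sqclosure wexp by exact: S_exp.
move=> mE.
have genE : @measurable _ (measurableTypeR R) = <<s @RGenCInfty.G R >> := RGenCInfty.measurableE R.
apply: (@dynkin_induction _ (measurableTypeR R) (@RGenCInfty.G R)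
   (fun E => sqclosure (fun t => wexp t * \1_E t))); last by rewrite -genE.
- exact: genE.
- move=> A B [x ->] [y ->]; exists (Num.max x y).
  by apply/seteqP; split=> t /=; rewrite !in_itv/= !andbT ge_max => /andP.
- by move: cu; congr sqclosure; apply/funext => t; rewrite indicT mulr1.
- move=> A [x ->]; exact: sqclosure_ray.
- move=> E' mE' cS.
  have := sqclosureD cu (sqclosureZ (- 1) cS).
  congr sqclosure; apply/funext => t; rewrite !indicE in_setC.
  by case: (t \in E'); rewrite /= ?mulr0 ?mulr1; ring.
- move=> F mF tF cF.
  pose U n := \big[setU/set0]_(i < n) F i.
  have cU n : sqclosure (fun t => wexp t * \1_(U n) t).
    elim: n => [|n ih].
      have := sqclosure0; congr sqclosure; apply/funext => t.
      by rewrite /U big_ord0 indicE in_set0 mulr0.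
    have := sqclosureD ih (cF n); congr sqclosure; apply/funext => t.
    rewrite /U big_ord_recr /= -mulrDr; congr (_ * _); rewrite !indicE in_setU.
    case: (boolP (t \in F n)) => [tn|]; last by rewrite orbF addr0.
    rewrite orbT memNset ?add0r// -bigcup_mkord => -[i /= ni Fit].
    have /trivIsetP/(_ i n I I) := tF.
    rewrite neq_ltn ni => /(_ isT) /seteqP[/(_ t) + _]; apply; split=> //.
    by move: tn; rewrite inE.
  have mU n : measurable (U n : set (measurableTypeR R)) by apply: bigsetU_measurable => i _.
  have [se _] := cu.
  apply: (@sqclosure_ae _ (fun n t => wexp t * \1_(U n) t) wexp) => //.
  + by apply: sqint_wexp_indic; exact: bigcup_measurable.
  + apply: nearW => t _; apply: cvgM; first exact: cvg_cst.
    have [[k _ Fkt]|nF] := pselect ((\bigcup_k F k) t).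
      apply: cvg_near_cst; near=> n.
      have Un : U n t.
        rewrite /U -bigcup_mkord; exists k => //=.
        by near: n; exact: nbhs_infty_gt.
      by rewrite !indicE !mem_set//; exists k.
    apply: cvg_near_cst; apply: nearW => n; rewrite !indicE !memNset//.
    by rewrite /U -bigcup_mkord => -[k _ Fkt]; apply: nF; exists k.
  + move=> n t _; rewrite normrM ler_piMr// indicE.
    by case: (t \in U n); rewrite ?normr0 ?normr1.
Unshelve. all: by end_near. Qed.

Import HBSimple HBNNSimple.

(** The weight [exp (- t)] is put back by approximating [u * exp] by simple
    functions, which keeps all approximants below [u]. *)
Lemma sqclosure_ge0 u : sqint u -> (forall t, 0 <= u t) -> sqclosure u.
Proof.
move=> su u0.
have se := sqint_expRN (ltr01 : 0 < (1 : R)).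
pose v t := (u t * expR t)%:E.
have mv : measurable_fun HL v.
  apply/measurable_EFinP; apply: measurable_funM; first exact: (measurable_sqint su).
  by apply: continuous_measurable_Rplus; exact: continuous_expR.
have [g [ndg gv]] := approximation (@measurable_Rplus R) mv
  (fun t _ => ltac:(rewrite lee_fin mulr_ge0 ?expR_ge0//)).
have gv' t : HL t -> g n t @[n --> \oo] --> u t * expR t.
  by move=> /gv /fine_cvgP[_].
have ew t : wexp t * (u t * expR t) = u t.
  by rewrite mulrCA -expRD mul1r addNr expR0 mulr1.
apply: (@sqclosure_ae _ (fun n t => wexp t * g n t) u) => //.
- move=> n.
  rewrite (_ : (fun t => _) = (fun t => \sum_(y <- finmap.enum_fset (fset_set (range (g n))))
     y * (wexp t * \1_(g n @^-1` [set y]) t))); last first.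
    apply/funext => t; rewrite fimfunE fsbig_finite//= mulr_sumr.
    by apply: eq_bigr => y _; rewrite mulrCA.
  apply: sqclosure_sum => y; apply: sqclosureZ; apply: sqclosure_indic.
  exact: measurable_funPTI.
- apply: nearW => t Ht; rewrite -[X in _ --> X]ew; apply: cvgM; first exact: cvg_cst.
  exact: gv'.
- move=> n t Ht; rewrite -[in leRHS]ew !ger0_norm ?mulr_ge0 ?expR_ge0//.
  apply: ler_wpM2l; first exact: expR_ge0.
  rewrite -(cvg_lim _ (gv' t Ht))//; apply: (nondecreasing_cvgn_le (u_ := fun n => g n t)).
    by move=> i j ij; have /lefP := ndg i j ij.
  by apply/cvg_ex; exists (u t * expR t); exact: gv'.
Qed.

(** The subspace is arbitrary because the lemma serves twice: for the exponential
    polynomials, and for the functions orthogonal to a given one. *)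
Lemma sqclosure_total u : sqint u -> sqclosure u.
Proof.
move=> su.
have mp : measurable_fun HL (fun t => Num.max (u t) 0).
  by apply: measurable_maxr => //; exact: measurable_sqint.
have mn : measurable_fun HL (fun t => Num.max (- u t) 0).
  by apply: measurable_maxr => //; apply: measurable_sqint; exact: sqintN.
have maxle (x : R) : Num.max x 0 ^+ 2 <= x ^+ 2.
  by rewrite maxEle; case: ifP => // _; rewrite expr0n sqr_ge0.
have sp : sqint (fun t => Num.max (u t) 0).
  by apply: (sqint_le mp su) => t _; exact: maxle.
have sn : sqint (fun t => Num.max (- u t) 0).
  by apply: (sqint_le mn su) => t _; rewrite -[leRHS]sqrrN; exact: maxle.
have cp : sqclosure (fun t => Num.max (u t) 0).
  by apply: sqclosure_ge0 => // t; rewrite le_max lexx orbT.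
have cn : sqclosure (fun t => Num.max (- u t) 0).
  by apply: sqclosure_ge0 => // t; rewrite le_max lexx orbT.
have := sqclosureD cp (sqclosureZ (- 1) cn).
congr sqclosure; apply/funext => t; rewrite mulN1r !maxEle oppr_le0.
by case: ifP; case: ifP; lra.
Qed.

End Closure.

Section Total.
Variable R : realType.
Notation mu := (@lebesgue_measure R).
Notation HL := (@Rplus R).
Implicit Types (u v : R -> R).

Definition theta_space u := exists p, u = theta p.

Lemma theta_space_sqint u : theta_space u -> sqint u.
Proof. by move=> [p ->]; exact: sqint_theta. Qed.

Lemma theta_space0 : theta_space (fun=> 0).
Proof. by exists 0; apply/funext => t; rewrite theta0. Qed.

Lemma theta_spaceD u v : theta_space u -> theta_space v -> theta_space (fun t => u t + v t).
Proof. by move=> [p ->] [q ->]; exists (p + q); apply/funext => t; rewrite thetaD. Qed.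

Lemma theta_spaceZ a u : theta_space u -> theta_space (fun t => a * u t).
Proof. by move=> [p ->]; exists (a *: p); apply/funext => t; rewrite thetaZ. Qed.

(** The Laguerre coefficients of an exponential form a geometric sequence, whose
    square sum is the square norm of the exponential: equality in Bessel's
    inequality. *)
Lemma sqclosure_theta_exp (s : R) : 0 < s -> sqclosure theta_space (fun t => expR (- (s * t))).
Proof.
move=> s0.
pose u t : R := Num.sqrt 2 * expR (- (s * t)).
have su : sqint u by apply: sqintZ; exact: sqint_expRN.
have uu : inner u u = 1 / s.
  transitivity (\int[mu]_(t in HL) (2 * (dpow 0 t * expR (- (2 * s * t))))).
    apply: eq_Rintegral => t _; rewrite dpow0E mul1r.
    transitivity (Num.sqrt 2 ^+ 2 * (expR (- (s * t)) * expR (- (s * t)))); first by rewrite /u; ring.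
    by rewrite sqr_sqrtr// -expRD; congr (_ * expR _); ring.
  have [_ i0 _] := ecos_dominated 0 0 (mulr_gt0 (ltr0n R 2) s0).
  rewrite RintegralZl//; last first.
    apply: eq_integrable i0; first exact: measurable_Rplus.
    by move=> t _ /=; rewrite /ecos mul0r cos0 mulr1.
  rewrite Rintegral_dpow_expRN ?mulr_gt0// expr1; field.
  by rewrite gt_eqF.
pose y : R := 2 / (1 + s) - 1.
have coef n : laguerre_coef n u = 2 / (1 + s) * y ^+ n.
  rewrite /laguerre_coef innerC inner_theta_exp// !horner_exp /zpoly !hornerE.
  by congr (_ * _ ^+ _); rewrite /y.
have s1 : 1 + s != 0 by rewrite gt_eqF//; lra.
have y1 : `|y| < 1.
  have -> : y = (1 - s) / (1 + s) by rewrite /y; field.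
  rewrite normrM normfV ltr_pdivrMr ?normr_gt0// mul1r.
  by rewrite [ltRHS]ger0_norm; [rewrite ltr_norml; apply/andP; split; lra|lra].
have norm N : inner (fun t => u t - laguerre_sum N u t) (fun t => u t - laguerre_sum N u t)
    = 1 / s * (y ^+ 2) ^+ N.
  rewrite bessel_eq// uu.
  have -> : \sum_(n < N) laguerre_coef n u ^+ 2 = 1 / s * (1 - (y ^+ 2) ^+ N).
    elim: N => [|N ih]; first by rewrite big_ord0 expr0; ring.
    rewrite big_ord_recr /= ih coef (exprSr (y ^+ 2) N).
    have -> : (2 / (1 + s) * y ^+ N) ^+ 2 = (2 / (1 + s)) ^+ 2 * (y ^+ 2) ^+ N.
      by rewrite exprMn [(y ^+ 2) ^+ N]exprAC.
    set Y := (y ^+ 2) ^+ N; rewrite /y; field.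
    by rewrite s1 gt_eqF.
  by ring.
have cu : sqclosure theta_space u.
  apply: (sqclosure_lim theta_space_sqint su (h := fun N => laguerre_sum N u)) => [N|].
    apply: sqclosure_sub => //; first exact: theta_space_sqint.
    exists (\sum_(n < N) laguerre_coef n u *: zpoly R ^+ n); apply/funext => t.
    by rewrite theta_sum; apply: eq_bigr => n _; rewrite thetaZ.
  suff H : 1 / s * (y ^+ 2) ^+ N @[N --> \oo] --> (0 : R).
    by under eq_fun do rewrite norm; exact: H.
  rewrite -[X in _ --> X](mulr0 (1 / s)); apply: cvgM; first exact: cvg_cst.
  apply: cvg_expr; rewrite ger0_norm ?sqr_ge0//.
  by rewrite -(real_normK (num_real y)) expr_lt1.
have := sqclosureZ theta_space_sqint theta_spaceZ (Num.sqrt 2)^-1 cu.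
congr sqclosure; apply/funext => t; rewrite /u mulKf//.
Qed.

Lemma theta_dense u : sqint u -> forall e : R, 0 < e ->
  exists p, inner (fun t => u t - theta p t) (fun t => u t - theta p t) < e.
Proof.
move=> su e e0.
have [_ /(_ _ e0)[v [p ->] pe]] := sqclosure_total theta_space_sqint theta_space0
  theta_spaceD theta_spaceZ sqclosure_theta_exp su.
by exists p.
Qed.

(** The functions orthogonal to [u] form a subspace containing all exponentials;
    it is dense, so [u] is a limit of functions orthogonal to [u]. *)
Lemma exp_orthogonal_eq0 u : sqint u ->
  (forall s : R, 0 < s -> inner u (fun t => expR (- (s * t))) = 0) -> inner u u = 0.
Proof.
move=> su ue; pose S v := sqint v /\ inner u v = 0.
have [_ cu] : sqclosure S u.
  apply: (@sqclosure_total _ S) => //.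
  - by move=> v [].
  - by split; [exact: sqint0|rewrite innerC inner0l].
  - by move=> v w [sv uv] [sw uw]; split; [exact: sqintD|rewrite innerDr// uv uw addr0].
  - by move=> a v [sv uv]; split; [exact: sqintZ|rewrite innerZr// uv mulr0].
  - move=> s s0; have se := sqint_expRN s0.
    have Se : S (fun t => expR (- (s * t))) by split=> //; exact: ue.
    by apply: sqclosure_sub Se => v [].
apply/eqP; rewrite eq_le inner_ge0 andbT; apply/ler_addgt0Pr => e e0; rewrite add0r.
have [v [sv uv]] := cu e e0.
rewrite innerBl ?innerBr//; last exact: sqintB.
rewrite (innerC v u) uv; have := inner_ge0 v; lra.
Qed.

End Total.

(** * The transform on square integrable complex functions *)

Section ComplexL2.
Variable R : realType.
Notation mu := (@lebesgue_measure R).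
Notation HL := (@Rplus R).
Notation Re := (@complex.Re R).
Notation Im := (@complex.Im R).
Local Open Scope complex_scope.
Implicit Types (f g k : R -> R[i]).

Lemma normc_sqr (z : R[i]) : Normc.normc z ^+ 2 = Re z ^+ 2 + Im z ^+ 2.
Proof. by case: z => a b /=; rewrite sqr_sqrtr// addr_ge0 ?sqr_ge0. Qed.

Lemma normc_ge0 (z : R[i]) : 0 <= Normc.normc z.
Proof. by case: z => a b /=; exact: sqrtr_ge0. Qed.

Lemma normcE (z : R[i]) : `|z| = (Normc.normc z)%:C. Proof. by case: z. Qed.

Lemma ltc_normP (z : R[i]) (r : R) : (`|z| < r%:C) = (Normc.normc z < r).
Proof. by rewrite normcE ltcR. Qed.

Lemma diskP (z : R[i]) : disk z <-> Normc.normc z < 1.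
Proof. by rewrite -ltc_normP. Qed.

Definition n2 f : R := inner (Re \o f) (Re \o f) + inner (Im \o f) (Im \o f).

Lemma n2_ge0 f : 0 <= n2 f. Proof. by rewrite addr_ge0// inner_ge0. Qed.

Lemma L2norm_integral f :
  L2norm f = ((\int[mu]_(t in HL) (Re (f t) ^+ 2 + Im (f t) ^+ 2)%:E) `^ 2^-1)%E.
Proof.
rewrite /L2norm unlock; congr (_ `^ _)%E.
rewrite [RHS]integral_mkcond; apply: eq_integral => t _.
rewrite !patchE; case: ifP => _.
  by rewrite /= ger0_norm ?normc_ge0// powR_mulrn ?normc_ge0// normc_sqr.
by rewrite abse0 poweR0r.
Qed.

Lemma integral_n2 f : sqint (Re \o f) -> sqint (Im \o f) ->
  (\int[mu]_(t in HL) (Re (f t) ^+ 2 + Im (f t) ^+ 2)%:E = (n2 f)%:E)%E.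
Proof.
move=> [mr ir] [mi ii].
rewrite /n2 /inner -RintegralD//; try exact: integrable_mul_sqint.
rewrite /Rintegral fineK; first by apply: eq_integral => t _.
apply: integrable_fin_num; first exact: measurable_Rplus.
exact: (integrableD (@measurable_Rplus R) (integrable_mul_sqint (conj mr ir) (conj mr ir)) (integrable_mul_sqint (conj mi ii) (conj mi ii))).
Qed.

Lemma L2P f : L2 f <-> sqint (Re \o f) /\ sqint (Im \o f).
Proof.
split=> [[mr mi]|[sr si]]; last first.
  split; [exact: (measurable_sqint sr)|exact: (measurable_sqint si)|].
  by rewrite L2norm_integral integral_n2// poweR_lty// ltry.
rewrite L2norm_integral => fin.
have Ifin : (\int[mu]_(t in HL) (Re (f t) ^+ 2 + Im (f t) ^+ 2)%:E < +oo)%E.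
  by apply: lty_poweRy fin; rewrite invr_neq0.
have msum : measurable_fun HL (fun t => Re (f t) ^+ 2 + Im (f t) ^+ 2).
  by apply: measurable_funD; exact: measurable_funX.
have int : mu.-integrable HL (EFin \o (fun t => Re (f t) ^+ 2 + Im (f t) ^+ 2)).
  apply/integrableP; split; first exact/measurable_EFinP.
  by under eq_integral do rewrite /= ger0_norm ?addr_ge0 ?sqr_ge0//.
split; split=> //; apply: le_integrable int => //.
- by apply/measurable_EFinP; exact: measurable_funX.
- by move=> t _ /=; rewrite lee_fin !ger0_norm ?addr_ge0 ?sqr_ge0// lerDl sqr_ge0.
- by apply/measurable_EFinP; exact: measurable_funX.
- by move=> t _ /=; rewrite lee_fin !ger0_norm ?addr_ge0 ?sqr_ge0// lerDr sqr_ge0.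
Qed.

Lemma L2norm_n2 f : L2 f -> L2norm f = (Num.sqrt (n2 f))%:E.
Proof.
move=> /L2P[sr si]; rewrite L2norm_integral integral_n2//.
by rewrite poweR_EFin powR12_sqrt// n2_ge0.
Qed.

Lemma ReD (x y : R[i]) : Re (x + y) = Re x + Re y. Proof. by case: x; case: y. Qed.
Lemma ImD (x y : R[i]) : Im (x + y) = Im x + Im y. Proof. by case: x; case: y. Qed.
Lemma ReB (x y : R[i]) : Re (x - y) = Re x - Re y. Proof. by case: x; case: y. Qed.
Lemma ImB (x y : R[i]) : Im (x - y) = Im x - Im y. Proof. by case: x; case: y. Qed.
Lemma ReM (x y : R[i]) : Re (x * y) = Re x * Re y - Im x * Im y.
Proof. by case: x; case: y. Qed.
Lemma ImM (x y : R[i]) : Im (x * y) = Re x * Im y + Im x * Re y.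
Proof. by case: x; case: y. Qed.
Lemma complexE2 (x : R[i]) : x = Re x +i* Im x. Proof. by case: x. Qed.
Lemma complexP (x y : R[i]) : Re x = Re y -> Im x = Im y -> x = y.
Proof. by case: x => a b; case: y => c d /= -> ->. Qed.

Lemma L2_lin (a : R[i]) f g : L2 f -> L2 g -> L2 (fun t => a * f t + g t).
Proof.
move=> /L2P[rf If] /L2P[rg Ig]; apply/L2P; split.
  rewrite (_ : _ \o _ = fun t => Re a * (Re \o f) t - Im a * (Im \o f) t + (Re \o g) t); last first.
    by apply/funext => t /=; rewrite ReD ReM.
  by apply: sqintD => //; apply: sqintB; exact: sqintZ.
rewrite (_ : _ \o _ = fun t => Re a * (Im \o f) t + Im a * (Re \o f) t + (Im \o g) t); last first.
  by apply/funext => t /=; rewrite ImD ImM.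
by apply: sqintD => //; apply: sqintD; exact: sqintZ.
Qed.

Lemma L2_0 : L2 (fun _ : R => 0 : R[i]).
Proof. by apply/L2P; split; exact: sqint0. Qed.

Lemma L2Z (a : R[i]) f : L2 f -> L2 (fun t => a * f t).
Proof.
by move=> lf; have := L2_lin a lf L2_0; congr L2; apply/funext=> t; rewrite addr0.
Qed.

Lemma L2D f g : L2 f -> L2 g -> L2 (fun t => f t + g t).
Proof.
by move=> lf lg; have := L2_lin 1 lf lg; congr L2; apply/funext=> t; rewrite mul1r.
Qed.

Lemma L2B f g : L2 f -> L2 g -> L2 (fun t => f t - g t).
Proof.
by move=> lf lg; have := L2_lin (- 1) lg lf; congr L2; apply/funext=> t; rewrite mulN1r addrC.
Qed.

Lemma L2_real (u : R -> R) : sqint u -> L2 (fun t => (u t)%:C).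
Proof. by move=> su; apply/L2P; split=> //; exact: sqint0. Qed.

(** Bilinear, not hermitian: [calH f z] is a multiple of [cpair f (kern z)]. *)
Definition cpair f k : R[i] := cintegral HL (fun t => f t * k t).

Lemma cpairE f k : L2 f -> L2 k -> cpair f k =
  (inner (Re \o f) (Re \o k) - inner (Im \o f) (Im \o k)) +i*
  (inner (Re \o f) (Im \o k) + inner (Im \o f) (Re \o k)).
Proof.
move=> /L2P[rf If] /L2P[rk Ik]; rewrite /cpair /cintegral /inner; congr (_ +i* _).
  rewrite -RintegralB//; try exact: integrable_mul_sqint.
  by apply: eq_Rintegral => t _; rewrite ReM.
rewrite -RintegralD//; try exact: integrable_mul_sqint.
by apply: eq_Rintegral => t _; rewrite ImM.
Qed.

Lemma inner_lin3 (a b : R) (u v w x : R -> R) :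
  sqint u -> sqint v -> sqint w -> sqint x ->
  inner (fun t => a * u t + b * v t + w t) x = a * inner u x + b * inner v x + inner w x.
Proof.
move=> su sv sw sx; have sau := sqintZ a su; have sbv := sqintZ b sv.
by rewrite innerDl ?innerDl ?innerZl//; exact: sqintD.
Qed.

Lemma cpair_lin a f g k : L2 f -> L2 g -> L2 k ->
  cpair (fun t => a * f t + g t) k = a * cpair f k + cpair g k.
Proof.
move=> lf lg lk; rewrite !cpairE//; last exact: L2_lin.
move: lf lg lk => /L2P[rf If] /L2P[rg Ig] /L2P[rk Ik].
have -> : Re \o (fun t => a * f t + g t) =
    fun t => Re a * (Re \o f) t + (- Im a) * (Im \o f) t + (Re \o g) t.
  by apply/funext => t /=; rewrite ReD ReM; ring.
have -> : Im \o (fun t => a * f t + g t) =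
    fun t => Re a * (Im \o f) t + Im a * (Re \o f) t + (Im \o g) t.
  by apply/funext => t /=; rewrite ImD ImM.
by apply: complexP; rewrite !inner_lin3// ?ReD ?ReM ?ImD ?ImM/=; ring.
Qed.

(** The constant [4] is a crude price for applying the real Cauchy-Schwarz
    inequality to the four products of real and imaginary parts. *)
Lemma cpair_le f k : L2 f -> L2 k -> Normc.normc (cpair f k) ^+ 2 <= 4 * n2 k * n2 f.
Proof.
move=> lf lk; rewrite cpairE// normc_sqr/=.
move: lf lk => /L2P[rf If] /L2P[rk Ik].
have := cauchy_schwarz rf rk; have := cauchy_schwarz If Ik.
have := cauchy_schwarz rf Ik; have := cauchy_schwarz If rk.
rewrite /n2.
have := inner_ge0 (Re \o f); have := inner_ge0 (Im \o f).
have := inner_ge0 (Re \o k); have := inner_ge0 (Im \o k).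
set a := inner (Re \o f) (Re \o k); set b := inner (Im \o f) (Im \o k).
set c := inner (Re \o f) (Im \o k); set d := inner (Im \o f) (Re \o k).
set p := inner (Re \o f) _; set q := inner (Im \o f) _; set r := inner (Re \o k) _.
set s := inner (Im \o k) _ => s0 r0 q0 p0 h1 h2 h3 h4.
have := sqr_ge0 (a + b); have := sqr_ge0 (c - d).
have := mulr_ge0 p0 r0; have := mulr_ge0 p0 s0; have := mulr_ge0 q0 r0; have := mulr_ge0 q0 s0.
nra.
Qed.

Lemma eqL2_cpair f g k : L2 f -> L2 g -> L2 k -> eqL2 f g -> cpair f k = cpair g k.
Proof.
move=> lf lg lk fg; rewrite !cpairE//.
move: lf lg lk => /L2P[rf If] /L2P[rg Ig] /L2P[rk Ik].
have fgR : ae_eq mu HL (Re \o f) (Re \o g) by move: fg; apply: filterS => t /[swap] Ht /(_ Ht) /= ->.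
have fgI : ae_eq mu HL (Im \o f) (Im \o g) by move: fg; apply: filterS => t /[swap] Ht /(_ Ht) /= ->.
by rewrite !(eq_inner_ae rf rg _ fgR)// !(eq_inner_ae If Ig _ fgI).
Qed.

(** ** The exponential kernel of the transform *)

Definition kern (z : R[i]) (t : R) : R[i] := cexp (t%:C * (z - 1) / (z + 1)).

Lemma Re_div (x y : R[i]) :
  Re (x / y) = (Re x * Re y + Im x * Im y) / (Re y ^+ 2 + Im y ^+ 2).
Proof. by case: x => a b; case: y => c d /=; ring. Qed.

Lemma disk_add1_neq0 (z : R[i]) : disk z -> 1 + z != 0.
Proof.
move=> /diskP z1; apply/eqP => z0; move: z1.
have -> : z = - 1 by apply/eqP; rewrite -addr_eq0 addrC z0.
by rewrite /= oppr0 sqrrN expr1n expr0n addr0 sqrtr1 ltxx.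
Qed.

Lemma disk_sqr_lt1 (z : R[i]) : disk z -> Re z ^+ 2 + Im z ^+ 2 < 1.
Proof.
by move=> /diskP z1; rewrite -normc_sqr -[ltRHS](expr1n R 2) ltrXn2r// ?nnegrE ?normc_ge0.
Qed.

(** The Cayley map of the disk onto the right half plane; the kernel at [z] is
    [exp (- t * cayley z)]. *)
Definition cayley (z : R[i]) : R[i] := (1 - z) / (z + 1).

Lemma cayley_gt0 (z : R[i]) : disk z -> 0 < Re (cayley z).
Proof.
move=> dz; have z0 := disk_add1_neq0 dz; have := disk_sqr_lt1 dz.
rewrite /cayley Re_div; case: z z0 {dz} => a b /= z0 z1.
apply: divr_gt0; first by nra.
rewrite lt_neqAle addr_ge0 ?sqr_ge0// andbT eq_sym paddr_eq0 ?sqr_ge0// !sqrf_eq0.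
by move: z0; rewrite eq_complex /= addr0 add0r (addrC 1 a).
Qed.

Lemma kernE (z : R[i]) t :
  kern z t = ecos 0 (Re (cayley z)) (Im (cayley z)) t +i* (- esin 0 (Re (cayley z)) (Im (cayley z)) t).
Proof.
have -> : kern z t = cexp (- (t%:C * cayley z)).
  by rewrite /kern /cayley; congr cexp; rewrite -mulrA -mulrN -mulNr opprB.
rewrite /cexp /ecos /esin dpow0E.
have -> : Re (- (t%:C * cayley z)) = - (Re (cayley z) * t).
  by case: (cayley z) => a b /=; ring.
have -> : Im (- (t%:C * cayley z)) = - (Im (cayley z) * t).
  by case: (cayley z) => a b /=; ring.
by rewrite cosN sinN; apply: complexP; rewrite /=; ring.
Qed.

Lemma L2_kern (z : R[i]) : disk z -> L2 (kern z).
Proof.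
move=> /cayley_gt0 c0; apply/L2P.
rewrite (_ : Re \o _ = ecos 0 (Re (cayley z)) (Im (cayley z))); last first.
  by apply/funext => t; rewrite /comp kernE.
rewrite (_ : Im \o _ = fun t => - esin 0 (Re (cayley z)) (Im (cayley z)) t); last first.
  by apply/funext => t; rewrite /comp kernE.
split; first by have [] := ecos_dominated 0 (Im (cayley z)) c0.
by apply: sqintN; have [] := esin_dominated 0 (Im (cayley z)) c0.
Qed.

Lemma calHE f z : calH f z = (Num.sqrt 2)%:C / (1 + z) * cpair f (kern z).
Proof. by []. Qed.

Lemma calH_lin a f g z : L2 f -> L2 g -> disk z ->
  calH (fun t => a * f t + g t) z = a * calH f z + calH g z.
Proof.
by move=> lf lg dz; rewrite !calHE cpair_lin//; [ring|exact: L2_kern].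
Qed.

Lemma eq_calH f g z : f =1 g -> calH f z = calH g z.
Proof. by move=> /funext ->. Qed.

Lemma calH0 (z : R[i]) : disk z -> calH (fun=> 0) z = 0.
Proof.
move=> dz; have H := calH_lin (- 1) L2_0 L2_0 dz.
transitivity (calH (fun _ : R => - 1 * (0 : R[i]) + 0) z).
  by apply: eq_calH => t; rewrite mulr0 addr0.
by rewrite H; ring.
Qed.

Lemma calHB f g z : L2 f -> L2 g -> disk z ->
  calH (fun t => f t - g t) z = calH f z - calH g z.
Proof.
move=> lf lg dz; rewrite -mulN1r addrC -calH_lin//.
by apply: eq_calH => t; rewrite mulN1r addrC.
Qed.

Lemma calH_eqL2 f g z : L2 f -> L2 g -> disk z -> eqL2 f g -> calH f z = calH g z.
Proof.
by move=> lf lg dz fg; rewrite !calHE (eqL2_cpair lf lg _ fg)//; exact: L2_kern.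
Qed.

Lemma calH_bounded z : disk z ->
  exists2 C : R, 0 <= C & forall f, L2 f -> Normc.normc (calH f z) ^+ 2 <= C * n2 f.
Proof.
move=> dz; exists (Normc.normc ((Num.sqrt 2)%:C / (1 + z)) ^+ 2 * (4 * n2 (kern z))).
  by apply: mulr_ge0; [exact: sqr_ge0|apply: mulr_ge0 => //; exact: n2_ge0].
move=> f lf; rewrite calHE Normc.normcM exprMn -[leRHS]mulrA; apply: ler_wpM2l; first exact: sqr_ge0.
by apply: cpair_le => //; exact: L2_kern.
Qed.

(** ** Exponential polynomials *)

Definition Theta (q : {poly R[i]}) (t : R) : R[i] :=
  \sum_(k < size q) q`_k * (ebasis k t)%:C.

Lemma Theta_widen (q : {poly R[i]}) n t : (size q <= n)%N ->
  Theta q t = \sum_(k < n) q`_k * (ebasis k t)%:C.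
Proof.
move=> qn; rewrite /Theta (big_ord_widen n (fun j : nat => q`_j * (ebasis j t)%:C) qn).
rewrite big_mkcond; apply: eq_bigr => k _; case: ltnP => // qk.
by rewrite nth_default// mul0r.
Qed.

Lemma L2_sum (I : Type) (s : seq I) (F : I -> R -> R[i]) : (forall i, L2 (F i)) ->
  L2 (fun t => \sum_(i <- s) F i t).
Proof.
move=> lF; elim: s => [|i s ih].
  by under eq_fun do rewrite big_nil; exact: L2_0.
by under eq_fun do rewrite big_cons; exact: L2D.
Qed.

Lemma L2_ebasis (k : nat) : L2 (fun t : R => (ebasis k t)%:C).
Proof. by apply: L2_real; exact: sqint_ebasis. Qed.

Lemma ebasis_kern (k : nat) (z : R[i]) t : (ebasis k t)%:C * kern z t =
  (Num.sqrt 2 * ecos k (1 + Re (cayley z)) (Im (cayley z)) t) +i*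
  (- Num.sqrt 2 * esin k (1 + Re (cayley z)) (Im (cayley z)) t).
Proof.
rewrite kernE; move: (Re (cayley z)) (Im (cayley z)) => a b.
rewrite /ebasis /ecos /esin dpow0E !mulrDl opprD expRD.
by apply: complexP; [rewrite ReM|rewrite ImM]; cbn [complex.Re complex.Im real_complex_def]; ring.
Qed.

(** This is the Laplace transform of [dpow k] at [1 + cayley z = 2 / (1 + z)]. *)
Lemma calH_ebasis (k : nat) (z : R[i]) : disk z ->
  calH (fun t : R => (ebasis k t)%:C) z = ((1 + z) / 2) ^+ k.
Proof.
move=> dz; have c0 := cayley_gt0 dz; have z0 := disk_add1_neq0 dz.
have H : cpair (fun t : R => (ebasis k t)%:C) (kern z) = (Num.sqrt 2)%:C * (1 + cayley z) ^- k.+1.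
  have c1 : 0 < Re (1 + cayley z) by rewrite ReD ltr_wpDl.
  have Re1 : Re (1 + cayley z) = 1 + Re (cayley z) by rewrite ReD.
  have Im1 : Im (1 + cayley z) = Im (cayley z) by rewrite ImD add0r.
  rewrite -(complex_Laplace_dpow k c1) Re1 Im1.
  rewrite Re1 in c1.
  have [_ ic _] := ecos_dominated k (Im (cayley z)) c1.
  have [_ isn _] := esin_dominated k (Im (cayley z)) c1.
  rewrite /cpair /cintegral.
  have -> : \int[mu]_(t in HL) Re ((ebasis k t)%:C * kern z t) =
      Num.sqrt 2 * \int[mu]_(t in HL) ecos k (1 + Re (cayley z)) (Im (cayley z)) t.
    rewrite -RintegralZl//.
    by apply: eq_Rintegral => t _; rewrite ebasis_kern.
  have -> : \int[mu]_(t in HL) Im ((ebasis k t)%:C * kern z t) =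
      - Num.sqrt 2 * \int[mu]_(t in HL) esin k (1 + Re (cayley z)) (Im (cayley z)) t.
    rewrite -RintegralZl//.
    by apply: eq_Rintegral => t _; rewrite ebasis_kern.
  by apply: complexP => /=; ring.
rewrite calHE H.
have two0 : (2 : R[i]) != 0 by rewrite pnatr_eq0.
have -> : 1 + cayley z = 2 / (1 + z).
  by rewrite /cayley (addrC z 1) -[X in X + _](@divff _ (1 + z))// -mulrDl; congr (_ / _); ring.
have s2 : (Num.sqrt 2)%:C * (Num.sqrt 2)%:C = 2 :> R[i].
  by rewrite -rmorphM -expr2 sqr_sqrtr// rmorph_nat.
rewrite -exprVn invf_div exprS.
set y := (1 + z) / 2.
transitivity ((Num.sqrt 2)%:C * (Num.sqrt 2)%:C / (1 + z) * y * y ^+ k); first by ring.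
by rewrite s2 /y -invf_div mulVf ?mul1r// mulf_neq0// invr_eq0.
Qed.

Lemma calH_sum (I : Type) (s : seq I) (a : I -> R[i]) (F : I -> R -> R[i]) z :
  (forall i, L2 (F i)) -> disk z ->
  calH (fun t => \sum_(i <- s) a i * F i t) z = \sum_(i <- s) a i * calH (F i) z.
Proof.
move=> lF dz; elim: s => [|i s ih].
  by rewrite big_nil; under eq_fun do rewrite big_nil; exact: calH0.
rewrite big_cons -ih -calH_lin//; last by apply: L2_sum => j; exact: L2Z.
by apply: eq_calH => t; rewrite big_cons.
Qed.

Lemma calH_Theta q z : disk z -> calH (Theta q) z = q.[(1 + z) / 2].
Proof.
move=> dz; rewrite /Theta calH_sum//; last exact: L2_ebasis.
by rewrite horner_coef; apply: eq_bigr => k _; rewrite calH_ebasis.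
Qed.

Lemma cayley_real (s : R) : 0 < s -> cayley ((1 - s) / (1 + s))%:C = s%:C.
Proof.
move=> s0; rewrite /cayley -[1 in LHS](rmorph1 (real_complex R)) -rmorphB -rmorphD -fmorphV -rmorphM.
congr (_%:C); field.
by rewrite !gt_eqF//; lra.
Qed.

Lemma disk_real (s : R) : 0 < s -> disk ((1 - s) / (1 + s))%:C.
Proof.
move=> s0; apply/diskP; rewrite /= expr0n addr0 sqrtr_sqr.
rewrite normrM normfV ltr_pdivrMr ?normr_gt0 ?gt_eqF//; last by lra.
by rewrite mul1r [ltRHS]ger0_norm; [rewrite ltr_norml; apply/andP; split; lra|lra].
Qed.

(** On the real diameter of the disk the kernel runs through all exponentials. *)
Lemma calH_eq0 f : L2 f -> (forall z, disk z -> calH f z = 0) -> eqL2 f (fun=> 0).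
Proof.
move=> lf f0.
have lr : forall s : R, 0 < s -> cpair f (fun t => (expR (- (s * t)))%:C) = 0.
  move=> s s0; have dz := disk_real s0; have /eqP := f0 _ dz.
  rewrite calHE !mulf_eq0 invr_eq0 (negbTE (disk_add1_neq0 dz)) orbF.
  rewrite -(rmorph0 (real_complex R)) (inj_eq (@complexI R)) sqrtr_eq0 leNgt ltr0n/=.
  move=> /eqP fk; rewrite -[RHS]fk /cpair; congr (cintegral HL).
  apply/funext => t; rewrite kernE cayley_real//= /ecos /esin dpow0E !mul0r cos0 sin0.
  by rewrite mulr0 mulr1 mul1r oppr0.
have [sr si] := (L2P f).1 lf.
have both : forall s : R, 0 < s -> inner (Re \o f) (fun t => expR (- (s * t))) = 0 /\
    inner (Im \o f) (fun t => expR (- (s * t))) = 0.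
  move=> s s0; have := lr s s0; rewrite cpairE//; last by apply: L2_real; exact: sqint_expRN.
  rewrite (_ : Re \o (fun t => (expR (- (s * t)))%:C) = fun t => expR (- (s * t)))//.
  rewrite (_ : Im \o (fun t => (expR (- (s * t)))%:C) = fun=> 0)//.
  rewrite (innerC (Im \o f) (fun=> 0)) (innerC (Re \o f) (fun=> 0)) !inner0l subr0 add0r.
  by case=> -> ->.
have r0 := inner_eq0 sr (exp_orthogonal_eq0 sr (fun s s0 => (both s s0).1)).
have i0 := inner_eq0 si (exp_orthogonal_eq0 si (fun s s0 => (both s s0).2)).
move: r0 i0; apply: filterS2 => t ft gt Ht.
by apply: complexP; [exact: ft|exact: gt].
Qed.

Lemma calH_inj f g : L2 f -> L2 g -> (forall z, disk z -> calH f z = calH g z) -> eqL2 f g.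
Proof.
move=> lf lg fg; have := calH_eq0 (L2B lf lg); move=> H.
have {}H : eqL2 (fun t => f t - g t) (fun=> 0).
  by apply: H => z dz; rewrite calHB// fg// subrr.
move: H; apply: filterS => t /= /[swap] Ht /(_ Ht) /eqP.
by rewrite subr_eq0 => /eqP.
Qed.

Lemma bounded_n2 (A : (R -> R[i]) -> R -> R[i]) : bounded_linear_L2 A ->
  exists2 K : R, 0 <= K & forall f, L2 f -> n2 (A f) <= K * n2 f.
Proof.
move=> [st _ _ [C bC]]; exists (C ^+ 2); first exact: sqr_ge0.
move=> f lf; have := bC f lf; rewrite !L2norm_n2//; last exact: st.
rewrite -EFinM lee_fin => H.
have := n2_ge0 f; have := n2_ge0 (A f) => a0 f0.
rewrite -(sqr_sqrtr a0) -(sqr_sqrtr f0) -exprMn lerXn2r// ?nnegrE ?sqrtr_ge0//.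
by apply: le_trans H; exact: sqrtr_ge0.
Qed.

End ComplexL2.

(** * Power series of the transforms *)

Section HardySpace.
Variable R : realType.
Notation mu := (@lebesgue_measure R).
Notation HL := (@Rplus R).
Notation Re := (@complex.Re R).
Notation Im := (@complex.Im R).
Local Open Scope complex_scope.

Lemma ccvgP (T : Type) (F : set_system T) (FF : Filter F) (u : T -> R[i]) (l : R[i]) :
  (u x : R[i]^o) @[x --> F] --> (l : R[i]^o) <-> Normc.normc (l - u x) @[x --> F] --> (0 : R).
Proof.
split=> [/cvgrPdist_lt H|/cvgr0Pnorm_lt H].
  apply/cvgr0Pnorm_lt => e e0.
  have : 0 < e%:C :> R[i] by rewrite ltcR.
  move/H; apply: filterS => x; rewrite ltc_normP => xe.
  by rewrite ger0_norm ?normc_ge0.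
apply/cvgrPdist_lt => e e0.
have eE : e = (Re e)%:C by move: e0; rewrite ltcE/= => /andP[/eqP ie _]; apply: complexP.
have re0 : 0 < Re e by move: e0; rewrite eE ltcR.
move/(_ _ re0): H; apply: filterS => x; rewrite ger0_norm ?normc_ge0// => xe.
by rewrite eE ltc_normP.
Qed.

Lemma normc_le_ReIm (z : R[i]) : Normc.normc z <= `|Re z| + `|Im z|.
Proof.
rewrite -(@ler_pXn2r _ 2)// ?nnegrE ?normc_ge0 ?addr_ge0// normc_sqr.
rewrite -(real_normK (num_real (Re z))) -(real_normK (num_real (Im z))).
have := normr_ge0 (Re z); have := normr_ge0 (Im z); nra.
Qed.

Lemma Re_le_normc (z : R[i]) : `|Re z| <= Normc.normc z.
Proof.
rewrite -(@ler_pXn2r _ 2)// ?nnegrE ?normc_ge0// normc_sqr real_normK ?num_real// lerDl sqr_ge0//.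
Qed.

Lemma Im_le_normc (z : R[i]) : `|Im z| <= Normc.normc z.
Proof.
rewrite -(@ler_pXn2r _ 2)// ?nnegrE ?normc_ge0// normc_sqr real_normK ?num_real// lerDr sqr_ge0//.
Qed.

Lemma ccvg_ReIm (T : Type) (F : set_system T) (FF : Filter F) (u : T -> R[i]) (a b : R) :
  Re (u x) @[x --> F] --> a -> Im (u x) @[x --> F] --> b ->
  Normc.normc ((a +i* b) - u x) @[x --> F] --> (0 : R).
Proof.
move=> ua ub.
apply: (@squeeze_cvgr _ _ _ _ (fun=> 0) (fun x => `|a - Re (u x)| + `|b - Im (u x)|)).
- apply: nearW => x; rewrite normc_ge0/=.
  by apply: le_trans (normc_le_ReIm _) _; rewrite ReB ImB.
- exact: cvg_cst.
rewrite -[X in _ --> X]addr0; apply: cvgD.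
  by apply/norm_cvg0P; rewrite -(subrr a); apply: cvgB => //; exact: cvg_cst.
by apply/norm_cvg0P; rewrite -(subrr b); apply: cvgB => //; exact: cvg_cst.
Qed.

(** ** Laguerre expansions converge *)

Lemma laguerre_coefB n (u v : R -> R) : sqint u -> sqint v ->
  laguerre_coef n (fun t => u t - v t) = laguerre_coef n u - laguerre_coef n v.
Proof. by move=> su sv; rewrite /laguerre_coef innerBl//; exact: sqint_rho. Qed.

(** Up to the linear change of variable inverse to [zpoly], [p] is a polynomial in
    [zpoly], so its Laguerre expansion is finite. *)
Lemma laguerre_sum_theta (p : {poly R}) : exists n, forall N, (n <= N)%N ->
  forall t, laguerre_sum N (theta p) t = theta p t.
Proof.
pose q := p \Po (2^-1 *: 'X + 2^-1%:P); exists (size q) => N qN t.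
have pE : p = \sum_(i < N) q`_i *: zpoly R ^+ i.
  have -> : p = q \Po zpoly R.
    rewrite /q -comp_polyA; have -> : (2^-1 *: 'X + 2^-1%:P) \Po zpoly R = 'X :> {poly R}.
      rewrite comp_polyD comp_polyZ comp_polyX comp_polyC /zpoly scalerBr scalerA mulVf// scale1r.
      by rewrite alg_polyC subrK.
    by rewrite comp_polyXr.
  rewrite comp_polyE (big_ord_widen N (fun i => q`_i *: zpoly R ^+ i) qN) big_mkcond.
  apply: eq_bigr => i _; case: ltnP => // iq.
  by rewrite nth_default// scale0r.
rewrite {2}pE theta_sum; apply: eq_bigr => i _; rewrite thetaZ; congr (_ * _).
rewrite /laguerre_coef.
rewrite (_ : theta p = fun t => \sum_(i < N) q`_i * rho i t); last first.
  apply/funext => x; rewrite pE theta_sum; apply: eq_bigr => j _.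
  by rewrite thetaZ.
exact: (inner_rho_sum (fun i => q`_i)).
Qed.

(** Past the degree of an approximating polynomial [p], the remainder of [u] is
    the remainder of [u - theta p], which Bessel's inequality controls. *)
Lemma laguerre_cvg (u : R -> R) : sqint u ->
  inner (fun t => u t - laguerre_sum N u t) (fun t => u t - laguerre_sum N u t)
    @[N --> \oo] --> (0 : R).
Proof.
move=> su; apply/cvgr0Pnorm_lt => e e0.
have [p pe] := theta_dense su e0; have [n nP] := laguerre_sum_theta p.
exists n => //= N /= nN; rewrite ger0_norm ?inner_ge0//.
apply: le_lt_trans pe.
have sw : sqint (fun t => u t - theta p t) by apply: sqintB => //; exact: sqint_theta.
rewrite (_ : (fun t => u t - laguerre_sum N u t) =
  fun t => (u t - theta p t) - laguerre_sum N (fun t => u t - theta p t) t); last first.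
  apply/funext => t; rewrite -(nP N nN t) /laguerre_sum -addrA -opprD; congr (_ - _).
  rewrite -big_split/=; apply: eq_bigr => i _.
  by rewrite laguerre_coefB//; [ring|exact: sqint_theta].
rewrite bessel_eq// gerBl; apply: sumr_ge0 => i _; exact: sqr_ge0.
Qed.

Definition lcoef (n : nat) (f : R -> R[i]) : R[i] :=
  laguerre_coef n (Re \o f) +i* laguerre_coef n (Im \o f).

Definition lsum N (f : R -> R[i]) (t : R) : R[i] := \sum_(n < N) lcoef n f * (rho n t)%:C.

Lemma lsumE N f t :
  lsum N f t = laguerre_sum N (Re \o f) t +i* laguerre_sum N (Im \o f) t.
Proof.
rewrite /lsum /laguerre_sum.
elim/big_ind3 : _ => // [x1 x2 x3 y1 y2 y3 -> ->//|n _].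
by apply: complexP => /=; ring.
Qed.

Lemma L2_rho n : L2 (fun t : R => (rho n t)%:C).
Proof. by apply: L2_real; exact: sqint_rho. Qed.

Lemma L2_lsum N f : L2 (lsum N f).
Proof. by apply: L2_sum => n; apply: L2Z; exact: L2_rho. Qed.

Lemma lsum_cvg f : L2 f -> n2 (fun t => f t - lsum N f t) @[N --> \oo] --> (0 : R).
Proof.
move=> /L2P[rf If].
have E N : n2 (fun t => f t - lsum N f t) =
    inner (fun t => (Re \o f) t - laguerre_sum N (Re \o f) t)
          (fun t => (Re \o f) t - laguerre_sum N (Re \o f) t) +
    inner (fun t => (Im \o f) t - laguerre_sum N (Im \o f) t)
          (fun t => (Im \o f) t - laguerre_sum N (Im \o f) t).
  rewrite /n2.
  rewrite (_ : Re \o (fun t => f t - lsum N f t) = fun t => (Re \o f) t - laguerre_sum N (Re \o f) t); last first.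
    by apply/funext => t; rewrite /comp ReB lsumE.
  rewrite (_ : Im \o (fun t => f t - lsum N f t) = fun t => (Im \o f) t - laguerre_sum N (Im \o f) t)//.
  by apply/funext => t; rewrite /comp ImB lsumE.
rewrite (funext E) -[X in _ --> X]addr0.
by apply: cvgD; exact: laguerre_cvg.
Qed.

Lemma Theta_map_poly (p : {poly R}) t :
  Theta (map_poly (real_complex R) p) t = (theta p t)%:C.
Proof.
rewrite (@Theta_widen _ _ (size p)) ?size_map_poly// rmorph_sum.
by apply: eq_bigr => k _; rewrite coef_map; apply: complexP => /=; ring.
Qed.

Lemma calH_rho n (z : R[i]) : disk z -> calH (fun t : R => (rho n t)%:C) z = z ^+ n.
Proof.
move=> dz.
transitivity (calH (Theta (map_poly (real_complex R) (zpoly R ^+ n))) z).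
  by apply: eq_calH => t; rewrite Theta_map_poly.
rewrite calH_Theta// rmorphXn /= horner_exp; congr (_ ^+ _).
rewrite /zpoly rmorphB /= map_polyZ map_polyX rmorph1 !hornerE /= rmorph_nat.
by rewrite [2 * _]mulrC mulfK ?pnatr_eq0// addrC addKr.
Qed.

Lemma calH_lsum N f (z : R[i]) : disk z ->
  calH (lsum N f) z = \sum_(n < N) lcoef n f * z ^+ n.
Proof.
move=> dz; rewrite /lsum calH_sum//; last exact: L2_rho.
by apply: eq_bigr => n _; rewrite calH_rho.
Qed.

Lemma sum_normc_lcoef N f : L2 f ->
  \sum_(n < N) Normc.normc (lcoef n f) ^+ 2 <= n2 f.
Proof.
move=> /L2P[rf If].
under eq_bigr do rewrite normc_sqr /=.
by rewrite big_split/=; apply: lerD; exact: bessel_le.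
Qed.

(** Partial Laguerre sums are mapped to polynomials in [z] with the same
    coefficients, and evaluation at [z] is continuous in [f]. *)
Lemma calH_series f (z : R[i]) : L2 f -> disk z ->
  (series (fun n => lcoef n f * z ^+ n) : nat -> R[i]^o) @ \oo --> (calH f z : R[i]^o).
Proof.
move=> lf dz; apply/ccvgP.
have [C C0 HC] := calH_bounded dz.
apply/cvgr0Pnorm_lt => e e0.
have C1 : 0 < C + 1 by lra.
have d0 : 0 < e ^+ 2 / (C + 1) by rewrite divr_gt0// exprn_gt0.
have [M _ HM] := cvgr_lt _ (lsum_cvg lf) _ d0; exists M => // N /= MN.
have := HM N MN; rewrite /=.
rewrite ltr_pdivlMr// => HN.
rewrite ger0_norm ?normc_ge0// /series /= big_mkord -calH_lsum// -calHB//; last exact: L2_lsum.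
rewrite -(@ltr_pXn2r _ 2)// ?nnegrE ?normc_ge0 ?ltW//.
apply: le_lt_trans (HC _ (L2B lf (L2_lsum N f))) _.
have := n2_ge0 (fun t => f t - lsum N f t); nra.
Qed.

Lemma H2_calH (f : R -> R[i]) : L2 f -> H2 (calH f).
Proof.
move=> lf; exists (fun n => lcoef n f); split; last by move=> z dz; exact: calH_series.
apply: nondecreasing_is_cvgn.
  apply/nondecreasing_seqP => n; rewrite /series /= big_nat_recr//= lerDl.
  exact: sqr_ge0.
exists (n2 f) => _ [N _ <-]; rewrite /series/= big_mkord.
exact: sum_normc_lcoef.
Qed.

Lemma eq_H2 (F G : R[i] -> R[i]) : (forall z, disk z -> F z = G z) -> H2 F -> H2 G.
Proof.
move=> FG [a [ca aF]]; exists a; split; first exact: ca.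
by move=> z dz; rewrite -(FG z dz); exact (aF z dz).
Qed.

(** ** Power series with bounded coefficients are holomorphic *)

Lemma normc_sum (I : Type) (s : seq I) (P : pred I) (F : I -> R[i]) :
  Normc.normc (\sum_(i <- s | P i) F i) <= \sum_(i <- s | P i) Normc.normc (F i).
Proof.
elim/big_ind2 : _ => //; first by rewrite Normc.normc0.
by move=> x1 x2 y1 y2 h1 h2; apply: le_trans (le_normcD _ _) _; exact: lerD.
Qed.

Lemma normcX (z : R[i]) n : Normc.normc (z ^+ n) = Normc.normc z ^+ n.
Proof.
elim: n => [|n ih]; first by rewrite !expr0 Normc.normc1.
by rewrite !exprS Normc.normcM ih.
Qed.

Lemma normc_nat n : Normc.normc (n%:R : R[i]) = n%:R.
Proof. by rewrite -(rmorph_nat (real_complex R)) /= expr0n addr0 sqrtr_sqr ger0_norm. Qed.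

Lemma normc_real (x : R) : Normc.normc x%:C = `|x|.
Proof. by rewrite /= expr0n addr0 sqrtr_sqr. Qed.

(** Summing the recursion gives [sum b <= r * sum b + sum c]. *)
Lemma sum_rec_bounded (r M : R) (b c : nat -> R) : 0 <= r < 1 -> b 0%N = 0 ->
  (forall n, 0 <= b n) ->
  (forall n, b n.+1 <= r * b n + c n) -> (forall N, \sum_(n < N) c n <= M) ->
  forall N, \sum_(n < N) b n <= M / (1 - r).
Proof.
move=> /andP[r0 r1] b0 bge bS cM N.
have M0 : 0 <= M by have := cM 0%N; rewrite big_ord0.
have H : \sum_(n < N.+1) b n <= r * (\sum_(n < N) b n) + \sum_(n < N) c n.
  rewrite big_ord_recl b0 add0r mulr_sumr -big_split /=; apply: ler_sum => i _.
  by rewrite /bump /= add1n; exact: bS.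
move: H; rewrite big_ord_recr /= => H.
rewrite ler_pdivlMr ?subr_gt0//; have := cM N; have := bge N; nra.
Qed.

Lemma geo_sum_bounded (r : R) N : 0 <= r < 1 -> \sum_(n < N) r ^+ n <= 1 / (1 - r).
Proof.
move=> /andP[r0 r1]; rewrite ler_pdivlMr ?subr_gt0//.
have : (\sum_(n < N) r ^+ n) * (1 - r) = 1 - r ^+ N.
  by rewrite mulrC -[1 in RHS](expr1n R N) subrXX; congr (_ * _); apply: eq_bigr => i _; rewrite expr1n mul1r.
by move=> ->; rewrite gerBl exprn_ge0.
Qed.

Lemma geo_deriv_bounded (r : R) N : 0 <= r < 1 ->
  \sum_(n < N) n%:R * r ^+ n.-1 <= 1 / (1 - r) / (1 - r).
Proof.
move=> r01; have /andP[r0 r1] := r01.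
apply: (sum_rec_bounded (b := fun n => n%:R * r ^+ n.-1) (c := fun n => r ^+ n)) => //; first by rewrite mul0r.
- by move=> n; rewrite mulr_ge0// exprn_ge0.
- move=> n; rewrite -natr1 mulrDl mul1r /=; apply: lerD => //.
  by case: n => [|n]; rewrite ?mul0r ?mulr0//= exprS mulrCA.
- by move=> M; exact: geo_sum_bounded.
Qed.

(** The error of the first order Taylor expansion of the [n]-th power at [z]. *)
Definition rem2 (z h : R[i]) n := (z + h) ^+ n - z ^+ n - h * (n%:R * z ^+ n.-1).

Lemma rem2S (z h : R[i]) n :
  rem2 z h n.+1 = (z + h) * rem2 z h n + h ^+ 2 * (n%:R * z ^+ n.-1).
Proof.
rewrite /rem2 -natr1 /= !exprS; case: n => [|n] /=; first by rewrite !expr0; ring.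
by rewrite !exprS; ring.
Qed.

Lemma rem2_sum_bounded (z h : R[i]) (r : R) : Normc.normc z <= r -> Normc.normc (z + h) <= r ->
  0 <= r < 1 ->
  forall N, \sum_(n < N) Normc.normc (rem2 z h n) <=
    Normc.normc h ^+ 2 * (1 / (1 - r) / (1 - r)) / (1 - r).
Proof.
move=> zr zhr r01; have /andP[r0 r1] := r01.
apply: (sum_rec_bounded (b := fun n => Normc.normc (rem2 z h n)) (c := fun n => Normc.normc h ^+ 2 * (n%:R * r ^+ n.-1))) => //.
- by rewrite /rem2 !expr0 subrr mul0r mulr0 subrr Normc.normc0.
- by move=> n; exact: normc_ge0.
- move=> n; rewrite rem2S.
  apply: le_trans (le_normcD _ _) _; rewrite !Normc.normcM.
  apply: lerD; first by apply: ler_wpM2r => //; exact: normc_ge0.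
  rewrite !normcX normc_nat; apply: ler_wpM2l; first exact: sqr_ge0.
  apply: ler_wpM2l => //; apply: lerXn2r; rewrite ?nnegrE ?normc_ge0//.
- move=> M; rewrite -mulr_sumr; apply: ler_wpM2l; first exact: sqr_ge0.
  exact: geo_deriv_bounded.
Qed.

Lemma cvg_series_bounded (u : nat -> R) (M : R) :
  (forall N, \sum_(n < N) `|u n| <= M) -> exists l : R, series u @ \oo --> l.
Proof.
move=> uM; suff : cvgn (series (fun n => `|u n|)) by move/normed_cvg/cvg_ex.
apply: nondecreasing_is_cvgn.
  by apply/nondecreasing_seqP => n; rewrite /series /= big_nat_recr//= lerDl.
by exists M => _ [N _ <-]; rewrite /series/= big_mkord; exact: uM.
Qed.

Lemma ccvg_series_bounded (u : nat -> R[i]) (M : R) :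
  (forall N, \sum_(n < N) Normc.normc (u n) <= M) ->
  exists l : R[i], Normc.normc (l - \sum_(n < N) u n) @[N --> \oo] --> (0 : R).
Proof.
move=> uM.
have [a ua] : exists a : R, series (fun n => Re (u n)) @ \oo --> a.
  apply: (@cvg_series_bounded _ M) => N; apply: le_trans (uM N).
  by apply: ler_sum => n _; exact: Re_le_normc.
have [b ub] : exists b : R, series (fun n => Im (u n)) @ \oo --> b.
  apply: (@cvg_series_bounded _ M) => N; apply: le_trans (uM N).
  by apply: ler_sum => n _; exact: Im_le_normc.
exists (a +i* b); apply: ccvg_ReIm.
  rewrite (_ : (fun N => _) = series (fun n => Re (u n)))//.
  by apply/funext => N; rewrite /series /= big_mkord; exact: (big_morph _ (@ReD R) (erefl : Re 0 = 0)).
rewrite (_ : (fun N => _) = series (fun n => Im (u n)))//.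
by apply/funext => N; rewrite /series /= big_mkord; exact: (big_morph _ (@ImD R) (erefl : Im 0 = 0)).
Qed.

Lemma normc_sub_swap (x y : R[i]) : Normc.normc (x - y) = Normc.normc (y - x).
Proof. by rewrite -opprB normcN. Qed.

(** Summing [rem2] over the series shows that the error of the first order
    expansion of [F] at [z] is [O(|h| ^ 2)]. *)
Lemma power_series_derivable (a : nat -> R[i]) (M : R) (F : R[i] -> R[i]) :
  (forall n, Normc.normc (a n) <= M) ->
  (forall z, disk z -> Normc.normc (F z - \sum_(n < N) a n * z ^+ n) @[N --> \oo] --> (0 : R)) ->
  analytic_disk F.
Proof.
move=> aM aF z dz.
have M0 : 0 <= M by apply: le_trans (aM 0%N); exact: normc_ge0.
have z1 : Normc.normc z < 1 by apply/diskP.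
pose r := (1 + Normc.normc z) / 2.
have rz := normc_ge0 z.
have r01 : 0 <= r < 1 by rewrite /r; apply/andP; split; lra.
have zr : Normc.normc z <= r by rewrite /r; lra.
have [D HD] : exists D : R[i], Normc.normc (D - \sum_(n < N) a n * (n%:R * z ^+ n.-1)) @[N --> \oo] --> (0 : R).
  apply: (@ccvg_series_bounded (fun n => a n * (n%:R * z ^+ n.-1)) (M * (1 / (1 - r) / (1 - r)))) => N.
  apply: (@le_trans _ _ (\sum_(n < N) M * (n%:R * r ^+ n.-1))).
    apply: ler_sum => n _; rewrite !Normc.normcM normcX normc_nat.
    apply: ler_pM; rewrite ?normc_ge0 ?mulr_ge0 ?exprn_ge0 ?normc_ge0//.
    apply: ler_wpM2l => //; apply: lerXn2r; rewrite ?nnegrE ?normc_ge0//.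
    by case/andP: r01.
  by rewrite -mulr_sumr; apply: ler_wpM2l => //; exact: geo_deriv_bounded.
pose K := M * ((1 / (1 - r) / (1 - r)) / (1 - r)).
have key h : Normc.normc (z + h) <= r ->
    Normc.normc (F (z + h) - F z - h * D) <= K * Normc.normc h ^+ 2.
  move=> zhr.
  have dzh : disk (z + h) by apply/diskP; apply: le_lt_trans zhr _; case/andP: r01.
  apply/ler_addgt0Pr => e e0.
  have e3 : 0 < e / 4 by rewrite divr_gt0.
  have h1 : 0 < Normc.normc h + 1 by have := normc_ge0 h; lra.
  have [N1 _ H1] := cvgr_lt _ (aF _ dzh) _ e3.
  have [N2 _ H2] := cvgr_lt _ (aF _ dz) _ e3.
  have [N3 _ H3] := cvgr_lt _ HD _ (divr_gt0 e3 h1).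
  pose N := maxn N1 (maxn N2 N3).
  have {}H1 := H1 N (leq_maxl _ _).
  have {}H2 := H2 N (leq_trans (leq_maxl _ _) (leq_maxr _ _)).
  have {}H3 := H3 N (leq_trans (leq_maxr _ _) (leq_maxr _ _)).
  move: H1 H2 H3; rewrite /=.
  set s1 := \sum_(n < N) _; set s2 := \sum_(n < N) _; set s3 := \sum_(n < N) _ => H1 H2 H3.
  have -> : F (z + h) - F z - h * D =
     (F (z + h) - s1) + ((s2 - F z) + (h * (s3 - D) + (s1 - s2 - h * s3))) by ring.
  have H4 : Normc.normc (s1 - s2 - h * s3) <= K * Normc.normc h ^+ 2.
    have -> : s1 - s2 - h * s3 = \sum_(n < N) a n * rem2 z h n.
      rewrite /s1 /s2 /s3 mulr_sumr -!sumrB; apply: eq_bigr => n _.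
      by rewrite /rem2; ring.
    apply: le_trans (normc_sum _ _ _) _.
    apply: (@le_trans _ _ (\sum_(n < N) M * Normc.normc (rem2 z h n))).
      apply: ler_sum => n _; rewrite Normc.normcM; apply: ler_wpM2r => //; exact: normc_ge0.
    rewrite -mulr_sumr /K -mulrA; apply: ler_wpM2l => //.
    by apply: le_trans (rem2_sum_bounded zr zhr r01 N) _; rewrite le_eqVlt; apply/orP; left; apply/eqP; ring.
  have H5 : Normc.normc (h * (s3 - D)) <= e / 4.
    rewrite Normc.normcM normc_sub_swap; move: H3; rewrite ltr_pdivlMr// => H3.
    have := normc_ge0 h; have := normc_ge0 (D - s3); nra.
  apply: le_trans (le_normcD _ _) _.
  have := le_normcD (s2 - F z) (h * (s3 - D) + (s1 - s2 - h * s3)).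
  have := le_normcD (h * (s3 - D)) (s1 - s2 - h * s3).
  rewrite (normc_sub_swap s2); lra.
apply/cvg_ex; exists (D : R[i]^o); apply/ccvgP.
have K0 : 0 <= K.
  case/andP: r01 => r0 r1; have r1' : 0 <= 1 - r by lra.
  by rewrite /K !mulr_ge0// ?invr_ge0// mulr_ge0 ?divr_ge0 ?invr_ge0.
apply/cvgr0Pnorm_lt => e e0.
pose d := Num.min ((1 - Normc.normc z) / 2) (e / (K + 1)).
have d0 : 0 < d by rewrite lt_min !divr_gt0//; lra.
exists d%:C; first by rewrite /= ltcR.
move=> h /=; rewrite sub0r normrN ltc_normP => hd hn0.
have hpos : 0 < Normc.normc h.
  rewrite lt_neqAle normc_ge0 andbT eq_sym; apply: contraNN hn0 => /eqP /Normc.eq0_normc ->.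
  by [].
have zh : Normc.normc (z + h) <= r.
  apply: le_trans (le_normcD _ _) _; rewrite /r.
  move: hd; rewrite lt_min => /andP[+ _]; lra.
rewrite ger0_norm ?normc_ge0//.
have -> : D - h^-1 *: ((F (h *: (1 : R[i]^o) + z) : R[i]^o) - F z) = - h^-1 * (F (z + h) - F z - h * D).
  rewrite /GRing.scale /= mulr1 (addrC h z).
  by move: (F (z + h)) (F z) => x y; field.
rewrite Normc.normcM normcN Normc.normcV mulrC ltr_pdivrMr//.
apply: le_lt_trans (key h zh) _.
move: hd; rewrite lt_min => /andP[_]; rewrite ltr_pdivlMr; last by lra.
nra.
Qed.

Lemma analytic_calH (f : R -> R[i]) : L2 f -> analytic_disk (calH f).
Proof.
move=> lf; apply: (@power_series_derivable (fun n => lcoef n f) (Num.sqrt (n2 f))).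
  move=> n; rewrite -(@ler_pXn2r _ 2)// ?nnegrE ?normc_ge0 ?sqrtr_ge0// [leRHS]sqr_sqrtr ?n2_ge0//.
  apply: le_trans (sum_normc_lcoef n.+1 lf); rewrite big_ord_recr /= lerDr.
  by apply: sumr_ge0 => i _; exact: sqr_ge0.
move=> z dz; have /ccvgP := calH_series lf dz.
by rewrite /series /=; under eq_fun do rewrite big_mkord.
Qed.

End HardySpace.

(** * The Schwarz integral on the circle *)

Section Circle.
Variable R : realType.
Notation mu := (@lebesgue_measure R).
Notation Re := (@complex.Re R).
Notation Im := (@complex.Im R).
Local Open Scope complex_scope.
Implicit Types (f g : R -> R[i]).

(** ** Integration over the circle *)

Definition ccont f := continuous (Re \o f) /\ continuous (Im \o f).

Lemma ccontD f g : ccont f -> ccont g -> ccont (fun t => f t + g t).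
Proof.
move=> [fr fi] [gr gi]; split => t.
  rewrite (_ : Re \o _ = (fun t => (Re \o f) t + (Re \o g) t)); last by apply/funext => s; rewrite /comp ReD.
  by apply: cvgD; [exact: fr|exact: gr].
rewrite (_ : Im \o _ = (fun t => (Im \o f) t + (Im \o g) t)); last by apply/funext => s; rewrite /comp ImD.
by apply: cvgD; [exact: fi|exact: gi].
Qed.

Lemma ccontM f g : ccont f -> ccont g -> ccont (fun t => f t * g t).
Proof.
move=> [fr fi] [gr gi]; split => t.
  rewrite (_ : Re \o _ = (fun t => (Re \o f) t * (Re \o g) t - (Im \o f) t * (Im \o g) t)); last first.
    by apply/funext => s; rewrite /comp ReM.
  by apply: cvgB; apply: cvgM; [exact: fr|exact: gr|exact: fi|exact: gi].
rewrite (_ : Im \o _ = (fun t => (Re \o f) t * (Im \o g) t + (Im \o f) t * (Re \o g) t)); last first.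
  by apply/funext => s; rewrite /comp ImM.
by apply: cvgD; apply: cvgM; [exact: fr|exact: gi|exact: fi|exact: gr].
Qed.

Lemma ccont_cst (c : R[i]) : ccont (fun=> c).
Proof. by split=> t; exact: cvg_cst. Qed.

Lemma ccont_real (u : R -> R) : continuous u -> ccont (fun t => (u t)%:C).
Proof. by move=> cu; split=> t; [exact: cu|exact: cvg_cst]. Qed.

Lemma ccontX f n : ccont f -> ccont (fun t => f t ^+ n).
Proof.
move=> cf; elim: n => [|n ih]; first exact: ccont_cst.
by under eq_fun do rewrite exprS; exact: ccontM.
Qed.

Lemma ccont_sum (I : Type) (s : seq I) (F : I -> R -> R[i]) : (forall i, ccont (F i)) ->
  ccont (fun t => \sum_(i <- s) F i t).
Proof.
move=> cF; elim: s => [|i s ih].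
  by under eq_fun do rewrite big_nil; exact: ccont_cst.
by under eq_fun do rewrite big_cons; exact: ccontD.
Qed.

Lemma normc_sqr_gt0 (z : R[i]) : z != 0 -> 0 < Re z ^+ 2 + Im z ^+ 2.
Proof.
move=> z0; rewrite lt_neqAle addr_ge0 ?sqr_ge0// andbT eq_sym.
rewrite paddr_eq0 ?sqr_ge0// !sqrf_eq0; apply: contraNN z0 => /andP[/eqP r0 /eqP i0].
by apply/eqP/complexP.
Qed.

Lemma continuous_normc_sqr f : ccont f -> continuous (fun t => Re (f t) ^+ 2 + Im (f t) ^+ 2).
Proof.
by move=> [fr fi] t; apply: cvgD; rewrite !expr2; apply: cvgM; [exact: fr|exact: fr|exact: fi|exact: fi].
Qed.

Lemma ccontV f : ccont f -> (forall t, f t != 0) -> ccont (fun t => (f t)^-1).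
Proof.
move=> cf f0; have cn := continuous_normc_sqr cf; have [fr fi] := cf.
have n0 t : Re (f t) ^+ 2 + Im (f t) ^+ 2 != 0 by rewrite gt_eqF// normc_sqr_gt0.
split => t.
  rewrite (_ : Re \o _ = (fun t => (Re \o f) t * (Re (f t) ^+ 2 + Im (f t) ^+ 2)^-1)); last first.
    by apply/funext => s /=; case: (f s).
  by apply: cvgM; [exact: fr|apply: cvgV => //; exact: cn].
rewrite (_ : Im \o _ = (fun t => - ((Im \o f) t * (Re (f t) ^+ 2 + Im (f t) ^+ 2)^-1))); last first.
  by apply/funext => s /=; case: (f s).
by apply: cvgN; apply: cvgM; [exact: fi|apply: cvgV => //; exact: cn].
Qed.

Definition circint f := cintegral `[0, 2 * pi] f.

Lemma integrable_circ (u : R -> R) : continuous u -> mu.-integrable `[0, 2 * pi] (EFin \o u).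
Proof.
move=> cu; apply: continuous_compact_integrable; first exact: segment_compact.
exact: continuous_subspaceT.
Qed.

Lemma circint_lin (a : R[i]) f g : ccont f -> ccont g ->
  circint (fun t => a * f t + g t) = a * circint f + circint g.
Proof.
move=> [fr fi] [gr gi].
have i1 := integrable_circ fr; have i2 := integrable_circ fi.
have i3 := integrable_circ gr; have i4 := integrable_circ gi.
have mI : measurable (`[0, 2 * pi]%classic : set (g_sigma_algebraType (R.-ocitv.-measurable))).
  exact: measurable_itv.
have lin (b c : R) (u v w : R -> R) : mu.-integrable `[0, 2 * pi] (EFin \o u) ->
  mu.-integrable `[0, 2 * pi] (EFin \o v) -> mu.-integrable `[0, 2 * pi] (EFin \o w) ->
  \int[mu]_(t in `[0, 2 * pi]) (b * u t + c * v t + w t) =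
  b * \int[mu]_(t in `[0, 2 * pi]) u t + c * \int[mu]_(t in `[0, 2 * pi]) v t
    + \int[mu]_(t in `[0, 2 * pi]) w t.
  move=> iu iv iw.
  have ibu : mu.-integrable `[0, 2 * pi] (EFin \o (fun t => b * u t)) := integrableZl mI b iu.
  have icv : mu.-integrable `[0, 2 * pi] (EFin \o (fun t => c * v t)) := integrableZl mI c iv.
  have iuv : mu.-integrable `[0, 2 * pi] (EFin \o (fun t => b * u t + c * v t)) := integrableD mI ibu icv.
  by rewrite RintegralD// RintegralD// !RintegralZl.
rewrite /circint /cintegral; apply: complexP.
  rewrite ReD ReM /= -mulNr -lin//; apply: eq_Rintegral => t _.
  by rewrite ReD ReM mulNr.
rewrite ImD ImM /= -lin//; apply: eq_Rintegral => t _.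
by rewrite ImD ImM.
Qed.

Lemma circint0 : circint (fun=> 0) = 0.
Proof.
have H := circint_lin (- 1) (ccont_cst 0) (ccont_cst 0).
transitivity (circint (fun=> - 1 * 0 + 0)).
  by congr circint; apply/funext => t; rewrite mulr0 addr0.
by rewrite H; ring.
Qed.

Lemma circintZ (a : R[i]) f : ccont f -> circint (fun t => a * f t) = a * circint f.
Proof.
move=> cf; rewrite -[RHS]addr0 -circint0 -(circint_lin a cf (ccont_cst 0)).
by congr circint; apply/funext => t; rewrite addr0.
Qed.

Lemma circintD f g : ccont f -> ccont g -> circint (fun t => f t + g t) = circint f + circint g.
Proof.
move=> cf cg; rewrite -[circint f]mul1r -(circint_lin 1 cf cg).
by congr circint; apply/funext => t; rewrite mul1r.
Qed.

Lemma circint_sum (I : Type) (s : seq I) (F : I -> R -> R[i]) : (forall i, ccont (F i)) ->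
  circint (fun t => \sum_(i <- s) F i t) = \sum_(i <- s) circint (F i).
Proof.
move=> cF; elim: s => [|i s ih].
  by rewrite big_nil -[RHS]circint0; congr circint; apply/funext => t; rewrite big_nil.
rewrite big_cons -ih -circintD//; last exact: ccont_sum.
by congr circint; apply/funext => t; rewrite big_cons.
Qed.

Lemma circint_le f (M : R) : ccont f -> (forall t, Normc.normc (f t) <= M) ->
  Normc.normc (circint f) <= 2 * (2 * pi * M).
Proof.
move=> [fr fi] fM; apply: le_trans (normc_le_ReIm _) _ => /=.
have mI : measurable (`[0, 2 * pi]%classic : set (g_sigma_algebraType (R.-ocitv.-measurable))).
  exact: measurable_itv.
have p0 : 0 <= 2 * pi :> R by rewrite mulr_ge0// pi_ge0.
have bound (u : R -> R) : continuous u -> (forall t, `|u t| <= M) ->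
    `|\int[mu]_(t in `[0, 2 * pi]) u t| <= 2 * pi * M.
  move=> cu uM; have iu := integrable_circ cu.
  have iM : mu.-integrable `[0, 2 * pi] (EFin \o (fun=> M : R)).
    by apply: integrable_circ => t; exact: cvg_cst.
  apply: le_trans (le_normr_Rintegral mI iu) _.
  apply: (@le_trans _ _ (\int[mu]_(t in `[0, 2 * pi]) M)).
    apply: le_Rintegral => //; exact: (integrable_abse iu).
  rewrite Rintegral_cst//= lebesgue_measure_itv/= lte_fin; case: ifP => _ /=.
    by rewrite subr0 mulrC.
  by rewrite mulr0 mulr_ge0// (le_trans _ (uM 0)).
rewrite [leRHS]mulr_natl mulr2n; apply: lerD; apply: bound => // t.
  by apply: le_trans (fM t); exact: Re_le_normc.
by apply: le_trans (fM t); exact: Im_le_normc.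
Qed.

Lemma expiD (s t : R) : expi (s + t) = expi s * expi t.
Proof. by apply: complexP; rewrite ?ReM ?ImM /= ?cosD ?sinD//; ring. Qed.

Lemma expi_neq0 (t : R) : expi t != 0.
Proof.
rewrite eq_complex /= negb_and; have := cos2Dsin2 t.
have [->|//] := eqVneq (cos t) 0; have [->|//] := eqVneq (sin t) 0.
by rewrite expr0n addr0 => /eqP; rewrite eq_sym oner_eq0.
Qed.

Lemma normc_expi (t : R) : Normc.normc (expi t) = 1.
Proof. by rewrite /= cos2Dsin2 sqrtr1. Qed.

Lemma expiMn (t : R) n : expi t ^+ n = expi (n%:R * t).
Proof.
elim: n => [|n ih]; first by rewrite expr0 mul0r /expi cos0 sin0.
by rewrite exprS ih -expiD -natr1 mulrDl mul1r addrC.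
Qed.

Lemma expiV (t : R) : (expi t)^-1 = expi (- t).
Proof.
apply: (mulfI (expi_neq0 t)); rewrite mulfV ?expi_neq0// -expiD subrr.
by rewrite /expi cos0 sin0.
Qed.

Lemma ccont_expiM (c : R) : ccont (fun t => expi (c * t)).
Proof.
have cc : continuous (fun t : R => c * t).
  by move=> t; apply: cvgM; [exact: cvg_cst|exact: cvg_id].
split=> t; rewrite /comp /=.
  by apply: continuous_comp; [exact: cc|exact: continuous_cos].
by apply: continuous_comp; [exact: cc|exact: continuous_sin].
Qed.

Lemma circint_expi (c : R) : c != 0 -> expi (c * (2 * pi)) = 1 ->
  circint (fun t => expi (c * t)) = 0.
Proof.
move=> c0 [c1 s1]; have p0 : 0 < 2 * pi :> R by rewrite mulr_gt0// pi_gt0.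
have [cr ci] := ccont_expiM c.
rewrite /circint /cintegral; apply: complexP => /=.
  rewrite /Rintegral (@continuous_FTC2 _ _ (fun t : R => c^-1 * sin (c * t)) 0 (2 * pi))//.
  - by rewrite s1 !mulr0 sin0 mulr0 -EFinB subrr.
  - by apply: continuous_subspaceT; exact: cr.
  - have d (x : R) : is_derive x 1 (fun t : R => c^-1 * sin (c * t)) (cos (c * x)).
      have H := is_derive_sinl c x; apply: is_derive_eq.
      by rewrite /GRing.scale/= mulrA mulVf// mul1r.
    have cF : continuous (fun t : R => c^-1 * sin (c * t)).
      by move=> x; apply: differentiable_continuous; apply/derivable1_diffP; have [] := d x.
    split; first by move=> x _; have [] := d x.
    + by apply: cvg_at_right_filter; exact: cF.
    + by apply: cvg_at_left_filter; exact: cF.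
  - move=> x _; rewrite derive1E; have H := is_derive_sinl c x.
    by rewrite derive_val /GRing.scale/= mulrA mulVf// mul1r.
rewrite /Rintegral (@continuous_FTC2 _ _ (fun t : R => - c^-1 * cos (c * t)) 0 (2 * pi))//.
- by rewrite c1 mulr0 cos0 -EFinB subrr.
- by apply: continuous_subspaceT; exact: ci.
- have d (x : R) : is_derive x 1 (fun t : R => - c^-1 * cos (c * t)) (sin (c * x)).
    have H := is_derive_cosl c x; apply: is_derive_eq.
    by rewrite /GRing.scale/= mulrNN mulrA mulVf// mul1r.
  have cF : continuous (fun t : R => - c^-1 * cos (c * t)).
    by move=> x; apply: differentiable_continuous; apply/derivable1_diffP; have [] := d x.
  split; first by move=> x _; have [] := d x.
  + by apply: cvg_at_right_filter; exact: cF.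
  + by apply: cvg_at_left_filter; exact: cF.
- move=> x _; rewrite derive1E; have H := is_derive_cosl c x.
  by rewrite derive_val /GRing.scale/= mulrNN mulrA mulVf// mul1r.
Qed.

Lemma circint_expiX n : circint (fun t => expi t ^+ n.+1) = 0.
Proof.
transitivity (circint (fun t => expi (n.+1%:R * t))).
  by congr circint; apply/funext => t; rewrite expiMn.
apply: circint_expi; first by rewrite pnatr_eq0.
by rewrite -expiMn /expi [2 * pi]mulrC mulr_natr cos2pi sin2pi expr1n.
Qed.

Lemma circint_expiVX n : circint (fun t => (expi t)^-1 ^+ n.+1) = 0.
Proof.
transitivity (circint (fun t => expi (- n.+1%:R * t))).
  by congr circint; apply/funext => t; rewrite expiV expiMn mulrN mulNr.
apply: circint_expi; first by rewrite oppr_eq0 pnatr_eq0.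
rewrite mulNr -expiV -expiMn /expi [2 * pi]mulrC mulr_natr cos2pi sin2pi expr1n.
by rewrite invr1.
Qed.

(** ** The Schwarz kernel *)

(** The kernel in the integral representation of an outer function. *)
Definition schwarz (z : R[i]) (t : R) : R[i] := (expi t + z) / (expi t - z).

Lemma normc_subl (x y : R[i]) : Normc.normc x - Normc.normc y <= Normc.normc (x - y).
Proof. by rewrite lerBlDr; have := le_normcD (x - y) y; rewrite subrK. Qed.

Lemma expi_sub_neq0 (z : R[i]) t : disk z -> expi t - z != 0.
Proof.
move=> /diskP z1; apply/eqP => H; have := normc_subl (expi t) z.
rewrite H Normc.normc0 normc_expi; lra.
Qed.

Lemma ccont_expi : ccont (@expi R).
Proof.
have := ccont_expiM 1; congr ccont; apply/funext => t; by rewrite mul1r.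
Qed.

Lemma ccont_expiV : ccont (fun t : R => (expi t)^-1).
Proof. by apply: ccontV; [exact: ccont_expi|exact: expi_neq0]. Qed.

Lemma ccont_schwarz (z : R[i]) : disk z -> ccont (schwarz z).
Proof.
move=> dz; apply: ccontM; first by apply: ccontD; [exact: ccont_expi|exact: ccont_cst].
apply: ccontV; last by move=> t; exact: expi_sub_neq0.
by apply: ccontD; [exact: ccont_expi|exact: ccont_cst].
Qed.

Lemma normc_schwarz (z : R[i]) t : disk z ->
  Normc.normc (schwarz z t) <= 2 / (1 - Normc.normc z).
Proof.
move=> /diskP z1; rewrite /schwarz Normc.normcM Normc.normcV.
have h1 := le_normcD (expi t) z; have h2 := normc_subl (expi t) z.
rewrite normc_expi in h1 h2.
apply: ler_pM; rewrite ?invr_ge0 ?normc_ge0//; first by lra.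
by rewrite lef_pV2 ?posrE//; lra.
Qed.

(** The relation [schwarz z * (w - z) = w + z] for [w] on the circle yields all
    moments of the kernel by recursion. *)
Lemma schwarzM (z : R[i]) t : disk z -> schwarz z t * expi t = expi t + z + z * schwarz z t.
Proof.
move=> dz; have n0 := expi_sub_neq0 t dz.
by rewrite /schwarz; field.
Qed.

Lemma circint1 : circint (fun=> 1) = (2 * pi)%:C.
Proof.
rewrite /circint /cintegral !Rintegral_cst; try exact: measurable_itv.
rewrite /= mul0r mul1r lebesgue_measure_itv/= lte_fin ifT; first by rewrite -EFinB subr0.
by rewrite mulr_gt0// pi_gt0.
Qed.

Section SchwarzMoments.
Variables (z : R[i]) (dz : disk z).

Let cS := ccont_schwarz dz.
Let cw n := @ccontX _ n ccont_expi.
Let cv n := @ccontX _ n ccont_expiV.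

(** By [schwarzM] the moment [V k] is [z ^+ n * V (k + n)] for every [n], while
    all moments are bounded. *)
Lemma schwarz_neg_moment m : circint (fun t => schwarz z t * (expi t)^-1 ^+ m.+1) = 0.
Proof.
pose V k := circint (fun t => schwarz z t * (expi t)^-1 ^+ k).
have rec k : V k.+1 = z * V k.+2.
  rewrite /V.
  transitivity (circint (fun t => (expi t)^-1 ^+ k.+1 +
      (z * (expi t)^-1 ^+ k.+2 + z * (schwarz z t * (expi t)^-1 ^+ k.+2)))).
    congr circint; apply/funext => t; have e0 := expi_neq0 t.
    transitivity (schwarz z t * expi t * ((expi t)^-1 ^+ k.+2)).
      by rewrite [in RHS]exprS -mulrA; congr (_ * _); rewrite mulVKf.
    rewrite schwarzM// !mulrDl -!addrA -mulrA; congr (_ + _).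
    by rewrite exprS mulVKf.
  have c1 := cv k.+1; have c2 := ccontM (ccont_cst z) (cv k.+2).
  have c3 := ccontM (ccont_cst z) (ccontM cS (cv k.+2)).
  rewrite !circintD//; last exact: ccontD.
  rewrite !circintZ//; last exact: ccontM.
  by rewrite !circint_expiVX mulr0 !add0r.
have iter n : V m.+1 = z ^+ n * V (m.+1 + n)%N.
  elim: n => [|n ih]; first by rewrite expr0 mul1r addn0.
  by rewrite ih addSn rec exprSr -mulrA addnS.
have bd k : Normc.normc (V k) <= 2 * (2 * pi * (2 / (1 - Normc.normc z))).
  apply: circint_le; first exact: ccontM.
  move=> t; rewrite Normc.normcM normcX Normc.normcV normc_expi invr1 expr1n mulr1.
  exact: normc_schwarz.
set M := 2 * (2 * pi * _) in bd.
apply: Normc.eq0_normc; apply/eqP; rewrite eq_le normc_ge0 andbT.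
have zlim : Normc.normc z ^+ n * M @[n --> \oo] --> (0 : R).
  rewrite -[X in _ --> X](mul0r M); apply: cvgM; last exact: cvg_cst.
  by apply: cvg_expr; rewrite ger0_norm ?normc_ge0//; apply/diskP.
rewrite -/(V m.+1) -(cvg_lim _ zlim)//; apply: limr_ge; first by apply/cvg_ex; exists 0.
apply: nearW => n; rewrite (iter n) Normc.normcM normcX.
by apply: ler_wpM2l => //; rewrite exprn_ge0// normc_ge0.
Qed.

Lemma schwarz_moment k : circint (fun t => schwarz z t * expi t ^+ k.+1) = (4 * pi)%:C * z ^+ k.+1.
Proof.
have I0 : circint (schwarz z) = (2 * pi)%:C.
  transitivity (circint (fun t => 1 + (z * (expi t)^-1 ^+ 1 + z * (schwarz z t * (expi t)^-1 ^+ 1)))).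
    congr circint; apply/funext => t; have e0 := expi_neq0 t.
    transitivity (schwarz z t * expi t * (expi t)^-1); first by rewrite mulfK.
    by rewrite schwarzM// !mulrDl mulfV// expr1 -!addrA mulrA.
  have c2 := ccontM (ccont_cst z) (cv 1); have c3 := ccontM (ccont_cst z) (ccontM cS (cv 1)).
  have c1 := ccont_cst 1; have c4 := ccontM cS (cv 1); have c5 := cv 1.
  rewrite circintD//; last exact: ccontD.
  rewrite circintD// !circintZ// circint1 circint_expiVX schwarz_neg_moment.
  by rewrite !mulr0 !addr0.
have rec j : circint (fun t => schwarz z t * expi t ^+ j.+1) =
    z * circint (fun t => expi t ^+ j) + z * circint (fun t => schwarz z t * expi t ^+ j).
  transitivity (circint (fun t => expi t ^+ j.+1 + (z * expi t ^+ j + z * (schwarz z t * expi t ^+ j)))).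
    congr circint; apply/funext => t.
    by rewrite exprS mulrA schwarzM// !mulrDl -!addrA mulrA.
  have c1 := cw j.+1; have c2 := ccontM (ccont_cst z) (cw j).
  have c3 := ccontM (ccont_cst z) (ccontM cS (cw j)).
  have c4 := ccontM cS (cw j); have c5 := cw j.
  rewrite circintD//; last exact: ccontD.
  by rewrite circintD// !circintZ// circint_expiX add0r.
elim: k => [|k ih]; rewrite rec.
  rewrite (_ : (fun t => schwarz z t * expi t ^+ 0) = schwarz z); last first.
    by apply/funext => t; rewrite expr0 mulr1.
  rewrite I0 (_ : circint (fun t => expi t ^+ 0) = (2 * pi)%:C) ?circint1//.
  rewrite -mulrDr expr1 mulrC; congr (_ * _); apply: complexP => /=; ring.
by rewrite circint_expiX mulr0 add0r ih [in RHS]exprS; ring.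
Qed.

(** The Schwarz integral recovers an analytic function from its real part: write
    the real part as half the sum with the conjugate, a negative power. *)
Lemma schwarz_Re (c : R[i]) k :
  circint (fun t => schwarz z t * (Re (c * expi t ^+ k.+1))%:C) = (2 * pi)%:C * (c * z ^+ k.+1).
Proof.
pose cj (x : R[i]) := Re x -i* Im x.
have cjM x y : cj (x * y) = cj x * cj y.
  by apply: complexP; rewrite /cj /= ?ReM ?ImM /=; ring.
have cjX x n : cj (x ^+ n) = cj x ^+ n.
  elim: n => [|n ih]; first by rewrite !expr0 /cj /= oppr0.
  by rewrite !exprS cjM ih.
have cjE t : cj (expi t) = (expi t)^-1 by rewrite expiV /expi cosN sinN.
have h (x : R[i]) : (Re x)%:C = 2^-1 * (x + cj x).
  have h2 : (2 : R[i]) = (2 : R)%:C by rewrite rmorph_nat.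
  rewrite h2 -fmorphV; apply: complexP; rewrite ?ReM ?ImM ?ReD ?ImD/=; first by field.
  by ring.
transitivity (circint (fun t => (c / 2) * (schwarz z t * expi t ^+ k.+1) +
    (cj c / 2) * (schwarz z t * (expi t)^-1 ^+ k.+1))).
  by congr circint; apply/funext => t; rewrite h cjM cjX cjE; ring.
have c1 := ccontM cS (cw k.+1); have c2 := ccontM cS (cv k.+1).
rewrite circint_lin//; last by apply: ccontM => //; exact: ccont_cst.
rewrite circintZ// schwarz_moment schwarz_neg_moment mulr0 addr0.
have -> : (4 * pi)%:C = 2 * (2 * pi)%:C :> R[i].
  by rewrite -(rmorph_nat (real_complex R) 2) -rmorphM; congr (_%:C); ring.
by field.
Qed.

End SchwarzMoments.

End Circle.

(** * Outer polynomials *)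

Section OuterPoly.
Variable R : realType.
Notation mu := (@lebesgue_measure R).
Notation Re := (@complex.Re R).
Notation Im := (@complex.Im R).
Local Open Scope complex_scope.

(** ** The logarithm on the circle *)

Lemma cexpD (x y : R[i]) : cexp (x + y) = cexp x * cexp y.
Proof.
rewrite /cexp ReD ImD expRD cosD sinD.
by apply: complexP; rewrite !(ReM, ImM) /=; ring.
Qed.

Lemma cexp0 : cexp (0 : R[i]) = 1.
Proof. by rewrite /cexp /= expR0 cos0 sin0 mul1r. Qed.

Lemma cexpNK (x : R[i]) : cexp x * cexp (- x) = 1.
Proof. by rewrite -cexpD subrr cexp0. Qed.

Lemma cexpMn (x : R[i]) n : cexp (n%:R * x) = cexp x ^+ n.
Proof.
elim: n => [|n ih]; first by rewrite mul0r expr0 cexp0.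
by rewrite -natr1 mulrDl mul1r cexpD ih exprSr.
Qed.

Lemma normc_cexp (x : R[i]) : Normc.normc (cexp x) = expR (Re x).
Proof.
rewrite /cexp Normc.normcM normc_real ger0_norm ?expR_ge0//.
by rewrite /= cos2Dsin2 sqrtr1 mulr1.
Qed.

(** Partial sums of the power series of [log (1 - x)]; working with these
    polynomials dispenses with a branch of the complex logarithm. *)
Definition logsum N (x : R[i]) : R[i] := \sum_(k < N) - (k.+1%:R)^-1%:C * x ^+ k.+1.

Let logre N (x : R[i]) (s : R) := \sum_(k < N) - (k.+1%:R)^-1 * Re (x ^+ k.+1) * s ^+ k.+1.
Let logim N (x : R[i]) (s : R) := \sum_(k < N) - (k.+1%:R)^-1 * Im (x ^+ k.+1) * s ^+ k.+1.

Lemma logsumE N x s : logsum N (s%:C * x) = logre N x s +i* logim N x s.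
Proof.
rewrite /logsum /logre /logim.
elim/big_ind3 : _ => // [x1 x2 x3 y1 y2 y3 -> ->//|k _].
rewrite exprMn -rmorphXn; case: (x ^+ k.+1) => a b.
by apply: complexP; rewrite !(ReM, ImM)/=; ring.
Qed.

Lemma is_derive_powsum N (c : nat -> R) (s : R) :
  is_derive s 1 (fun s => \sum_(k < N) - (k.+1%:R)^-1 * c k * s ^+ k.+1)
    (- \sum_(k < N) c k * s ^+ k).
Proof.
elim: N => [|N ih].
  rewrite big_ord0 oppr0 (_ : (fun s => _) = cst 0); last first.
    by apply/funext => x; rewrite big_ord0.
  exact: is_derive_cst.
rewrite (_ : (fun s => _) = (fun s => \sum_(k < N) - (k.+1%:R)^-1 * c k * s ^+ k.+1) +
   (- (N.+1%:R)^-1 * c N) \*: ((id : R -> R) ^+ N.+1)); last first.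
  by apply/funext => x; rewrite big_ord_recr /= addrfctE exprfctE.
apply: is_derive_eq.
rewrite big_ord_recr /= opprD; congr (_ + _).
rewrite /GRing.scale /= mulr1 mulNr mulNr; congr (- _).
by rewrite mulrACA mulVf ?mul1r ?pnatr_eq0.
Qed.

(** [H s] is the real part of [exp (- i phi) * cexp (- logsum N (s x)) * (1 - s x)].
    The derivative of [logsum N] is a geometric sum, whose product with [1 - s x]
    telescopes: up to the rotation and the real part, [H] has the derivative
    [- x * (s x) ^ N * cexp (- logsum N (s x))], small for large [N]. *)
Lemma logsum_path (N : nat) (x : R[i]) (phi : R) :
  let H s := expR (- logre N x s) * (cos (logim N x s + phi) * (1 - s * Re x)
     - sin (logim N x s + phi) * (s * Im x)) in
  forall s : R, is_derive s 1 H (expR (- logre N x s) *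
    (- cos (logim N x s + phi) * (s ^+ N * Re (x ^+ N.+1)) - sin (logim N x s + phi) * (s ^+ N * Im (x ^+ N.+1)))).
Proof.
move=> H s.
pose G : R[i] := \sum_(k < N) x ^+ k.+1 * (s ^+ k)%:C.
pose P := \sum_(k < N) Re (x ^+ k.+1) * s ^+ k.
pose Q := \sum_(k < N) Im (x ^+ k.+1) * s ^+ k.
have GE : G = P +i* Q.
  rewrite /G /P /Q.
  elim/big_ind3 : _ => // [x1 x2 x3 y1 y2 y3 -> ->//|k _].
  by case: (x ^+ k.+1) => a b; apply: complexP; rewrite !(ReM, ImM)/=; ring.
have Gtel : G * (1 - s%:C * x) = x - (s ^+ N)%:C * x ^+ N.+1.
  rewrite /G; elim: N {H G P Q GE} => [|n ih]; first by rewrite big_ord0 mul0r expr0 mul1r expr1 subrr.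
  by rewrite big_ord_recr /= mulrDl ih !exprS rmorphM; ring.
have [e1 e2] : P * (1 - s * Re x) + Q * (s * Im x) = Re x - s ^+ N * Re (x ^+ N.+1) /\
    Q * (1 - s * Re x) - P * (s * Im x) = Im x - s ^+ N * Im (x ^+ N.+1).
  have := Gtel; rewrite GE; move: (x ^+ N.+1) => y.
  case: (x) => a b; case: (y) => c d /= [h1 h2].
  by split; lra.
have dp := is_derive_powsum N (fun k => Re (x ^+ k.+1)) s.
have dq := is_derive_powsum N (fun k => Im (x ^+ k.+1)) s.
rewrite -/P in dp; rewrite -/Q in dq.
have dqp : is_derive s 1 (fun s => logim N x s + phi) (- Q).
  rewrite (_ : (fun s => _) = logim N x + cst phi); last by apply/funext.
  by apply: is_derive_eq; rewrite addr0.
have dpn : is_derive s 1 (fun s => - logre N x s) P.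
  rewrite (_ : (fun s => _) = - logre N x); last by apply/funext.
  by apply: is_derive_eq; rewrite opprK.
have dA : is_derive s 1 (fun s : R => 1 - s * Re x) (- Re x).
  rewrite (_ : (fun s => _) = cst 1 - (Re x \*: (id : R -> R))); last first.
    by apply/funext => y /=; rewrite mulrC.
  by apply: is_derive_eq; rewrite /GRing.scale/= mulr1 sub0r.
have dB : is_derive s 1 (fun s : R => s * Im x) (Im x).
  rewrite (_ : (fun s => _) = (Im x \*: (id : R -> R))); last first.
    by apply/funext => y /=; rewrite mulrC.
  by apply: is_derive_eq; rewrite /GRing.scale/= mulr1.
have de : is_derive s 1 (fun s => expR (- logre N x s)) (P * expR (- logre N x s)).
  rewrite (_ : (fun s => _) = expR \o (fun s => - logre N x s))//.
  by apply: is_derive_eq; rewrite /GRing.scale/= mulrC.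
have dc : is_derive s 1 (fun s => cos (logim N x s + phi)) (Q * sin (logim N x s + phi)).
  rewrite (_ : (fun s => _) = cos \o (fun s => logim N x s + phi))//.
  by apply: is_derive_eq; rewrite /GRing.scale/=; ring.
have ds : is_derive s 1 (fun s => sin (logim N x s + phi)) (- Q * cos (logim N x s + phi)).
  rewrite (_ : (fun s => _) = sin \o (fun s => logim N x s + phi))//.
  by apply: is_derive_eq; rewrite /GRing.scale/=; ring.
rewrite (_ : H = (fun s => expR (- logre N x s)) *
  ((fun s => cos (logim N x s + phi)) * (fun s => 1 - s * Re x) -
   (fun s => sin (logim N x s + phi)) * (fun s => s * Im x))); last by apply/funext.
apply: is_derive_eq; rewrite /GRing.scale /=.
have -> : s ^+ N * Re (x ^+ N.+1) = Re x - (P * (1 - s * Re x) + Q * (s * Im x)) by rewrite e1; ring.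
have -> : s ^+ N * Im (x ^+ N.+1) = Im x - (Q * (1 - s * Re x) - P * (s * Im x)) by rewrite e2; ring.
rewrite addrfctE opprfctE !mulrfctE; ring.
Qed.

Lemma logre_bound N (x : R[i]) (r s : R) : Normc.normc x <= r -> 0 <= r < 1 -> 0 <= s <= 1 ->
  - logre N x s <= (1 - r)^-1.
Proof.
move=> xr r01 /andP[s0 s1]; have /andP[r0 r1] := r01.
rewrite -div1r; apply: le_trans (geo_sum_bounded N r01).
rewrite /logre -sumrN; apply: ler_sum => k _.
apply: le_trans (ler_norm _) _; rewrite normrN !normrM normrN normfV normr_nat.
rewrite -[leRHS]mul1r -[leRHS]mulr1 [`|s ^+ _|]ger0_norm ?exprn_ge0//.
have x1 : Normc.normc x <= 1 by lra.
apply: ler_pM; rewrite ?mulr_ge0 ?invr_ge0 ?exprn_ge0//; last by rewrite exprn_ile1.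
apply: ler_pM; rewrite ?invr_ge0//; first by rewrite invf_le1 ?ler1n.
apply: le_trans (Re_le_normc _) _; rewrite normcX exprS -[leRHS]mul1r.
apply: ler_pM; rewrite ?exprn_ge0 ?normc_ge0//.
by apply: lerXn2r; rewrite ?nnegrE ?normc_ge0.
Qed.

Lemma logre0 N x : logre N x 0 = 0.
Proof. by rewrite /logre big1// => k _; rewrite expr0n mulr0. Qed.

Lemma logim0 N x : logim N x 0 = 0.
Proof. by rewrite /logim big1// => k _; rewrite expr0n mulr0. Qed.

Lemma logsum_path_le N (x : R[i]) (r phi : R) : Normc.normc x <= r -> 0 <= r < 1 ->
  `|expR (- logre N x 1) * (cos (logim N x 1 + phi) * (1 - Re x)
     - sin (logim N x 1 + phi) * Im x) - cos phi| <= expR ((1 - r)^-1) * (2 * r ^+ N).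
Proof.
move=> xr r01; have /andP[r0 r1] := r01.
pose H s := expR (- logre N x s) * (cos (logim N x s + phi) * (1 - s * Re x)
     - sin (logim N x s + phi) * (s * Im x)).
have dH := @logsum_path N x phi.
have [||c /[!in_itv]/= /andP[c0 c1]] := MVT (ltr01 : 0 < (1 : R)) (f := H) (df := fun s => expR (- logre N x s) *
    (- cos (logim N x s + phi) * (s ^+ N * Re (x ^+ N.+1)) - sin (logim N x s + phi) * (s ^+ N * Im (x ^+ N.+1)))).
- by move=> s _; exact: dH.
- apply: continuous_subspaceT => s; apply: differentiable_continuous.
  by apply/derivable1_diffP; have [] := dH s.
rewrite subr0 mulr1 {1 2}/H logre0 logim0 oppr0 expR0 add0r !mul0r !mul1r mulr0 !subr0 mulr1.
move=> ->; rewrite normrM ger0_norm ?expR_ge0//.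
apply: ler_pM; rewrite ?expR_ge0//.
  by rewrite ler_expR; apply: logre_bound => //; apply/andP; split; exact: ltW.
have cN : `|c ^+ N| <= 1 by rewrite ger0_norm ?exprn_ge0 ?exprn_ile1// ltW.
have xN : Normc.normc (x ^+ N.+1) <= r ^+ N.
  rewrite normcX exprS -[leRHS]mul1r; apply: ler_pM; rewrite ?exprn_ge0 ?normc_ge0//; first by lra.
  by apply: lerXn2r; rewrite ?nnegrE ?normc_ge0.
have b (y z : R) : `|y| <= 1 -> `|z| <= r ^+ N -> `|y * (c ^+ N * z)| <= r ^+ N.
  move=> y1 zr; rewrite !normrM mulrA; apply: (@le_trans _ _ (1 * r ^+ N)); last by rewrite mul1r.
  by apply: ler_pM; rewrite ?mulr_ge0// -[leRHS]mulr1; apply: ler_pM.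
rewrite mulr_natl mulr2n; apply: le_trans (ler_normB _ _) _; apply: lerD; apply: b.
- by rewrite normrN ler_norml cos_geN1 cos_le1.
- by apply: le_trans xN; exact: Re_le_normc.
- by rewrite ler_norml sin_geN1 sin_le1.
- by apply: le_trans xN; exact: Im_le_normc.
Qed.

(** The mean value theorem along [s x], [0 <= s <= 1]; the angles [0] and [- pi / 2]
    give the real and the imaginary part. *)
Lemma cexp_logsum N (x : R[i]) (r : R) : Normc.normc x <= r -> 0 <= r < 1 ->
  Normc.normc (cexp (- logsum N x) * (1 - x) - 1) <= 4 * expR ((1 - r)^-1) * r ^+ N.
Proof.
move=> xr r01; apply: le_trans (normc_le_ReIm _) _.
have LE : logsum N x = logre N x 1 +i* logim N x 1 by rewrite -logsumE mul1r.
have h1 := logsum_path_le N 0 xr r01; have h2 := logsum_path_le N (- (pi / 2)) xr r01.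
rewrite !addr0 cos0 in h1; rewrite cosN cos_pihalf subr0 cosBpihalf sinBpihalf in h2.
rewrite (_ : 4 * _ * _ = expR ((1 - r)^-1) * (2 * r ^+ N) + expR ((1 - r)^-1) * (2 * r ^+ N)); last by ring.
have EX : cexp (- logsum N x) = (expR (- logre N x 1) * cos (logim N x 1)) +i*
    (- (expR (- logre N x 1) * sin (logim N x 1))).
  by rewrite /cexp LE /= cosN sinN; apply: complexP => /=; ring.
apply: lerD.
  apply: le_trans h1; rewrite EX; case: (x) => a b /=.
  by rewrite le_eqVlt; apply/orP; left; apply/eqP; congr (`|_|); ring.
apply: le_trans h2; rewrite EX -normrN; case: (x) => a b /=.
by rewrite le_eqVlt; apply/orP; left; apply/eqP; congr (`|_|); ring.
Qed.

Lemma ln_near1 (y : R) : `|y - 1| <= 1 / 2 -> `|ln y| <= 2 * `|y - 1|.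
Proof.
move=> y1; have y0 : 1 / 2 <= y by move: y1; rewrite ler_norml => /andP[]; lra.
have ypos : 0 < y by lra.
have h1 : ln y <= y - 1.
  by rewrite -{1}(subrK 1 y) (addrC _ 1); apply: le_ln1Dx; lra.
have h2 : - ln y <= y^-1 - 1.
  rewrite -lnV ?posrE//.
  have iy : 0 < y^-1 by rewrite invr_gt0.
  by rewrite -{1}(subrK 1 y^-1) (addrC _ 1); apply: le_ln1Dx; lra.
have h3 : y^-1 - 1 <= 2 * `|y - 1|.
  have -> : y^-1 - 1 = (1 - y) / y by field; rewrite gt_eqF.
  rewrite ler_pdivrMr//; have := normr_ge0 (y - 1); have := ler_norm (1 - y); rewrite distrC.
  by move=> a b; nra.
rewrite ler_norml; apply/andP; split; first by lra.
by apply: le_trans h1 _; have := ler_norm (y - 1); have := normr_ge0 (y - 1); lra.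
Qed.

Lemma ln_normc_logsum N (x : R[i]) (r : R) : Normc.normc x <= r -> 0 <= r < 1 ->
  4 * expR ((1 - r)^-1) * r ^+ N <= 1 / 2 ->
  `|ln (Normc.normc (1 - x)) - Re (logsum N x)| <= 2 * (4 * expR ((1 - r)^-1) * r ^+ N).
Proof.
move=> xr r01 small; have H := cexp_logsum N xr r01.
have x1 : 0 < Normc.normc (1 - x).
  by have := normc_subl 1 x; rewrite Normc.normc1; case/andP: r01; lra.
set y := Normc.normc (cexp (- logsum N x) * (1 - x)).
have yE : ln y = ln (Normc.normc (1 - x)) - Re (logsum N x).
  rewrite /y Normc.normcM normc_cexp lnM ?posrE ?expR_gt0// expRK addrC; congr (_ + _).
  by case: (logsum N x).
have y1 : `|y - 1| <= 4 * expR ((1 - r)^-1) * r ^+ N.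
  apply: le_trans H; rewrite ler_norml; apply/andP; split.
    have := normc_subl 1 (cexp (- logsum N x) * (1 - x)).
    by rewrite Normc.normc1 normc_sub_swap -/y; lra.
  by have := normc_subl (cexp (- logsum N x) * (1 - x)) 1; rewrite Normc.normc1.
rewrite -yE; apply: le_trans (ln_near1 (le_trans y1 small)) _.
by apply: ler_wpM2l.
Qed.

Lemma ccont_ln_normc (f : R -> R[i]) : ccont f -> (forall t, f t != 0) ->
  ccont (fun t => (ln (Normc.normc (f t)))%:C).
Proof.
move=> cf f0; apply: ccont_real => t.
rewrite (_ : (fun s => _) = (fun s => 2^-1 * ln (Re (f s) ^+ 2 + Im (f s) ^+ 2))); last first.
  apply/funext => s; rewrite -normc_sqr lnXn; last first.
    by rewrite lt_neqAle normc_ge0 andbT eq_sym; apply: contraNN (f0 s) => /eqP /Normc.eq0_normc ->.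
  by rewrite mulr2n; field.
apply: cvgM; first exact: cvg_cst.
apply: (@continuous_comp _ _ _ (fun s => Re (f s) ^+ 2 + Im (f s) ^+ 2) (@ln R)).
  exact: continuous_normc_sqr.
by apply: continuous_ln; rewrite normc_sqr_gt0.
Qed.

(** With [log |1 - a w|] replaced by the real part of a partial sum, [schwarz_Re]
    computes the integral as [logsum N (a z)]; both sides converge, uniformly on
    the circle, and [cexp_logsum] identifies the limit. *)
Lemma schwarz_ln (a z : R[i]) : disk a -> disk z ->
  cexp ((2 * pi)^-1%:C *
    circint (fun t => schwarz z t * (ln (Normc.normc (1 - a * expi t)))%:C)) = 1 - a * z.
Proof.
move=> da dz.
set J := circint _.
have /diskP a1 := da; have /diskP z1 := dz.
set r := Normc.normc a in a1; have r01 : 0 <= r < 1 by rewrite normc_ge0.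
have p0 : 0 < 2 * pi :> R by rewrite mulr_gt0// pi_gt0.
have cS := ccont_schwarz dz.
have cL N : ccont (fun t => (Re (logsum N (a * expi t)))%:C).
  apply: ccont_real; suff [] : ccont (fun t => logsum N (a * expi t)) by [].
  apply: ccont_sum => k; apply: ccontM; first exact: ccont_cst.
  by apply: ccontX; apply: ccontM; [exact: ccont_cst|exact: ccont_expi].
have JN N : circint (fun t => schwarz z t * (Re (logsum N (a * expi t)))%:C) =
    (2 * pi)%:C * logsum N (a * z).
  transitivity (circint (fun t => \sum_(k < N) schwarz z t *
      (Re ((- (k.+1%:R)^-1%:C * a ^+ k.+1) * expi t ^+ k.+1))%:C)).
    congr circint; apply/funext => t; rewrite -mulr_sumr; congr (_ * _).
    rewrite -(rmorph_sum (real_complex R)); congr (_%:C).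
    rewrite -(big_morph _ (@ReD R) (erefl : Re 0 = 0)); congr (Re _).
    by apply: eq_bigr => k _; rewrite exprMn mulrA.
  rewrite circint_sum; last first.
    move=> k; apply: ccontM => //; apply: ccont_real.
    suff [] : ccont (fun t => (- (k.+1%:R)^-1%:C * a ^+ k.+1) * expi t ^+ k.+1) by [].
    by apply: ccontM; [exact: ccont_cst|apply: ccontX; exact: ccont_expi].
  rewrite mulr_sumr; apply: eq_bigr => k _; rewrite schwarz_Re//.
  by rewrite (exprMn _ a z) -!mulrA.
have ne0 t : 1 - a * expi t != 0.
  apply/eqP => H; have := normc_subl 1 (a * expi t).
  rewrite H Normc.normc0 Normc.normcM normc_expi Normc.normc1 mulr1 -/r; lra.
have cln : ccont (fun t => (ln (Normc.normc (1 - a * expi t)))%:C).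
  apply: ccont_ln_normc => //; have := ccontD (ccont_cst 1) (ccontM (ccont_cst (- a)) (@ccont_expi R)).
  by congr ccont; apply/funext => t; rewrite mulNr.
pose d N := 4 * expR ((1 - r)^-1) * r ^+ N.
have dlim : d N @[N --> \oo] --> (0 : R).
  rewrite -[X in _ --> X](mulr0 (4 * expR ((1 - r)^-1))); apply: cvgM; first exact: cvg_cst.
  by apply: cvg_expr; rewrite ger0_norm//; case/andP: r01.
pose K := (2 * pi)^-1 * (2 * (2 * pi * (2 / (1 - Normc.normc z) * 2))).
have near_d : \forall N \near \oo, Normc.normc ((2 * pi)^-1%:C * J - logsum N (a * z)) <= K * d N.
  have half : 0 < 1 / 2 :> R by rewrite divr_gt0.
  have [M _ HM] := cvgr_le _ dlim _ half.
  exists M => // N /= MN; have dN := HM N MN; rewrite /= in dN.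
  have -> : (2 * pi)^-1%:C * J - logsum N (a * z) = (2 * pi)^-1%:C *
      circint (fun t => schwarz z t * ((ln (Normc.normc (1 - a * expi t)))%:C - (Re (logsum N (a * expi t)))%:C)).
    transitivity ((2 * pi)^-1%:C * (J - (2 * pi)%:C * logsum N (a * z))).
      rewrite mulrBr; congr (_ - _); rewrite mulrA -rmorphM mulVf ?gt_eqF//.
      by rewrite rmorph1 mul1r.
    congr (_ * _); rewrite -JN addrC -mulN1r -circint_lin; try exact: ccontM.
    by congr circint; apply/funext => t; ring.
  rewrite Normc.normcM normc_real gtr0_norm ?invr_gt0// /K -mulrA.
  apply: ler_wpM2l; first by rewrite invr_ge0 ltW.
  apply: le_trans (circint_le (M := 2 / (1 - Normc.normc z) * (2 * d N)) _ _) _.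
  - apply: ccontM => //; apply: ccontD => //.
    have := ccontM (ccont_cst (- 1)) (cL N).
    by congr ccont; apply/funext => t; rewrite mulN1r.
  - move=> t; rewrite Normc.normcM -rmorphB normc_real.
    apply: ler_pM; rewrite ?normc_ge0//; first exact: normc_schwarz.
    by apply: ln_normc_logsum => //; rewrite Normc.normcM normc_expi mulr1.
  by rewrite le_eqVlt; apply/orP; left; apply/eqP; ring.
set j := (2 * pi)^-1%:C * J in near_d *.
have jlim : Normc.normc (j - logsum N (a * z)) @[N --> \oo] --> (0 : R).
  apply: (@squeeze_cvgr _ _ _ _ (fun=> 0) (fun N => K * d N)).
  - by apply: filterS near_d => N ->; rewrite normc_ge0.
  - exact: cvg_cst.
  - by rewrite -[X in _ --> X](mulr0 K); apply: cvgM => //; exact: cvg_cst.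
have sub0 (F : R[i] -> R) (u : nat -> R[i]) (l : R[i]) : (forall x, `|F x| <= Normc.normc x) ->
    (forall x y, F (x - y) = F x - F y) ->
    Normc.normc (l - u N) @[N --> \oo] --> (0 : R) -> F (u N) @[N --> \oo] --> F l.
  move=> F1 FB ul; apply/cvgrPdist_le => e e0.
  have [M _ HM] := cvgr_le _ ul _ e0; exists M => // N /= MN.
  by rewrite -FB; apply: le_trans (F1 _) _; exact: HM.
have rlim := sub0 Re _ _ (@Re_le_normc R) (@ReB R) jlim.
have ilim := sub0 Im _ _ (@Im_le_normc R) (@ImB R) jlim.
pose u N := cexp (- logsum N (a * z)) * (1 - a * z).
have az : Normc.normc (a * z) <= r.
  by rewrite Normc.normcM ler_piMr ?normc_ge0// ltW.
have ulim : Normc.normc (1 - u N) @[N --> \oo] --> (0 : R).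
  apply: (@squeeze_cvgr _ _ _ _ (fun=> 0) d) => //; last exact: cvg_cst.
  by apply: nearW => N; rewrite normc_ge0/= normc_sub_swap; exact: cexp_logsum.
have urlim := sub0 Re _ _ (@Re_le_normc R) (@ReB R) ulim.
have uilim := sub0 Im _ _ (@Im_le_normc R) (@ImB R) ulim.
have cexpNE (x : R[i]) : cexp (- x) = (expR (- Re x) * cos (Im x)) +i* (- (expR (- Re x) * sin (Im x))).
  by rewrite /cexp; case: x => b c /=; rewrite cosN sinN; apply: complexP => /=; ring.
have elim : expR (- Re (logsum N (a * z))) @[N --> \oo] --> expR (- Re j).
  by apply: continuous_cvg; [exact: continuous_expR|exact: cvgN].
have clim : cos (Im (logsum N (a * z))) @[N --> \oo] --> cos (Im j).
  by apply: continuous_cvg; [exact: continuous_cos|].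
have slim : sin (Im (logsum N (a * z))) @[N --> \oo] --> sin (Im j).
  by apply: continuous_cvg; [exact: continuous_sin|].
have vr : Re (u N) @[N --> \oo] --> Re (cexp (- j) * (1 - a * z)).
  rewrite (_ : (fun N => _) = fun N =>
    (expR (- Re (logsum N (a * z))) * cos (Im (logsum N (a * z)))) * Re (1 - a * z) -
    (- (expR (- Re (logsum N (a * z))) * sin (Im (logsum N (a * z))))) * Im (1 - a * z)); last first.
    by apply/funext => N; rewrite /u ReM cexpNE.
  rewrite ReM cexpNE /=.
  by apply: cvgB; apply: cvgM; [exact: cvgM|exact: cvg_cst|apply: cvgN; exact: cvgM|exact: cvg_cst].
have vi : Im (u N) @[N --> \oo] --> Im (cexp (- j) * (1 - a * z)).
  rewrite (_ : (fun N => _) = fun N =>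
    (expR (- Re (logsum N (a * z))) * cos (Im (logsum N (a * z)))) * Im (1 - a * z) +
    (- (expR (- Re (logsum N (a * z))) * sin (Im (logsum N (a * z))))) * Re (1 - a * z)); last first.
    by apply/funext => N; rewrite /u ImM cexpNE.
  rewrite ImM cexpNE /=.
  by apply: cvgD; apply: cvgM; [exact: cvgM|exact: cvg_cst|apply: cvgN; exact: cvgM|exact: cvg_cst].
have one : cexp (- j) * (1 - a * z) = 1.
  by apply: complexP; [exact: (cvg_unique _ vr urlim)|exact: (cvg_unique _ vi uilim)].
transitivity (cexp j * (cexp (- j) * (1 - a * z))); first by rewrite one mulr1.
by rewrite mulrA cexpNK mul1r.
Qed.

Lemma boundary_poly (G : R[i] -> R[i]) (a : R[i]) n t :
  (forall z, disk z -> G z = (1 - a * z) ^+ n) -> boundary G t = (1 - a * expi t) ^+ n.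
Proof.
move=> GE; rewrite /boundary.
suff H : (G (r%:C * expi t) : R[i]^o) @[r --> (1 : R)^'-] --> ((1 - a * expi t) ^+ n : R[i]^o).
  exact: (cvg_lim (@norm_hausdorff _ _) H).
have cid : ccont (fun r : R => r%:C) by apply: ccont_real => x; exact: cvg_id.
have cf : ccont (fun r : R => (1 - a * (r%:C * expi t)) ^+ n).
  apply: ccontX; have := ccontD (ccont_cst 1) (ccontM (ccont_cst (- a))
    (ccontM cid (ccont_cst (expi t)))).
  by congr ccont; apply/funext => r; rewrite mulNr.
have [cr ci] := cf.
apply/ccvgP; rewrite [_ ^+ n]complexE2.
have E : {near (1 : R)^'-, (fun r => (1 - a * (r%:C * expi t)) ^+ n) =1 (fun r => G (r%:C * expi t))}.
  near=> r; rewrite GE//; apply/diskP; rewrite Normc.normcM normc_expi mulr1 normc_real ger0_norm.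
    by near: r; exact: nbhs_left_lt.
  by near: r; apply: nbhs_left_ge; exact: ltr01.
have e1 : (1 - a * expi t) ^+ n = (1 - a * ((1 : R)%:C * expi t)) ^+ n by rewrite mul1r.
apply: ccvg_ReIm.
  apply: cvg_trans; first by apply: near_eq_cvg; apply: filterS E => r /= <-; reflexivity.
  by rewrite e1; apply: cvg_at_left_filter; exact: cr.
apply: cvg_trans; first by apply: near_eq_cvg; apply: filterS E => r /= <-; reflexivity.
by rewrite e1; apply: cvg_at_left_filter; exact: ci.
Unshelve. all: by end_near. Qed.

(** Taking the [n]-th power multiplies the logarithm in [schwarz_ln] by [n]. *)
Lemma outer_poly (G : R[i] -> R[i]) (a : R[i]) n : disk a ->
  (forall z, disk z -> G z = (1 - a * z) ^+ n) -> H2 G -> outer G.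
Proof.
move=> da GE HG; split=> //.
  have d0 : disk (0 : R[i]) by apply/diskP; rewrite Normc.normc0.
  by exists 0 => //; rewrite GE// mulr0 subr0 expr1n oner_neq0.
exists 1; first by rewrite normcE Normc.normc1.
move=> z dz; rewrite mul1r GE// -schwarz_ln// -cexpMn; congr cexp.
have a1 : Normc.normc a < 1 by apply/diskP.
have pos t : 0 < Normc.normc (1 - a * expi t).
  by have := normc_subl 1 (a * expi t); rewrite Normc.normcM normc_expi Normc.normc1; lra.
rewrite mulrCA; congr (_ * _).
have cl : ccont (fun t => (ln (Normc.normc (1 - a * expi t)))%:C).
  apply: ccont_ln_normc => [|t].
    have := ccontD (ccont_cst 1) (ccontM (ccont_cst (- a)) (@ccont_expi R)).
    by congr ccont; apply/funext => t; rewrite mulNr.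
  by apply/eqP => H; have := pos t; rewrite H Normc.normc0 ltxx.
rewrite -circintZ; last by apply: ccontM => //; exact: ccont_schwarz.
congr (cintegral _); apply/funext => t.
have nC (x : R) : (x *+ n)%:C = n%:R * x%:C :> R[i].
  by rewrite (rmorphMn (real_complex R)) mulr_natl.
rewrite (boundary_poly t GE) normcX lnXn// -/(schwarz z t) nC.
by ring.
Qed.

End OuterPoly.

(** * Multiplicativity from zero-freeness *)

Section ZeroFree.
Variable R : realType.
Local Open Scope complex_scope.
Notation normc := (@Normc.normc R).

Lemma rem2_le (x h : R[i]) (X Y : R) k : normc x <= X -> normc h <= Y ->
  normc (rem2 x h k) <= (X + Y) ^+ k - X ^+ k - Y * (k%:R * X ^+ k.-1).
Proof.
move=> xX hY; have X0 := le_trans (normc_ge0 x) xX; have Y0 := le_trans (normc_ge0 h) hY.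
elim: k => [|k ih]; first by rewrite /rem2 !expr0 mul0r subrr mulr0 subr0 Normc.normc0 mul0r mulr0 subr0 subrr.
rewrite rem2S.
have -> : (X + Y) ^+ k.+1 - X ^+ k.+1 - Y * (k.+1%:R * X ^+ k.+1.-1) =
  (X + Y) * ((X + Y) ^+ k - X ^+ k - Y * (k%:R * X ^+ k.-1)) + Y ^+ 2 * (k%:R * X ^+ k.-1).
  rewrite -natr1 /= !exprS; case: k {ih} => [|k] /=; first by rewrite !expr0; ring.
  by rewrite !exprS; ring.
apply: le_trans (le_normcD _ _) _; rewrite !Normc.normcM; apply: lerD.
  by apply: ler_pM; rewrite ?normc_ge0//; apply: le_trans (le_normcD _ _) _; exact: lerD.
rewrite !normcX normc_nat; apply: ler_pM; rewrite ?exprn_ge0 ?mulr_ge0 ?exprn_ge0 ?normc_ge0//.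
  by rewrite expr2; apply: ler_pM => //; exact: normc_ge0.
by apply: ler_wpM2l => //; apply: lerXn2r; rewrite ?nnegrE ?normc_ge0.
Qed.

Lemma ffactS_pascal n k : (n.+1 ^_ k.+1 = n ^_ k.+1 + k.+1 * n ^_ k)%N.
Proof.
rewrite ffactSS ffactnSr mulnC.
have [kn|nk] := leqP k n.
  by rewrite [(k.+1 * _)%N]mulnC -mulnDr; congr (_ * _)%N; rewrite addnS subnK.
by rewrite ffact_small// !(mul0n, muln0).
Qed.

Lemma expn_ffact n k : (n ^ k.+1 <= n ^_ k.+1 + k.+1 ^ 2 * n ^ k)%N.
Proof.
elim: k => [|k ih]; first by rewrite expn1 ffactn1 leq_addr.
have h1 : (n * n ^_ k.+1 <= n ^_ k.+2 + k.+1 * n ^ k.+1)%N.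
  apply: (@leq_trans (n ^_ k.+2 + k.+1 * n ^_ k.+1)); last first.
    rewrite leq_add2l leq_mul2l; apply/orP; right.
    elim: (k.+1) => [|j jh]; first by rewrite ffactn0 expn0.
    by rewrite ffactnSr expnSr; apply: leq_mul => //; exact: leq_subr.
  rewrite (ffactnSr n k.+1) [(k.+1 * _)%N]mulnC -mulnDr mulnC leq_mul2l; apply/orP; right.
  by rewrite addnC -leq_subLR.
rewrite expnS; apply: leq_trans (leq_mul (leqnn n) ih) _.
rewrite mulnDr; apply: leq_trans (leq_add h1 (leqnn _)) _.
rewrite -addnA leq_add2l mulnCA -expnS -mulnDl leq_mul2r; apply/orP; right.
rewrite -[k.+2]addn1 sqrnD muln1 -addnA [leqLHS]addnC leq_add2l.
by rewrite exp1n add1n mul2n -addnn ltnW// ltnS leq_addr.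
Qed.

(** Elementary symmetric functions of numbers of modulus at most one are close
    to the powers of their sum: of the [n ^ k] tuples of [k] out of [n] numbers,
    only the [n ^ k - n ^_ k] with a repetition contribute to the difference. *)
Lemma elementary_sym_close (s : seq R[i]) k : all (fun m => normc m <= 1) s ->
  normc (\sum_(m <- s) m) <= (size s)%:R /\
  normc ((\sum_(m <- s) m) ^+ k - k`!%:R * (\prod_(m <- s) (1 + m *: 'X))`_k) <=
    (size s)%:R ^+ k - ((size s) ^_ k)%:R.
Proof.
elim: s k => [|m s ih] k.
  rewrite !big_nil Normc.normc0 [size _]/= => _; split; first by [].
  case: k => [|k]; first by rewrite !expr0 coef1 eqxx fact0 mulr1 subrr Normc.normc0 ffactn0 subrr.
  by rewrite !expr0n coef1 -[(k.+1 == 0)%N]/false mulr0n mulr0 subrr Normc.normc0 ffact0n subrr.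
rewrite [all _ _]/= => /andP[m1 s1]; rewrite [size _]/=; have [sn _] := ih 0%N s1.
rewrite !big_cons; split.
  by apply: le_trans (le_normcD _ _) _; rewrite -natr1 addrC; exact: lerD.
set S := \sum_(j <- s) j in sn ih *; set P := \prod_(j <- s) _ in ih *.
case: k => [|k].
  have P0 : P`_0 = 1.
    rewrite -horner_coef0 /P horner_prod big1// => j _.
    by rewrite !hornerE.
  rewrite !expr0 fact0 mulrDl mul1r -scalerAl coefD coefZ coefXM/= mulr0 addr0 P0.
  by rewrite mulr1 subrr Normc.normc0 ffactn0 subrr.
have [_ hk] := ih k s1; have [_ hk1] := ih k.+1 s1.
rewrite mulrDl mul1r -scalerAl coefD coefZ coefXM /=.
have -> : (m + S) ^+ k.+1 - k.+1`!%:R * (P`_k.+1 + m * P`_k) =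
  (S ^+ k.+1 - k.+1`!%:R * P`_k.+1) + (k.+1%:R * m * (S ^+ k - k`!%:R * P`_k) + rem2 S m k.+1).
  by rewrite /rem2 (addrC m S) factS natrM /=; ring.
apply: le_trans (le_normcD _ _) _.
apply: (@le_trans _ _ (((size s)%:R ^+ k.+1 - ((size s) ^_ k.+1)%:R) +
   (k.+1%:R * ((size s)%:R ^+ k - ((size s) ^_ k)%:R) +
    (((size s)%:R + 1) ^+ k.+1 - (size s)%:R ^+ k.+1 - 1 * (k.+1%:R * (size s)%:R ^+ k))))).
  apply: lerD => //; apply: le_trans (le_normcD _ _) _; apply: lerD; last exact: rem2_le.
  rewrite !Normc.normcM normc_nat; apply: ler_pM => //; rewrite ?mulr_ge0 ?normc_ge0//.
  by rewrite -[leRHS]mulr1; apply: ler_wpM2l.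
rewrite le_eqVlt; apply/orP; left; apply/eqP.
by rewrite ffactS_pascal natrD natrM natr1; ring.
Qed.

Lemma prod_XsubC_scale (rs : seq R[i]) : (forall r, r \in rs -> r != 0) ->
  \prod_(r <- rs) ('X - r%:P) = (\prod_(r <- rs) - r) *: \prod_(r <- rs) (1 + (- r^-1) *: 'X).
Proof.
elim: rs => [|r rs ih] rn0; first by rewrite !big_nil scale1r.
rewrite !big_cons ih; last by move=> x xrs; apply: rn0; rewrite in_cons xrs orbT.
have -> : 'X - r%:P = (- r) *: (1 + (- r^-1) *: 'X).
  rewrite scalerDr scalerA mulrNN mulfV ?rn0 ?mem_head// scale1r addrC; congr (_ + _).
  by rewrite -mul_polyC mulr1 polyCN.
by rewrite -scalerAl -scalerAr scalerA.
Qed.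

Lemma normc_nat_exp n k : normc (n%:R ^+ k) = n%:R ^+ k.
Proof. by rewrite normcX normc_nat. Qed.

(** For each [n] the sums are the values of a polynomial in [a] of degree at most
    [n] without zeros in the disk, hence a product of factors [1 + m a] with
    [|m| <= 1]. Its coefficients are elementary symmetric functions of the [m], so
    by [elementary_sym_close] the numbers [n ^_ k * c k] and [(n * c 1) ^ k] differ by
    at most [n ^ k - n ^_ k = O(n ^ (k - 1))]. Divide by [n ^ k] and let [n] grow. *)
Lemma zero_free_geometric (c : nat -> R[i]) : c 0%N = 1 ->
  (forall n a, disk a -> \sum_(k < n.+1) 'C(n, k)%:R * (- a) ^+ k * c k != 0) ->
  forall k, c k = c 1%N ^+ k.
Proof.
move=> c0 nz.
have key n k : normc ((n%:R * c 1%N) ^+ k - (n ^_ k)%:R * c k) <= n%:R ^+ k - (n ^_ k)%:R.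
  pose P : {poly R[i]} := \poly_(k < n.+1) ('C(n, k)%:R * (- 1) ^+ k * c k).
  have Pa a : P.[a] = \sum_(k < n.+1) 'C(n, k)%:R * (- a) ^+ k * c k.
    rewrite horner_poly; apply: eq_bigr => j _.
    by rewrite (exprNn a); ring.
  have P0 : P.[0] = 1.
    by rewrite horner_coef0 coef_poly /= bin0 expr0 c0 !mul1r.
  have [rs Prs] := closed_field_poly_normal P.
  have Pn0 : P != 0 by apply/eqP => H; have := P0; rewrite H horner0 => /eqP; rewrite eq_sym oner_eq0.
  have l0 : lead_coef P != 0 by rewrite lead_coef_eq0.
  have szrs : (size rs <= n)%N.
    have : (size P <= n.+1)%N by exact: size_poly.
    by rewrite Prs size_scale// size_prod_XsubC.
  have root1 r : r \in rs -> 1 <= normc r.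
    move=> rrs; rewrite leNgt; apply/negP => r1.
    have dr : disk r by apply/diskP.
    have := nz n r dr; rewrite -Pa Prs hornerZ => /eqP; apply.
    have /rootP -> : root (\prod_(z <- rs) ('X - z%:P)) r by rewrite root_prod_XsubC.
    by rewrite mulr0.
  have rn0 r : r \in rs -> r != 0.
    by move=> /root1 r1; apply/eqP => H; move: r1; rewrite H Normc.normc0 ler10.
  (* Zeros make up for the degree of [P] falling short of [n]. *)
  pose s := [seq - r^-1 | r <- rs] ++ nseq (n - size rs) 0.
  have szs : size s = n by rewrite size_cat size_map size_nseq subnKC.
  have s1 : all (fun m => normc m <= 1) s.
    rewrite all_cat all_nseq Normc.normc0 ler01 orbT andbT; apply/allP => m /mapP[r rrs ->].
    by rewrite normcN Normc.normcV invf_le1 ?root1// (lt_le_trans ltr01 (root1 _ rrs)).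
  have Ps : P = \prod_(m <- s) (1 + m *: 'X).
    rewrite /s big_cat /= big_map [X in _ * X]big1_seq ?mulr1; last first.
      by move=> m /andP[_]; rewrite mem_nseq => /andP[_ /eqP ->]; rewrite scale0r addr0.
    have E : P = (lead_coef P * \prod_(r <- rs) - r) *: \prod_(r <- rs) (1 + (- r^-1) *: 'X).
      by rewrite {1}Prs prod_XsubC_scale// scalerA.
    suff one : lead_coef P * \prod_(r <- rs) - r = 1 by rewrite {1}E one scale1r.
    have Q0 : (\prod_(r <- rs) (1 + (- r^-1) *: 'X)).[0] = 1.
      by rewrite horner_prod big1// => r _; rewrite !hornerE.
    by have := P0; rewrite {1}E hornerZ Q0 mulr1.
  have [_ H] := elementary_sym_close k s1; have [_ H1] := elementary_sym_close 1 s1.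
  rewrite -Ps szs in H; rewrite -Ps szs ffactn1 expr1 subrr in H1.
  have PE j : j`!%:R * P`_j = (- 1) ^+ j * ((n ^_ j)%:R * c j).
    rewrite coef_poly ltnS; case: leqP => [jn|nj]; last by rewrite ffact_small// mul0r !mulr0.
    by rewrite -bin_ffact natrM; ring.
  have SE : \sum_(m <- s) m = - (n%:R * c 1%N).
    apply/eqP; rewrite -subr_eq0; apply/eqP/Normc.eq0_normc/eqP.
    rewrite eq_le normc_ge0 andbT; apply: le_trans H1.
    by rewrite PE ffactn1 expr1 mulN1r.
  rewrite SE PE (exprNn (n%:R * c 1%N)) -mulrBr Normc.normcM normcX normcN Normc.normc1 expr1n mul1r in H.
  exact: H.
case=> [|k]; first by rewrite c0 expr0.
set d := normc (c 1%N ^+ k.+1 - c k.+1).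
have dn n : (0 < n)%N -> n%:R * d <= (k.+1 ^ 2)%:R * (1 + normc (c k.+1)).
  move=> n0; have n0' : 0 < n%:R :> R by rewrite ltr0n.
  have D : n%:R ^+ k.+1 - (n ^_ k.+1)%:R <= (k.+1 ^ 2)%:R * n%:R ^+ k :> R.
    by rewrite lerBlDl -!natrX -natrM -natrD ler_nat expn_ffact.
  have D0 : 0 <= n%:R ^+ k.+1 - (n ^_ k.+1)%:R :> R.
    by apply: le_trans (key n k.+1); exact: normc_ge0.
  rewrite -(ler_pM2l (exprn_gt0 k n0')) mulrA -exprSr.
  have -> : n%:R ^+ k.+1 * d = normc (((n%:R * c 1%N) ^+ k.+1 - (n ^_ k.+1)%:R * c k.+1)
      - (n%:R ^+ k.+1 - (n ^_ k.+1)%:R) * c k.+1).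
    rewrite /d -[n%:R ^+ k.+1]normc_nat_exp -Normc.normcM; congr normc.
    by rewrite exprMn; ring.
  apply: le_trans (le_normcD _ _) _; rewrite normcN Normc.normcM.
  have -> : normc (n%:R ^+ k.+1 - (n ^_ k.+1)%:R) = n%:R ^+ k.+1 - (n ^_ k.+1)%:R.
    rewrite -(rmorph_nat (real_complex R) n) -(rmorph_nat (real_complex R) (n ^_ k.+1)) -rmorphXn -rmorphB.
    by rewrite normc_real ger0_norm.
  have := key n k.+1; have := normc_ge0 (c k.+1); nra.
have d0 : d = 0.
  apply/eqP; rewrite eq_le normc_ge0 andbT leNgt; apply/negP => dpos.
  set M := (k.+1 ^ 2)%:R * _ in dn.
  have Md0 : 0 <= M / d.
    by apply: divr_ge0; rewrite ?normc_ge0// mulr_ge0// addr_ge0// normc_ge0.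
  have [n Mn] : exists n, M / d < n%:R by exists (Num.bound (M / d)); exact: archi_boundP.
  have n0 : (0 < n)%N by rewrite -(ltr0n R); exact: le_lt_trans Mn.
  by have := dn n n0; rewrite leNgt => /negP; apply; rewrite -ltr_pdivrMr.
by apply/eqP; rewrite eq_sym -subr_eq0; apply/eqP; exact: Normc.eq0_normc.
Qed.

End ZeroFree.

(** * Translations *)

Section Translation.
Variable R : realType.
Notation mu := (@lebesgue_measure R).
Notation HL := (@Rplus R).
Notation Re := (@complex.Re R).
Notation Im := (@complex.Im R).
Local Open Scope complex_scope.
Notation borelR := (g_sigma_algebraType (R.-ocitv.-measurable)).

Let shift_by (tau : R) : borelR -> borelR := fun t => t + tau.

Lemma measurable_shift_by tau : measurable_fun setT (shift_by tau).
Proof.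
apply: continuous_measurable_fun => t.
by apply: cvgD; [exact: cvg_id|exact: cvg_cst].
Qed.

Lemma pushforward_shift_by tau (A : set borelR) : measurable A ->
  pushforward mu (shift_by tau) A = mu A.
Proof.
move=> mA; apply/esym.
apply: (@lebesgue_measure_unique R
  (measure_function_pushforward__canonical__measure_function_Measure mu (measurable_shift_by tau))) => // X [[a b]] /= _ <-.
rewrite /pushforward (_ : shift_by tau @^-1` _ = `]a - tau, b - tau]%classic); last first.
  apply/seteqP; split=> t /=; rewrite !in_itv/= /shift_by => /andP[h1 h2]; apply/andP; split; lra.
rewrite !lebesgue_measure_itv/= !lte_fin ltrD2r; case: ifP => // _.
by rewrite -!EFinB; congr (_%:E); ring.
Qed.

Definition rtranslate (tau : R) (h : R -> R) (t : R) : R :=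
  if tau <= t then h (t - tau) else 0.

Lemma Rplus_translate tau : 0 <= tau -> HL `&` `[tau, +oo[ = `[tau, +oo[%classic.
Proof.
move=> t0; apply/setIidr => t; rewrite RplusE /= in_itv/= andbT; exact: le_trans.
Qed.

Lemma rtranslateE tau h : rtranslate tau h = (fun t => h (t - tau)) \_ `[tau, +oo[.
Proof.
apply/funext => t; rewrite /rtranslate patchE mem_setE in_itv/= andbT.
by case: (tau <= t).
Qed.

Lemma measurable_rtranslate tau h : 0 <= tau -> measurable_fun HL h ->
  measurable_fun HL (rtranslate tau h).
Proof.
move=> t0 mh; rewrite rtranslateE.
have mI : measurable (`[tau, +oo[%classic : set borelR) by exact: measurable_itv.
apply/(measurable_restrict _ mI (@measurable_Rplus R)); rewrite Rplus_translate//.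
apply: (@measurable_comp _ _ _ _ _ _ HL h `[tau, +oo[%classic (shift_by (- tau))) => //.
- exact: measurable_Rplus.
- by move=> _ [t /= + <-]; rewrite in_itv/= andbT => tt; apply/RplusE; rewrite /shift_by subr_ge0.
- exact: (measurable_funTS (measurable_shift_by (- tau))).
Qed.

Lemma Rintegral_rtranslate tau h : 0 <= tau -> mu.-integrable HL (EFin \o h) ->
  \int[mu]_(t in HL) rtranslate tau h t = \int[mu]_(t in HL) h t.
Proof.
move=> t0 ih; rewrite rtranslateE -Rintegral_mkcondr Rplus_translate//.
rewrite /Rintegral; congr fine.
have mI : measurable (`[tau, +oo[%classic : set borelR) by exact: measurable_itv.
have E : shift_by tau @^-1` `[tau, +oo[ = HL.
  by apply/seteqP; split=> t; rewrite RplusE/= in_itv/= andbT /shift_by; lra.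
have mh : measurable_fun HL h by apply/measurable_EFinP; exact: measurable_int ih.
pose f y := ((h \_ HL) (y - tau))%:E.
have fE t : HL t -> (f \o shift_by tau) t = (h t)%:E.
  by move=> Ht; rewrite /f /shift_by /= addrK patchE mem_set.
have mf : measurable_fun setT f.
  apply/measurable_EFinP; apply: (measurableT_comp (f := h \_ HL) (g := shift_by (- tau))).
    exact/(measurable_restrictT h (@measurable_Rplus R)).
  exact: measurable_shift_by.
have intf : mu.-integrable (shift_by tau @^-1` `[tau, +oo[) (f \o shift_by tau).
  rewrite E; apply: eq_integrable ih; first exact: measurable_Rplus.
  by move=> t; rewrite inE => Ht; rewrite fE.
transitivity (\int[mu]_(t in `[tau, +oo[) f t)%E.
  apply: eq_integral => t; rewrite inE /= in_itv/= andbT => tt.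
  by rewrite /f patchE mem_set// RplusE subr_ge0.
transitivity (\int[mu]_(x in shift_by tau @^-1` `[tau, +oo[) (f \o shift_by tau) x)%E.
  rewrite -(integral_pushforward (measurable_shift_by tau) mf intf mI).
  apply: (@eq_measure_integral _ _ R _ (measure_function_pushforward__canonical__measure_function_Measure mu (measurable_shift_by tau)) mu f) => X mX _; exact: (esym (pushforward_shift_by tau mX)).
by rewrite E; apply: eq_integral => t; rewrite inE => Ht; rewrite fE.
Qed.

Lemma kern_add (z : R[i]) s t : kern z (s + t) = kern z s * kern z t.
Proof.
by rewrite /kern -cexpD; congr cexp; rewrite rmorphD; ring.
Qed.

(** The kernel is multiplicative in time, so a shift by [tau] factors out as
    [kern z tau], which is an exponential and never zero. *)
Lemma calH_translate tau (f g : R -> R[i]) (z : R[i]) : 0 <= tau -> disk z ->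
  L2 f -> L2 g -> eqL2 f (translate tau g) -> calH f z = kern z tau * calH g z.
Proof.
move=> t0 dz lf lg fg; rewrite !calHE mulrCA; congr (_ * _).
have lk := L2_kern dz.
have [rk ik] := (L2P _).1 lk; have [rf If] := (L2P _).1 lf; have [rg Ig] := (L2P _).1 lg.
pose h t := kern z tau * (g t * kern z t).
have i1 := integrable_mul_sqint rg rk; have i2 := integrable_mul_sqint Ig ik.
have i3 := integrable_mul_sqint rg ik; have i4 := integrable_mul_sqint Ig rk.
have mH := @measurable_Rplus R.
have iRe : mu.-integrable HL (EFin \o (fun t => Re (g t * kern z t))).
  apply: eq_integrable (integrableB mH i1 i2) => // t _; congr EFin; by rewrite /comp ReM.
have iIm : mu.-integrable HL (EFin \o (fun t => Im (g t * kern z t))).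
  apply: eq_integrable (integrableD mH i3 i4) => // t _; congr EFin; by rewrite /comp ImM.
have iReh : mu.-integrable HL (EFin \o (fun t => Re (h t))).
  apply: eq_integrable (integrableB mH (integrableZl mH (Re (kern z tau)) iRe)
    (integrableZl mH (Im (kern z tau)) iIm)) => // t _.
  by rewrite /comp -!EFinM -EFinB; congr EFin; exact/esym/ReM.
have iImh : mu.-integrable HL (EFin \o (fun t => Im (h t))).
  apply: eq_integrable (integrableD mH (integrableZl mH (Re (kern z tau)) iIm)
    (integrableZl mH (Im (kern z tau)) iRe)) => // t _.
  by rewrite /comp -!EFinM -EFinD; congr EFin; exact/esym/ImM.
have fh : ae_eq mu HL (fun t => f t * kern z t) (fun t => if tau <= t then h (t - tau) else 0).
  move: fg; apply: filterS => t /[swap] Ht /(_ Ht) ->; rewrite /translate.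
  case: ifP => _; last by rewrite mul0r.
  have <- : kern z (t - tau) * kern z tau = kern z t by rewrite -kern_add subrK.
  by rewrite /h mulrA mulrC.
have H (F : R[i] -> R) : F 0 = 0 -> mu.-integrable HL (EFin \o (F \o h)) ->
    measurable_fun HL (fun t => F (f t * kern z t)) ->
    \int[mu]_(t in HL) F (f t * kern z t) = \int[mu]_(t in HL) F (h t).
  move=> F0 iF mF; rewrite -[RHS](Rintegral_rtranslate t0 iF).
  rewrite /Rintegral; congr fine; apply: ae_eq_integral => //.
  - exact/measurable_EFinP.
  - apply/measurable_EFinP; apply: measurable_rtranslate => //.
    by apply/measurable_EFinP; exact: measurable_int iF.
  - move: fh; apply: filterS => t /[swap] Ht /(_ Ht) ->; rewrite /rtranslate.
    by case: ifP => // _; rewrite F0.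
have -> : cpair f (kern z) = cintegral HL h.
  rewrite /cpair /cintegral; congr (_ +i* _); apply: H => //.
  - under eq_fun do rewrite ReM; apply: measurable_funB; apply: measurable_funM.
    + exact: measurable_sqint rf.
    + exact: measurable_sqint rk.
    + exact: measurable_sqint If.
    + exact: measurable_sqint ik.
  - under eq_fun do rewrite ImM; apply: measurable_funD; apply: measurable_funM.
    + exact: measurable_sqint rf.
    + exact: measurable_sqint ik.
    + exact: measurable_sqint If.
    + exact: measurable_sqint rk.
rewrite /cpair /cintegral; apply: complexP.
  rewrite ReM /= -!RintegralZl// -RintegralB//.
  - by apply: eq_Rintegral => t _; rewrite /h ReM.
  - exact: (integrableZl mH _ iRe).
  - exact: (integrableZl mH _ iIm).
rewrite ImM /= -!RintegralZl// -RintegralD//.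
- by apply: eq_Rintegral => t _; rewrite /h ImM.
- exact: (integrableZl mH _ iIm).
- exact: (integrableZl mH _ iRe).
Qed.

Lemma kern_neq0 (z : R[i]) tau : kern z tau != 0.
Proof.
apply/eqP => H; have := normc_cexp (tau%:C * (z - 1) / (z + 1)).
rewrite -/(kern z tau) H Normc.normc0; apply/eqP; rewrite eq_sym gt_eqF//; exact: expR_gt0.
Qed.

End Translation.

(** * Functionals that vanish on no outer polynomial *)

Section Functional.
Variable R : realType.
Notation Re := (@complex.Re R).
Notation Im := (@complex.Im R).
Local Open Scope complex_scope.
Implicit Types f g : R -> R[i].

Let rhoC n (t : R) : R[i] := (rho n t)%:C.

Lemma L2_rho_sum N (a : nat -> R[i]) : L2 (fun t => \sum_(k < N) a k * rhoC k t).
Proof. by apply: (@L2_sum _ _ _ (fun (k : 'I_N) t => a k * rhoC k t)) => k; apply: L2Z; exact: L2_rho. Qed.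

Lemma calH_rho_sum N (a : nat -> R[i]) z : disk z ->
  calH (fun t => \sum_(k < N) a k * rhoC k t) z = \sum_(k < N) a k * z ^+ k.
Proof.
move=> dz; rewrite (calH_sum _ (fun k : 'I_N => a k) (F := fun k => rhoC k))//; last first.
  by move=> k; exact: L2_rho.
by apply: eq_bigr => k _; rewrite calH_rho.
Qed.

Lemma n2_rho_sum N (a : nat -> R[i]) :
  n2 (fun t => \sum_(k < N) a k * rhoC k t) = \sum_(k < N) Normc.normc (a k) ^+ 2.
Proof.
rewrite /n2.
have -> : Re \o (fun t => \sum_(k < N) a k * rhoC k t) = fun t => \sum_(k < N) Re (a k) * rho k t.
  apply/funext=> t /=; rewrite raddf_sum; apply: eq_bigr => k _.
  by apply: etrans (ReM (a k) (rhoC k t)) _; rewrite /= mulr0 subr0.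
have -> : Im \o (fun t => \sum_(k < N) a k * rhoC k t) = fun t => \sum_(k < N) Im (a k) * rho k t.
  apply/funext=> t /=; rewrite raddf_sum; apply: eq_bigr => k _.
  by apply: etrans (ImM (a k) (rhoC k t)) _; rewrite /= mulr0 add0r.
rewrite (inner_rho_sum_self N (fun k => Re (a k))) (inner_rho_sum_self N (fun k => Im (a k))) -big_split.
by apply: eq_bigr => k _; rewrite normc_sqr.
Qed.

Variables (L : (R -> R[i]) -> R[i]) (C : R).
Hypothesis L_lin : forall a f g, L2 f -> L2 g -> L (fun t => a * f t + g t) = a * L f + L g.
Hypothesis L_bounded : forall f, L2 f -> Normc.normc (L f) ^+ 2 <= C * n2 f.

Lemma functional0 : L (fun=> 0) = 0.
Proof.
have := L_lin (- 1) (@L2_0 R) (@L2_0 R).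
rewrite (_ : (fun t : R => - 1 * 0 + 0) = (fun=> 0)); last by apply/funext=> t; rewrite mulr0 addr0.
by rewrite mulN1r addNr.
Qed.

Lemma functional_rho_sum N (a : nat -> R[i]) :
  L (fun t => \sum_(k < N) a k * rhoC k t) = \sum_(k < N) a k * L (rhoC k).
Proof.
elim: N => [|N ih].
  by rewrite big_ord0 -[RHS]functional0; congr L; apply/funext=> t; rewrite big_ord0.
rewrite big_ord_recr /= -ih addrC -L_lin; [|exact: L2_rho|exact: L2_rho_sum].
by congr L; apply/funext=> t; rewrite big_ord_recr /= addrC.
Qed.

(** The Laguerre sums of [f] are killed by [L] and converge to [f]. *)
Lemma functional_bound_eq0 f : L2 f -> (forall n, L (rhoC n) = 0) -> L f = 0.
Proof.
move=> lf L0.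
have H N : Normc.normc (L f) ^+ 2 <= C * n2 (fun t => f t - lsum N f t).
  have -> : L f = L (fun t => f t - lsum N f t); last by apply: L_bounded; apply: L2B => //; exact: L2_lsum.
  transitivity (- 1 * L (lsum N f) + L f).
    rewrite /lsum (functional_rho_sum N (fun n => lcoef n f)) big1 ?mulr0 ?add0r// => n _.
    by rewrite L0 mulr0.
  rewrite -L_lin//; last exact: L2_lsum.
  by congr L; apply/funext=> t; rewrite mulN1r addrC.
have : Normc.normc (L f) ^+ 2 <= 0.
  rewrite -(mulr0 C); apply: cvgr_to_ge (cvgM (cvg_cst C) (lsum_cvg lf)) _; exact: nearW.
rewrite le_eqVlt ltNge sqr_ge0 orbF sqrf_eq0 => /eqP; exact: Normc.eq0_normc.
Qed.

End Functional.

Section ZeroFreeFunctional.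
Variable R : realType.
Local Open Scope complex_scope.
Implicit Types f g : R -> R[i].
Let rhoC n (t : R) : R[i] := (rho n t)%:C.
Variables (L : (R -> R[i]) -> R[i]) (C : R).
Hypothesis L_lin : forall a f g, L2 f -> L2 g -> L (fun t => a * f t + g t) = a * L f + L g.
Hypothesis L_bounded : forall f, L2 f -> Normc.normc (L f) ^+ 2 <= C * n2 f.
Hypothesis L_zero_free : forall n a f, disk a -> L2 f ->
  (forall z, disk z -> calH f z = (1 - a * z) ^+ n) -> L f != 0.

Let psi := L (rhoC 0).
Let phi := L (rhoC 1) / L (rhoC 0).

(** The case [n = 0] of the hypothesis, since [rho 0] has transform [1]. *)
Lemma functional_rho0_neq0 : psi != 0.
Proof.
have d0 : disk (0 : R[i]) by apply/diskP; rewrite Normc.normc0.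
by apply: (@L_zero_free 0 0) => //; [exact: L2_rho|move=> z dz; rewrite calH_rho].
Qed.

(** By the binomial formula [(1 - a z) ^ n] is the transform of a combination of the
    [rho k], to which [zero_free_geometric] applies. *)
Lemma functional_rho k : L (rhoC k) = psi * phi ^+ k.
Proof.
have p0 := functional_rho0_neq0.
have := @zero_free_geometric R (fun k => L (rhoC k) / psi).
rewrite divff// => /(_ erefl) H.
rewrite -[LHS](divfK p0) mulrC; congr (_ * _); rewrite {}H// => n a da.
have := @L_zero_free n a (fun t => \sum_(k < n.+1) ('C(n, k)%:R * (- a) ^+ k) * rhoC k t) da.
move=> /(_ (L2_rho_sum _ (fun k => 'C(n, k)%:R * (- a) ^+ k))).
rewrite (functional_rho_sum L_lin _ (fun k => 'C(n, k)%:R * (- a) ^+ k)) => H.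
under eq_bigr do rewrite mulrA.
rewrite -mulr_suml mulf_neq0 ?invr_eq0//; apply: H => z dz.
rewrite (calH_rho_sum _ (fun k => 'C(n, k)%:R * (- a) ^+ k))//.
rewrite exprDn; apply: eq_bigr => i _.
by rewrite expr1n mul1r -mulNr exprMn -mulrA mulr_natl.
Qed.

(** Otherwise the combinations [sum_(k < N) conj(phi) ^ k * rho k], of square norm
    [S N >= N], would be mapped to [psi * S N], against the boundedness of [L]. *)
Lemma functional_point_disk : disk phi.
Proof.
apply/diskP; rewrite ltNge; apply/negP => phi1.
pose b := Num.conj phi.
have nb (k : nat) : 1 <= Normc.normc phi ^+ 2 ^+ k.
  by rewrite !exprn_ege1.
pose S N := \sum_(k < N) Normc.normc phi ^+ 2 ^+ k.
have SN N : N%:R <= S N.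
  rewrite /S -[X in X%:R <= _]card_ord -sum1_card natr_sum; exact: ler_sum.
have psi0 : 0 < Normc.normc psi ^+ 2.
  rewrite exprn_gt0// lt_neqAle normc_ge0 andbT eq_sym.
  by apply: contra_neq functional_rho0_neq0 => /Normc.eq0_normc.
have H N : (0 < N)%N -> Normc.normc psi ^+ 2 * S N <= C.
  move=> N0; have SN0 : 0 < S N by apply: lt_le_trans (SN N); rewrite ltr0n.
  rewrite -(ler_pM2r SN0).
  have := L_bounded (L2_rho_sum N (fun k => b ^+ k)).
  rewrite n2_rho_sum (functional_rho_sum L_lin _ (fun k => b ^+ k)).
  have -> : \sum_(k < N) b ^+ k * L (rhoC k) = psi * (S N)%:C.
    rewrite /S rmorph_sum mulr_sumr; apply: eq_bigr => k _.
    rewrite functional_rho mulrCA -exprMn; congr (_ * _).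
    rewrite rmorphXn; congr (_ ^+ _).
    by rewrite mulrC /b -normCK normcE rmorphXn.
  have -> : \sum_(k < N) Normc.normc (b ^+ k) ^+ 2 = S N.
    apply: eq_bigr => k _; rewrite normcX exprAC; congr (_ ^+ _ ^+ _).
    by apply: complexI; rewrite -!normcE norm_conjC.
  by rewrite Normc.normcM normc_real (gtr0_norm SN0) exprMn expr2 mulrA.
have C0 : 0 <= C / Normc.normc psi ^+ 2.
  apply: divr_ge0; last exact: ltW.
  by apply: le_trans (H 1%N isT); rewrite mulr_ge0 ?ltW// (lt_le_trans _ (SN 1%N)).
have := archi_boundP C0; set N := Num.bound _ => CN.
have N0 : (0 < N)%N by rewrite lt0n; apply/eqP => N0; move: CN; rewrite N0 ltNge C0.
have := H N N0; rewrite mulrC -ler_pdivlMr// => /(le_trans (SN N)).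
by rewrite leNgt CN.
Qed.

Lemma normc_parallelogram (x y : R[i]) :
  Normc.normc (x - y) ^+ 2 <= 2 * (Normc.normc x ^+ 2 + Normc.normc y ^+ 2).
Proof.
rewrite !normc_sqr ReB ImB; have := sqr_ge0 (complex.Re x + complex.Re y).
by have := sqr_ge0 (complex.Im x + complex.Im y); nra.
Qed.

(** Both sides are bounded in [f] and agree on every [rho n]. *)
Lemma functional_evaluation f : L2 f -> L f = psi * calH f phi.
Proof.
have dphi := functional_point_disk.
have [C' C'0 bC'] := calH_bounded dphi.
pose D g := L g - psi * calH g phi.
move=> lf; apply/eqP; rewrite -subr_eq0; apply/eqP.
apply: (@functional_bound_eq0 _ D (2 * (C + Normc.normc psi ^+ 2 * C'))) => //.
- by move=> a g h lg lh; rewrite /D L_lin// calH_lin//; ring.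
- move=> g lg; rewrite /D.
  have h1 := L_bounded lg; have h2 := bC' g lg.
  have p0 : 0 <= Normc.normc psi ^+ 2 by rewrite sqr_ge0.
  have := ler_wpM2l p0 h2; rewrite -exprMn -Normc.normcM => h3.
  have := normc_parallelogram (L g) (psi * calH g phi); lra.
- by move=> n; rewrite /D functional_rho calH_rho// subrr.
Qed.

End ZeroFreeFunctional.

(** * Operators preserving translates of minimum phase functions *)

Section Operator.
Variable R : realType.
Local Open Scope complex_scope.

Lemma rho0E (t : R) : (rho 0 t)%:C = rho0 t.
Proof.
rewrite /rho expr0 -(expr0 'X) thetaXn /rho0 /ebasis /dpow expr0 fact0 invr1 !mul1r.
by rewrite ?mulr1 ?mul1r ?divr1.
Qed.

Lemma rho1E (t : R) : (rho 1 t)%:C = rho1 t.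
Proof.
have -> : rho 1 t = 2 * ebasis 1 t + - 1 * ebasis 0 t.
  by rewrite -!thetaXn -!thetaZ -thetaD scaleN1r.
by rewrite /rho1 /ebasis /dpow; congr (_%:C); rewrite expr0 expr1 fact0 factS fact0 mul1r; field.
Qed.

Lemma cexp_neq0 (z : R[i]) : cexp z != 0.
Proof.
apply/eqP => z0; have := normc_cexp z; rewrite z0 Normc.normc0 => /eqP.
by rewrite eq_sym gt_eqF// expR_gt0.
Qed.

Lemma outer_neq0 (G : R[i] -> R[i]) z : outer G -> disk z -> G z != 0.
Proof.
move=> [_ _ [l l1 GE]] dz; rewrite GE// mulf_neq0 ?cexp_neq0//.
by rewrite -normr_eq0 l1 oner_neq0.
Qed.

(** The transform of a translate is an outer function, which is an exponential up to
    a unimodular factor, times the exponential of [calH_translate]. *)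
Lemma translated_min_phase_neq0 (f : R -> R[i]) z :
  translated_min_phase f -> disk z -> calH f z != 0.
Proof.
move=> [lf [g [tau [[lg og] tau0 fg]]]] dz.
by rewrite (calH_translate tau0 dz lf lg fg) mulf_neq0 ?kern_neq0 ?outer_neq0.
Qed.

Lemma min_phase_translated (f : R -> R[i]) : min_phase f -> translated_min_phase f.
Proof.
move=> mf; split; first by case: mf.
exists f, 0; split => //; apply: aeW => t Ht.
by rewrite /translate subr0 ifT//; apply/RplusE.
Qed.

Lemma min_phase_poly (f : R -> R[i]) a n : disk a -> L2 f ->
  (forall z, disk z -> calH f z = (1 - a * z) ^+ n) -> min_phase f.
Proof. by move=> da lf fE; split=> //; apply: outer_poly da fE _; exact: H2_calH. Qed.

Lemma calHinvP (f : R -> R[i]) (F : R[i] -> R[i]) : L2 f ->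
  (forall z, disk z -> calH f z = F z) -> eqL2 f (calHinv F).
Proof.
move=> lf fF; have [lg gF] : [set f | L2 f /\ forall z, disk z -> calH f z = F z] (calHinv F).
  by apply: (@xgetPex _ (fun=> 0)); exists f.
by apply: calH_inj => // z dz; rewrite fF// gF.
Qed.

Section Evaluation.
Variables (A : (R -> R[i]) -> R -> R[i]).
Hypothesis A_bounded : bounded_linear_L2 A.
Hypothesis A_pres : forall f, translated_min_phase f -> translated_min_phase (A f).

(** The functional [f |-> calH (A f) z] does not vanish on the preimages of
    [(1 - a w) ^ n], because [A] maps them to translates of minimum phase functions. *)
Lemma calH_operator z : disk z ->
  let psi := calH (A rho0) z in let phi := calH (A rho1) z / psi in
  [/\ psi != 0, disk phi & forall f, L2 f -> calH (A f) z = psi * calH f phi].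
Proof.
move=> dz /=.
have [K K0 bK] := bounded_n2 A_bounded; have [C C0 bC] := calH_bounded dz.
pose L f := calH (A f) z.
have L_lin a f g : L2 f -> L2 g -> L (fun t => a * f t + g t) = a * L f + L g.
  move=> lf lg; have st := blL2_stable A_bounded.
  rewrite /L -calH_lin//; [|exact: st|exact: st].
  apply: calH_eqL2 => //; [exact/st/L2_lin|apply: L2_lin; exact: st|].
  exact: (blL2_linear A_bounded).
have L_bounded f : L2 f -> Normc.normc (L f) ^+ 2 <= (C * K) * n2 f.
  move=> lf; apply: le_trans (bC _ (blL2_stable A_bounded lf)) _.
  by rewrite -mulrA ler_wpM2l// bK.
have L0 n a f : disk a -> L2 f ->
    (forall w, disk w -> calH f w = (1 - a * w) ^+ n) -> L f != 0.
  move=> da lf fE; apply: translated_min_phase_neq0 dz; apply: A_pres.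
  exact/min_phase_translated/(min_phase_poly da lf fE).
have r0 : L (fun t => (rho 0 t)%:C) = calH (A rho0) z.
  by congr (calH (A _) z); apply/funext => t; exact: rho0E.
have r1 : L (fun t => (rho 1 t)%:C) = calH (A rho1) z.
  by congr (calH (A _) z); apply/funext => t; exact: rho1E.
rewrite -r0 -r1; split.
- exact: (functional_rho0_neq0 L0).
- exact: (functional_point_disk L_lin L_bounded L0).
- exact: (functional_evaluation L_lin L_bounded L0).
Qed.

End Evaluation.
End Operator.

Theorem theorem5 (R : realType) (A : (R -> R[i]) -> R -> R[i])
    (A_bounded : bounded_linear_L2 A)
    (A_pres : forall f, translated_min_phase f -> translated_min_phase (A f)) :
  let psi : R[i] -> R[i] := calH (A rho0) in
  let phi : R[i] -> R[i] := fun z => calH (A rho1) z / calH (A rho0) z in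
  [/\ forall z, disk z -> psi z != 0,
      analytic_disk psi,
      analytic_disk phi,
      forall z, disk z -> disk (phi z) &
      forall f, L2 f ->
        H2 (Mop psi (Cop phi (calH f))) /\
        eqL2 (A f) (calHinv (Mop psi (Cop phi (calH f))))].
Proof.
have E z (dz : disk z) := calH_operator A_bounded A_pres dz.
have st := blL2_stable A_bounded.
have l0 : L2 (@rho0 R).
  by rewrite (_ : rho0 = fun t => (rho 0 t)%:C%C) ?funeqE//; [exact: L2_rho|move=> t; rewrite rho0E].
have l1 : L2 (@rho1 R).
  by rewrite (_ : rho1 = fun t => (rho 1 t)%:C%C) ?funeqE//; [exact: L2_rho|move=> t; rewrite rho1E].
split.
- by move=> z /E[].
- exact/analytic_calH/st.
- move=> z dz; have [p0 _ _] := E z dz.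
  apply: derivableM; first exact: (analytic_calH (st _ l1) dz).
  by apply: derivableV => //; exact: (analytic_calH (st _ l0) dz).
- by move=> z /E[].
- move=> f lf.
  have AfE z : disk z -> calH (A f) z =
      Mop (calH (A rho0)) (Cop (fun z => calH (A rho1) z / calH (A rho0) z) (calH f)) z.
    by move=> /E[_ _]; exact.
  split; first exact: eq_H2 AfE (H2_calH (st _ lf)).
  exact: calHinvP (st _ lf) AfE.
Qed.
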